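(* Let $n\ge 2$ be an integer, let $\mathcal{O}_n$ be the Cuntz algebra, let $\mathcal{O}_n^{\mathbb{T}}$ be the fixed-point algebra of its canonical gauge action, and let $E:\mathcal{O}_n\to\mathcal{O}_n^{\mathbb{T}}$ be the conditional expectation obtained by averaging the gauge action over $\mathbb{T}$. Then the inclusion $\mathcal{O}_n^{\mathbb{T}}\overset{E}{\subset}\mathcal{O}_n$ is irreducible and C*-discrete. Moreover, there is an outer action $F$ of $\mathbb{Z}$ on $\mathcal{O}_n^{\mathbb{T}}$ by dualizable bimodules such that $$\mathcal{O}_n\cong\mathcal{O}_n^{\mathbb{T}}\rtimes_{r,F}\mathbb{C}[\mathbb{Z}],$$ the reduced crossed product by $F$ under the group C*-algebra object $\mathbb{C}[\mathbb{Z}]$.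
   Context: $\mathcal{O}_n$ is the universal C*-algebra generated by $s_1,\dots,s_n$ with $s_i^*s_j=\delta_{i=j}1$ and $\sum_i s_is_i^*=1$. The gauge action of $\mathbb{T}$ is $z\cdot s_j=zs_j$, and $E$ is its average against normalized Haar measure (a faithful conditional expectation). One has $\mathcal{O}_n^{\mathbb{T}}\cong M_{n^\infty}$, the UHF algebra. Bimodules. For a unital C*-algebra $A$, a right C*-correspondence over $A$ is a right Hilbert $A$-module $X$ (inner product $\langle\cdot\mid\cdot\rangle_A$, linear in the second variable) with a unital $*$-homomorphism from $A$ into the adjointable operators. Left C*-correspondences are defined symmetrically, with inner product ${}_A\langle\cdot,\cdot\rangle$ linear in the first variable. A right C*-correspondence $X$ lies in $\mathsf{Bim_{fgp}}(A)$ (is dualizable, or fgp) if it also carries a left $A$-valued inner product making it a left C*-correspondence, the two inner products induce equivalent norms, and $X$ has a finite right Pimsner–Popa basis $\{u_i\}$ ($\xi=\sum_iu_i\lhd\langle u_i\mid\xi\rangle_A$) and a finite left Pimsner–Popa basis $\{v_j\}$ ($\xi=\sum_j{}_A\langle\xi,v_j\rangle\rhd v_j$). Morphisms are adjointable bimodule maps. Inclusions. Let $A\subset B$ be a unital inclusion of C*-algebras with a faithful conditional expectation $E:B\to A$. It is irreducible if $A'\cap B=\mathbb{C}1$. The projective quasi-normalizer $\mathsf{PQN}(A\subset B)$ is the set of $b\in B$ that lie in some $A$-$A$ sub-bimodule $K\subset B$ which, with right inner product $\langle x\mid y\rangle_A=E(x^*y)$, belongs to $\mathsf{Bim_{fgp}}(A)$.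 The inclusion is C*-discrete if $\mathsf{PQN}(A\subset B)$ is norm-dense in $B$. Actions and crossed products. $\mathsf{Hilb_{fd}}(\mathbb{Z})$ is the unitary tensor category of finite-dimensional $\mathbb{Z}$-graded Hilbert spaces, with simple objects $\mathbb{C}_k$ and $\mathbb{C}_k\otimes\mathbb{C}_\ell=\mathbb{C}_{k+\ell}$. An action of $\mathbb{Z}$ on $A$ by dualizable bimodules is a unitary tensor functor $F:\mathsf{Hilb_{fd}}(\mathbb{Z})\to\mathsf{Bim_{fgp}}(A)$. It thus gives bimodules $F(\mathbb{C}_k)$ with $F(\mathbb{C}_0)=A$ and unitary bimodule maps $F^2_{k,\ell}:F(\mathbb{C}_k)\boxtimes_AF(\mathbb{C}_\ell)\to F(\mathbb{C}_{k+\ell})$ satisfying associativity and unitality. It is outer if $F$ is fully faithful. $\mathbb{C}[\mathbb{Z}]$ is the connected C*-algebra object with $\mathbb{C}[\mathbb{Z}](k)=\mathbb{C}$ for every $k$ and the group multiplication. The algebraic direct sum $\bigoplus_kF(\mathbb{C}_k)\otimes\mathbb{C}[\mathbb{Z}](k)=\bigoplus_kF(\mathbb{C}_k)$ is a unital $*$-algebra with product $\xi\cdot\eta=F^2_{k,\ell}(\xi\boxtimes\eta)$ for $\xi\in F(\mathbb{C}_k)$, $\eta\in F(\mathbb{C}_\ell)$, and with $\xi^*\in F(\mathbb{C}_{-k})$ determined by $\xi^*\cdot\eta=\langle\xi\mid\eta\rangle_A$ for $\eta\in F(\mathbb{C}_k)$. The reduced crossed product $A\rtimes_{r,F}\mathbb{C}[\mathbb{Z}]$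 is its completion in the operator norm of left multiplication on the right Hilbert $A$-module direct sum of the $F(\mathbb{C}_k)$. *)

(* Defs.v *)
From mathcomp Require Import all_boot all_order all_algebra.
From mathcomp Require Import all_classical all_reals all_analysis.
From mathcomp Require Import complex.

Set Implicit Arguments.
Unset Strict Implicit.
Unset Printing Implicit Defensive.
#[local] Obligation Tactic := idtac.

Import Order.TTheory GRing.Theory Num.Theory.
Import numFieldNormedType.Exports.

Local Open Scope classical_set_scope.
Local Open Scope ring_scope.
Local Open Scope complex_scope.

(* MathComp-Analysis has no normed algebras, and Hierarchy Builder refuses the
   join of a ring with a normed module because it lies below numDomainType.
   Norms are therefore explicit real-valued functions, and the metric notions
   are relative to such a function. *)
Section Norms.
Variables (R : realType) (V : zmodType) (N : V -> R).

Definition ncvg (u : nat -> V) (l : V) : Prop :=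
  (fun n => N (u n - l)) @ \oo --> (0 : R).

Definition ncauchy (u : nat -> V) : Prop :=
  forall e : R, 0 < e -> exists K : nat, forall i j : nat,
    (K <= i)%N -> (K <= j)%N -> N (u i - u j) < e.

Definition ncomplete : Prop :=
  forall u, ncauchy u -> exists l, ncvg u l.

Definition nclosed (S : set V) : Prop :=
  forall u l, (forall n, S (u n)) -> ncvg u l -> S l.

Definition ndense (S : set V) : Prop :=
  forall (x : V) (e : R), 0 < e -> exists y, S y /\ N (x - y) < e.

End Norms.

Section CStarAlgebras.
Variable R : realType.

(* Unital C*-algebras.  A MathComp algebra is a nonzero ring, so the zero
   algebra is excluded. *)
Record cstarAlg := CStarAlg {
  cstar_alg :> algType R[i];
  cnorm : cstar_alg -> R;
  star : cstar_alg -> cstar_alg;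
  cnorm0_eq0 : forall a, cnorm a = 0 -> a = 0;
  cnormD : forall a b, cnorm (a + b) <= cnorm a + cnorm b;
  cnormZ : forall (c : R[i]) a, cnorm (c *: a) = Normc.normc c * cnorm a;
  cnormM : forall a b, cnorm (a * b) <= cnorm a * cnorm b;
  cnorm_complete : ncomplete cnorm;
  starK : involutive star;
  starD : {morph star : a b / a + b};
  starZ : forall (c : R[i]) a, star (c *: a) = c^*%R *: star a;
  starM : forall a b, star (a * b) = star b * star a;
  cstar_identity : forall a, cnorm (star a * a) = cnorm a ^+ 2
}.

Definition is_star_hom (A B : cstarAlg) (f : A -> B) : Prop :=
  [/\ linear f, monoid_morphism f & {morph f : a / star a}].

Definition is_star_iso (A B : cstarAlg) (f : A -> B) : Prop :=
  is_star_hom f /\ bijective f.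

Definition cpos (A : cstarAlg) (a : A) : Prop :=
  exists b : A, a = star b * b.

Definition star_subalgebra (A : cstarAlg) (S : set A) : Prop :=
  [/\ S 1,
      forall (c : R[i]) a b, S a -> S b -> S (c *: a + b),
      forall a b, S a -> S b -> S (a * b)
    & forall a, S a -> S (star a)].

Definition cuntz_family (n : nat) (A : cstarAlg) (s : 'I_n -> A) : Prop :=
  (forall i j, star (s i) * s j = (i == j)%:R) /\
  \sum_(i < n) s i * star (s i) = 1.

(* (A, s) is universal among the C*-algebras generated by a Cuntz family.
   Generation forces the homomorphism f to be unique. *)
Definition is_cuntz_algebra (n : nat) (A : cstarAlg) (s : 'I_n -> A) : Prop :=
  [/\ cuntz_family s,
      forall S : set A, nclosed (@cnorm A) S -> star_subalgebra S ->
        (forall i, S (s i)) -> S = setT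
    & forall (D : cstarAlg) (t : 'I_n -> D), cuntz_family t ->
        exists f : A -> D, is_star_hom f /\ forall i, f (s i) = t i].

(* Only the values of gam on the unit circle matter. *)
Definition is_gauge_action (n : nat) (A : cstarAlg) (s : 'I_n -> A)
    (gam : R[i] -> A -> A) : Prop :=
  forall z : R[i], `|z| = 1 ->
    is_star_hom (gam z) /\ forall j, gam z (s j) = z *: s j.

Definition fixed_points (A : cstarAlg) (gam : R[i] -> A -> A) : set A :=
  [set a | forall z : R[i], `|z| = 1 -> gam z a = a].

(* Norm-convergent Riemann integral over [0, 1]; t lists the endpoints of a
   partition and c its tags. *)
Definition is_Rint01 (A : cstarAlg) (f : R -> A) (v : A) : Prop :=
  forall e : R, 0 < e -> exists2 d : R, 0 < d &
    forall (m : nat) (t c : nat -> R), t 0%N = 0 -> t m = 1 ->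
      (forall i, (i < m)%N -> t i <= c i <= t i.+1 /\ t i.+1 - t i < d) ->
      cnorm (\sum_(i < m) (t i.+1 - t i)%:C *: f (c i) - v) < e.

(* Normalized Haar measure on the circle is the image of Lebesgue measure on
   [0, 1] under t |-> exp (2 pi i t). *)
Definition is_circle_average (A : cstarAlg) (g : R[i] -> A) (v : A) : Prop :=
  is_Rint01 (fun t => g (cos (2 * pi * t) +i* sin (2 * pi * t))) v.

End CStarAlgebras.

Section Correspondences.
Variables (R : realType) (A : cstarAlg R).

Record bimod := Bimod {
  bimod_lmod :> lmodType R[i];
  lact : A -> bimod_lmod -> bimod_lmod;
  ract : bimod_lmod -> A -> bimod_lmod;
  lact_linearr : forall a, linear (lact a);
  lact_linearl : forall x, linear (lact^~ x);
  lact1 : forall x, lact 1 x = x;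
  lactM : forall a b x, lact (a * b) x = lact a (lact b x);
  ract_linearr : forall x, linear (ract x);
  ract_linearl : forall a, linear (ract^~ a);
  ract1 : forall x, ract x 1 = x;
  ractM : forall x a b, ract x (a * b) = ract (ract x a) b;
  lract : forall a x b, ract (lact a x) b = lact a (ract x b)
}.

Definition hnorm (V : lmodType R[i]) (ip : V -> V -> A) (x : V) : R :=
  Num.sqrt (cnorm (ip x x)).

(* The last conjunct says that a acts by an adjointable operator whose adjoint
   is the action of star a. *)
Definition right_inner (X : bimod) (ip : X -> X -> A) : Prop :=
  [/\ [/\ forall x, linear (ip x),
          forall x y a, ip x (ract y a) = ip x y * a
        & forall x y, star (ip x y) = ip y x],
      [/\ forall x, cpos (ip x x), forall x, ip x x = 0 -> x = 0
        & ncomplete (hnorm ip)]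
    & forall a x y, ip (lact a x) y = ip x (lact (star a) y)].

Definition left_inner (X : bimod) (ip : X -> X -> A) : Prop :=
  [/\ [/\ forall y, linear (ip^~ y),
          forall a x y, ip (lact a x) y = a * ip x y
        & forall x y, star (ip x y) = ip y x],
      [/\ forall x, cpos (ip x x), forall x, ip x x = 0 -> x = 0
        & ncomplete (hnorm ip)]
    & forall a x y, ip (ract x a) y = ip x (ract y (star a))].

(* Right C*-correspondences over A. *)
Record corr := Corr {
  corr_bimod :> bimod;
  rip : corr_bimod -> corr_bimod -> A;
  rip_right_inner : right_inner rip
}.

(* Membership in Bim_fgp(A). *)
Definition fgp (X : corr) : Prop :=
  exists lip : X -> X -> A,
    [/\ left_inner lip,
        exists c C : R, [/\ 0 < c, 0 < C & forall x : X,
          c * hnorm (@rip X) x <= hnorm lip x <= C * hnorm (@rip X) x],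
        exists (m : nat) (u : 'I_m -> X), forall x : X,
          x = \sum_(i < m) ract (u i) (rip (u i) x)
      & exists (m : nat) (v : 'I_m -> X), forall x : X,
          x = \sum_(j < m) lact (lip x (v j)) (v j)].

Definition is_bimod_map (X Y : bimod) (T : X -> Y) : Prop :=
  [/\ linear T, forall a x, T (lact a x) = lact a (T x)
    & forall x a, T (ract x a) = ract (T x) a].

Definition adjointable (X Y : corr) (T : X -> Y) : Prop :=
  exists S : Y -> X, forall x y, rip (T x) y = rip x (S y).

Definition is_unitary (X Y : corr) (T : X -> Y) : Prop :=
  [/\ is_bimod_map T, forall x y, rip (T x) (T y) = rip x y
    & forall y, exists x, T x = y].

Definition trivial_bimod : bimod.
Proof.
refine (@Bimod A (fun a b : A => a * b) (fun a b : A => a * b)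
  _ _ _ _ _ _ _ _ _).
- by move=> a c x y; rewrite mulrDr scalerAr.
- by move=> x c a b; rewrite mulrDl scalerAl.
- exact: mul1r.
- by move=> a b x; rewrite mulrA.
- by move=> a c x y; rewrite mulrDr scalerAr.
- by move=> x c a b; rewrite mulrDl scalerAl.
- exact: mulr1.
- by move=> a b x; rewrite mulrA.
- by move=> a x b; rewrite mulrA.
Defined.

Lemma cnorm_ge0 (a : A) : 0 <= cnorm a.
Proof.
have normcN1 : Normc.normc (-1 : R[i]) = 1.
  by rewrite /= oppr0 expr0n /= addr0 sqrrN expr1n sqrtr1.
have n0 : cnorm (0 : A) = 0.
  by rewrite -(scale0r a) cnormZ /= expr0n /= addr0 sqrtr0 mul0r.
have := cnormD a (- a); rewrite subrr n0 -scaleN1r cnormZ normcN1 mul1r.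
by rewrite -mulr2n pmulrn_lge0.
Qed.

Lemma hnorm_trivial (x : A) : hnorm (fun a b : A => star a * b) x = cnorm x.
Proof. by rewrite /hnorm cstar_identity sqrtr_sqr ger0_norm ?cnorm_ge0. Qed.

Lemma trivial_right_inner :
  @right_inner trivial_bimod (fun a b : A => star a * b).
Proof.
split.
- split=> [x c y z|x y a|x y] /=.
  + by rewrite mulrDr scalerAr.
  + by rewrite mulrA.
  + by rewrite starM starK.
- split=> [x|x /= x0|].
  + by exists x.
  + apply: cnorm0_eq0; apply/eqP; rewrite -sqrf_eq0 -cstar_identity x0.
    by rewrite -(scale0r (1 : A)) cnormZ /= expr0n /= addr0 sqrtr0 mul0r.
  + have -> : hnorm (fun a b : A => star a * b) = @cnorm R A.
      by apply/funext => x; exact: hnorm_trivial.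
    exact: cnorm_complete.
- by move=> a x y /=; rewrite starM mulrA.
Qed.

(* A over itself, with <a | b> = star a * b. *)
Definition trivial_corr : corr := Corr trivial_right_inner.

(* An interior tensor product of X and Y over A, with it_map x y standing for
   the class of x (x) y.  Its completeness as a correspondence and the density
   of the span of the elementary tensors determine it up to unique unitary. *)
Record itensor (X Y : corr) := ITensor {
  it_corr :> corr;
  it_map : X -> Y -> it_corr;
  it_linearr : forall x, linear (it_map x);
  it_linearl : forall y, linear (it_map^~ y);
  it_balanced : forall x a y, it_map (ract x a) y = it_map x (lact a y);
  it_lact : forall a x y, lact a (it_map x y) = it_map (lact a x) y;
  it_ract : forall x y a, ract (it_map x y) a = it_map x (ract y a);
  it_rip : forall x y x' y',
    rip (it_map x y) (it_map x' y') = rip y (lact (rip x x') y');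
  it_dense : ndense (hnorm (@rip it_corr))
    [set w | exists (m : nat) (x : 'I_m -> X) (y : 'I_m -> Y),
      w = \sum_(i < m) it_map (x i) (y i)]
}.

End Correspondences.

Section Inclusions.
Variables (R : realType) (A B : cstarAlg R) (iota : A -> B) (E : B -> A).

(* The inclusion of A in B is an isometric unital *-homomorphism iota. *)
Definition is_inclusion : Prop :=
  is_star_hom iota /\ forall a, cnorm (iota a) = cnorm a.

Definition is_cond_exp : Prop :=
  [/\ linear E, forall a, E (iota a) = a,
      forall a b, E (iota a * b) = a * E b,
      forall b a, E (b * iota a) = E b * a
    & forall b, cpos b -> cpos (E b)].

Definition is_faithful : Prop :=
  forall b, cpos b -> E b = 0 -> b = 0.

Definition irreducible_inclusion : Prop :=
  forall b : B, (forall a, iota a * b = b * iota a) -> exists c : R[i], b = c%:A.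

(* K is given as the image of an abstract member X of Bim_fgp(A) under an
   embedding j which transports the actions and the inner product. *)
Definition is_fgp_subbimodule (K : set B) : Prop :=
  exists (X : corr A) (j : X -> B),
    [/\ fgp X, [/\ linear j, injective j & range j = K],
        forall a x, j (lact a x) = iota a * j x,
        forall x a, j (ract x a) = j x * iota a
      & forall x y, rip x y = E (star (j x) * j y)].

Definition PQN : set B :=
  [set b | exists K : set B, is_fgp_subbimodule K /\ K b].

Definition cstar_discrete : Prop := ndense (@cnorm R B) PQN.

End Inclusions.

(* Hilb_fd(Z), with each object presented in an orthonormal basis of homogeneous
   vectors: the graded Hilbert space with basis gidx H, the basis vector i being
   of degree gdeg i.  Morphisms are the degree-preserving matrices. *)
Section GradedHilbertSpaces.
Variable R : realType.

Record ghilb := GHilb { gidx :> finType; gdeg : gidx -> int }.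

Record ghom (H K : ghilb) := GHom {
  gmx :> K -> H -> R[i];
  ghom_deg : forall j i, gdeg j != gdeg i -> gmx j i = 0
}.

Program Definition gid (H : ghilb) : ghom H H :=
  @GHom H H (fun j i => (j == i)%:R) _.
Next Obligation.
by move=> H j i; have [->|] := eqVneq j i; rewrite ?eqxx.
Qed.

Program Definition gcomp (H K L : ghilb) (g : ghom K L) (f : ghom H K) :
    ghom H L :=
  @GHom H L (fun l i => \sum_(k : K) g l k * f k i) _.
Next Obligation.
move=> H K L g f l i li /=; apply: big1 => k _.
have [lk|lk] := eqVneq (gdeg l) (gdeg k); last by rewrite (ghom_deg g) ?mul0r.
by rewrite (ghom_deg f) ?mulr0 // -lk.
Qed.

Program Definition glin (H K : ghilb) (c : R[i]) (f g : ghom H K) : ghom H K :=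
  @GHom H K (fun j i => c * f j i + g j i) _.
Next Obligation.
by move=> H K c f g j i ji /=; rewrite !ghom_deg // mulr0 addr0.
Qed.

Program Definition gadj (H K : ghilb) (f : ghom H K) : ghom K H :=
  @GHom K H (fun i j => (f j i)^*%R) _.
Next Obligation.
by move=> H K f i j ij /=; rewrite (ghom_deg f) ?conjC0 // eq_sym.
Qed.

Definition gtensor (H K : ghilb) : ghilb :=
  @GHilb (H * K)%type (fun i => gdeg i.1 + gdeg i.2).

Program Definition gtensor_hom (H K H' K' : ghilb)
    (f : ghom H H') (g : ghom K K') : ghom (gtensor H K) (gtensor H' K') :=
  @GHom (gtensor H K) (gtensor H' K')
    (fun j i => f j.1 i.1 * g j.2 i.2) _.
Next Obligation.
move=> H K H' K' f g [j j'] [i i'] /= ji.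
have [e|] := eqVneq (gdeg j) (gdeg i); last by move=> ?; rewrite (ghom_deg f) ?mul0r.
by rewrite (ghom_deg g) ?mulr0 //; apply: contraNneq ji => ->; rewrite e.
Qed.

Program Definition gassoc (H K L : ghilb) :
    ghom (gtensor (gtensor H K) L) (gtensor H (gtensor K L)) :=
  @GHom (gtensor (gtensor H K) L) (gtensor H (gtensor K L))
    (fun j i => (j == (i.1.1, (i.1.2, i.2)))%:R) _.
Next Obligation.
move=> H K L j [[i1 i2] i3] /=; case: (eqVneq j (i1, (i2, i3))) => [->|//].
by rewrite /= addrA eqxx.
Qed.

(* The simple object C_k. *)
Definition gline (k : int) : ghilb := @GHilb unit (fun=> k).

Program Definition glunit (H : ghilb) : ghom (gtensor (gline 0) H) H :=
  @GHom (gtensor (gline 0) H) H (fun j i => (j == i.2)%:R) _.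
Next Obligation.
by move=> H j [[] i] /=; case: (eqVneq j i) => [->|]; rewrite ?add0r ?eqxx.
Qed.

Program Definition grunit (H : ghilb) : ghom (gtensor H (gline 0)) H :=
  @GHom (gtensor H (gline 0)) H (fun j i => (j == i.1)%:R) _.
Next Obligation.
by move=> H j [i []] /=; case: (eqVneq j i) => [->|]; rewrite ?addr0 ?eqxx.
Qed.

Program Definition gcast (k l : int) (e : k = l) : ghom (gline k) (gline l) :=
  @GHom (gline k) (gline l) (fun _ _ => 1) _.
Next Obligation.
by move=> k l e _ _ /=; rewrite e eqxx.
Qed.

(* The identification of C_k (x) C_l with C_m, for m = k + l. *)
Program Definition gfuse (k l m : int) (e : k + l = m) :
    ghom (gtensor (gline k) (gline l)) (gline m) :=
  @GHom (gtensor (gline k) (gline l)) (gline m) (fun _ _ => 1) _.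
Next Obligation.
by move=> k l m e _ _ /=; rewrite e eqxx.
Qed.

End GradedHilbertSpaces.

Section Actions.
Variables (R : realType) (A : cstarAlg R).

(* Unitary tensor functors from Hilb_fd(Z) to Bim_fgp(A).  The equality of
   F(C_0) and A is rendered by the unitary za_unit; za_box H K is the interior
   tensor product of F(H) and F(K), and za_mu is F^2.  The coherence conditions
   are stated on elementary tensors. *)
Record zaction := ZAction {
  za_obj :> ghilb -> corr A;
  za_fgp : forall H, fgp (za_obj H);
  za_map : forall H K, ghom R H K -> za_obj H -> za_obj K;
  za_bimod : forall H K (f : ghom R H K), is_bimod_map (za_map f);
  za_id : forall H x, za_map (gid R H) x = x;
  za_comp : forall H K L (g : ghom R K L) (f : ghom R H K) x,
    za_map (gcomp g f) x = za_map g (za_map f x);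
  za_lin : forall H K c (f g : ghom R H K) x,
    za_map (glin c f g) x = c *: za_map f x + za_map g x;
  za_adj : forall H K (f : ghom R H K) x y,
    rip (za_map f x) y = rip x (za_map (gadj f) y);
  za_unit : trivial_corr A -> za_obj (gline 0);
  za_unit_unitary : is_unitary za_unit;
  za_box : forall H K, itensor (za_obj H) (za_obj K);
  za_mu : forall H K, za_box H K -> za_obj (gtensor H K);
  za_mu_unitary : forall H K, is_unitary (@za_mu H K);
  za_mu_nat : forall H K H' K' (f : ghom R H H') (g : ghom R K K') x y,
    za_mu (it_map (za_box H' K') (za_map f x) (za_map g y)) =
    za_map (gtensor_hom f g) (za_mu (it_map (za_box H K) x y));
  za_mu_assoc : forall H K L x y z,
    za_map (gassoc R H K L)
      (za_mu (it_map (za_box _ L) (za_mu (it_map (za_box H K) x y)) z)) =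
    za_mu (it_map (za_box H _) x (za_mu (it_map (za_box K L) y z)));
  za_mu_lunit : forall H (a : A) x,
    za_map (glunit R H) (za_mu (it_map (za_box _ H) (za_unit a) x)) = lact a x;
  za_mu_runit : forall H x (a : A),
    za_map (grunit R H) (za_mu (it_map (za_box H _) x (za_unit a))) = ract x a
}.

(* Full faithfulness, the morphisms of Bim_fgp(A) being the adjointable
   bimodule maps. *)
Definition outer_action (F : zaction) : Prop :=
  forall (H K : ghilb) (T : F H -> F K), is_bimod_map T -> adjointable T ->
    exists! f : ghom R H K, forall x, za_map f x = T x.

End Actions.

Section CrossedProduct.
Variables (R : realType) (A : cstarAlg R) (F : zaction A).

(* Families (x_k)_k with x_k in F(C_k); the algebraic direct sum consists of the
   finitely supported ones.  Since C[Z](k) is the field of scalars for every k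
   and its multiplication is that of the group, it does not appear. *)
Definition zfam := forall k : int, F (gline k).

Definition finsupp (x : zfam) : Prop := finite_set [set k | x k != 0].

Definition cp_prod (k l m : int) (e : k + l = m)
    (x : F (gline k)) (y : F (gline l)) : F (gline m) :=
  za_map (gfuse R e) (za_mu (it_map (za_box F _ _) x y)).

(* The element z of F(C_l), for l = - k, such that z . y = <x | y> for all y in
   F(C_k). *)
Definition cp_dagger (k l : int) (e : l + k = 0) (x : F (gline k)) :
    F (gline l) :=
  xget 0 [set z | forall y, cp_prod e z y = za_unit F (rip x y)].

Definition cp_in (k : int) (x : F (gline k)) : zfam := fun m =>
  if k =P m is ReflectT e then za_map (gcast R e) x else 0.

Definition cp_one : zfam := cp_in (za_unit F 1).

Lemma subzKC (k m : int) : k + (m - k) = m.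
Proof. by rewrite addrC subrK. Qed.

(* A finite sum as soon as x is finitely supported. *)
Definition cp_mul (x y : zfam) : zfam := fun m =>
  \sum_(k \in [set: int]) cp_prod (subzKC k m) (x k) (y (m - k)).

Definition cp_star (x : zfam) : zfam := fun m =>
  cp_dagger (subrr m) (x (- m)).

(* eta lies in the right Hilbert A-module direct sum of the F(C_k), and
   a = <eta | eta>; the terms being positive, symmetric partial sums suffice. *)
Definition hsum_sq (eta : zfam) (a : A) : Prop :=
  ncvg (@cnorm R A)
    (fun N => \sum_(i < N.*2.+1)
       rip (eta (i%:Z - N%:Z)) (eta (i%:Z - N%:Z))) a.

Definition lmul_bound (x : zfam) (M : R) : Prop :=
  forall eta a, hsum_sq eta a -> exists b,
    hsum_sq (cp_mul x eta) b /\ Num.sqrt (cnorm b) <= M * Num.sqrt (cnorm a).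

(* M is the operator norm of left multiplication by x. *)
Definition is_lmul_norm (x : zfam) (M : R) : Prop :=
  [/\ 0 <= M, lmul_bound x M & forall M', 0 <= M' -> lmul_bound x M' -> M <= M'].

(* D, with the canonical map P from the algebraic direct sum (the values of P
   outside of it are irrelevant), is the completion of the *-algebra of finitely
   supported families in the operator norm. *)
Definition is_reduced_crossed_product (D : cstarAlg R) (P : zfam -> D) : Prop :=
  [/\ [/\ forall (c : R[i]) x y, finsupp x -> finsupp y ->
            P (fun k => c *: x k + y k) = c *: P x + P y,
          forall x y, finsupp x -> finsupp y -> P (cp_mul x y) = P x * P y,
          P cp_one = 1
        & forall x, finsupp x -> P (cp_star x) = star (P x)],
      forall x, finsupp x -> is_lmul_norm x (cnorm (P x))
    & ndense (@cnorm R D) [set P x | x in finsupp]].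

End CrossedProduct.

(* Main.v *)
(** Kaplansky's argument gives positivity of b^* b without spectral theory, so
    closedness of the cone, contractivity of *-homomorphisms and spectral
    permanence reduce to power series for square roots.  E is the limit of finite
    averages over roots of unity, and positivity makes it faithful: x >= 0
    dominates a fixed part of its average over a short arc.

    Compressing an element of the relative commutant by the isometry s_1^m s_2
    preserves its norm, and for large m sends every short monomial to a scalar;
    by density the relative commutant is scalar.

    The spectral subspaces O_k of the gauge action have finite Pimsner-Popa bases
    (words of length |k|, or the adjoint of one such word), hence they are fgp
    and O_k O_l = O_(k+l), so multiplication realises the interior tensor products
    and F(C_k) = O_k is an action.  A bimodule map O_k -> O_l is left
    multiplication by an element of the relative commutant, hence a scalar.

    The crossed product is O itself: left multiplication by X on the Hilbert
    module of finite sums has norm |X|, because for a = X^* X of degree at most d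
    one has |a^m| <= (m d + 1) |E(a^m)|, the average over more than m d roots of
    unity being exact. *)

Require Import Defs.
From HB Require Import structures.
From mathcomp Require Import all_boot all_order all_algebra.
From mathcomp Require Import all_classical all_reals all_analysis.
From mathcomp Require Import complex ring lra zify.
From Stdlib Require Ncring Ncring_tac.

Set Implicit Arguments.
Unset Strict Implicit.
Unset Printing Implicit Defensive.

Import Order.TTheory GRing.Theory Num.Theory.
Import numFieldNormedType.Exports.

Local Open Scope classical_set_scope.
Local Open Scope ring_scope.
Local Open Scope complex_scope.

(** No representation of [O] is at hand, [A] is an abstract algebra embedded isometrically, and
    [gam] is prescribed only on the generators: neither its continuity nor [gam 1 = id] is given.
    Hence positivity is expressed by norms, which makes it the same in [A] and in [O], and facts
    about [gam] are checked on monomials and carried to [O] by density and contractivity of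
    *-homomorphisms.

    That left multiplication by X has norm no smaller than |X| usually follows from injective
    *-homomorphisms being isometric, which rests on functional calculus. Growth rates replace it. If
    the operator norm had a square c < |a|, raising an even power of a by one would cost at most c
    instead of |a|, so that |E(a^(2m))| <= (c |a|)^m; along powers of two this contradicts the lower
    bound |a|^(2m), which holds up to a factor linear in m. *)

Section NoncommutativeRingTactic.
Variable A : nzRingType.

Definition ncring_ops : @Ncring.Ring_ops A 0 1 (@GRing.add A) (@GRing.mul A)
  (fun x y => x - y) (@GRing.opp A) eq :=
  @Ncring.Build_Ring_ops A 0 1 _ _ _ _ _.

Definition ncring_ring : @Ncring.Ring A 0 1 (@GRing.add A) (@GRing.mul A)
  (fun x y => x - y) (@GRing.opp A) eq ncring_ops.
Proof.
split.
all: try (solve [typeclasses eauto]).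
all: try (by move=> ? ? -> ? ? ->).
all: try (by move=> ? ? ->).
- exact: add0r.
- exact: addrC.
- exact: addrA.
- exact: mul1r.
- exact: mulr1.
- exact: mulrA.
- exact: mulrDl.
- by move=> x y z; exact: mulrDr.
- by [].
- exact: subrr.
Qed.
End NoncommutativeRingTactic.
#[local] Existing Instances ncring_ops ncring_ring.

Ltac ncring := Ncring_tac.non_commutative_ring.

(** * Positivity in C*-algebras *)

Section CStarNorm.
Variables (R : realType) (A : cstarAlg R).
Implicit Types (a b c : A) (x t : R).

Lemma normc_real x : Normc.normc x%:C = `|x|.
Proof. by rewrite /= expr0n /= addr0 sqrtr_sqr. Qed.

Lemma cnormZr x a : cnorm (x%:C *: a) = `|x| * cnorm a.
Proof. by rewrite cnormZ normc_real. Qed.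

Lemma cnorm0 : cnorm (0 : A) = 0.
Proof. by rewrite -(scale0r (0 : A)) -[0 : R[i]]/(0 : R)%:C cnormZr normr0 mul0r. Qed.

Lemma cnormN a : cnorm (- a) = cnorm a.
Proof.
have -> : - a = (-1 : R)%:C *: a by rewrite rmorphN1 scaleN1r.
by rewrite cnormZr normrN1 mul1r.
Qed.

Lemma cnormB a b : cnorm (a - b) <= cnorm a + cnorm b.
Proof. by rewrite -(cnormN b) cnormD. Qed.

Lemma cnorm_distC a b : cnorm (a - b) = cnorm (b - a).
Proof. by rewrite -cnormN opprB. Qed.

Lemma cnorm_triangle b a c : cnorm (a - c) <= cnorm (a - b) + cnorm (b - c).
Proof. by rewrite -[a - c](subrKA b) cnormD. Qed.

Lemma cnorm_sum I (r : seq I) (P : pred I) (F : I -> A) :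
  cnorm (\sum_(i <- r | P i) F i) <= \sum_(i <- r | P i) cnorm (F i).
Proof.
elim/big_rec2: _ => [|i y x Pi]; first by rewrite cnorm0.
by move=> h; apply: le_trans (cnormD _ _) _; rewrite lerD2l.
Qed.

Lemma star0 : star (0 : A) = 0.
Proof. by rewrite -(scale0r (0 : A)) starZ conjC0 !scale0r. Qed.

Lemma starN a : star (- a) = - star a.
Proof. by rewrite -scaleN1r starZ conjCN1 scaleN1r. Qed.

Lemma starB a b : star (a - b) = star a - star b.
Proof. by rewrite starD starN. Qed.

Lemma star1 : star (1 : A) = 1.
Proof. by rewrite -[LHS]mulr1 -[X in _ * X]starK -starM mulr1 starK. Qed.

Lemma star_sum I (r : seq I) (P : pred I) (F : I -> A) :
  star (\sum_(i <- r | P i) F i) = \sum_(i <- r | P i) star (F i).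
Proof. exact: (big_morph _ (@starD _ A) star0). Qed.

Lemma starZr x a : star (x%:C *: a) = x%:C *: star a.
Proof. by rewrite starZ; congr (_ *: _); apply/CrealP; rewrite complex_real. Qed.

Lemma starX a m : star (a ^+ m) = star a ^+ m.
Proof. by elim: m => [|m IH]; rewrite ?expr0 ?star1 // exprSr starM IH -exprS. Qed.

Lemma cnorm_star a : cnorm (star a) = cnorm a.
Proof.
have le b : cnorm b <= cnorm (star b).
  have [->|nz] := eqVneq (cnorm b) 0; first exact: cnorm_ge0.
  have p : 0 < cnorm b by rewrite lt_def nz cnorm_ge0.
  rewrite -(ler_pM2r p) -expr2 -cstar_identity; exact: cnormM.
by apply/eqP; rewrite eq_le le -{2}(starK a) le.
Qed.

Lemma cnorm_sa_sqr a : star a = a -> cnorm (a * a) = cnorm a ^+ 2.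
Proof. by move=> h; rewrite -cstar_identity h. Qed.

Lemma cnorm_eq0 a : (cnorm a == 0) = (a == 0).
Proof. by apply/eqP/eqP => [/cnorm0_eq0|->]; rewrite ?cnorm0. Qed.

Lemma cnorm1 : cnorm (1 : A) = 1.
Proof.
have := cnorm_sa_sqr star1; rewrite mulr1 expr2 => /eqP.
rewrite -{1}[cnorm _]mulr1 => /eqP/mulfI h; apply/esym/h.
by rewrite cnorm_eq0 oner_eq0.
Qed.

Lemma cnormX a m : cnorm (a ^+ m) <= cnorm a ^+ m.
Proof.
elim: m => [|m IH]; first by rewrite !expr0 cnorm1.
rewrite !exprS; apply: le_trans (cnormM _ _) _.
by rewrite ler_wpM2l ?cnorm_ge0.
Qed.

Lemma cnorm_rs x : cnorm (x%:C%:A : A) = `|x|.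
Proof. by rewrite cnormZr cnorm1 mulr1. Qed.

Lemma star_rs x : star (x%:C%:A : A) = x%:C%:A.
Proof. by rewrite starZr star1. Qed.

Lemma star_mul_eq0 a : star a * a = 0 -> a = 0.
Proof.
move=> h; apply/eqP; rewrite -cnorm_eq0 -sqrf_eq0 -cstar_identity h.
by rewrite cnorm0.
Qed.

Lemma sa_sqr_eq0 a : star a = a -> a * a = 0 -> a = 0.
Proof. by move=> sa h; apply: star_mul_eq0; rewrite sa. Qed.

Lemma cnorm_small a : (forall e, 0 < e -> cnorm a <= e) -> a = 0.
Proof.
move=> h; apply: cnorm0_eq0; apply/le_anti; rewrite cnorm_ge0 andbT.
by apply/ler_addgt0Pr => e e0; rewrite add0r h.
Qed.

Lemma ncvgP (u : nat -> A) a :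
  ncvg (@cnorm R A) u a <->
  forall e : R, 0 < e -> exists K, forall i, (K <= i)%N -> cnorm (u i - a) < e.
Proof.
split=> [h e e0|h].
  have /cvgrPdist_lt/(_ e e0) [K _ HK] := h; exists K => i Ki.
  have := HK i Ki; rewrite sub0r normrN ger0_norm ?cnorm_ge0 //.
apply/cvgrPdist_lt => e e0; have [K HK] := h e e0; exists K => // i Ki.
by rewrite sub0r normrN ger0_norm ?cnorm_ge0 // HK.
Qed.

Lemma ncvg_uniq (u : nat -> A) a b :
  ncvg (@cnorm R A) u a -> ncvg (@cnorm R A) u b -> a = b.
Proof.
move=> /ncvgP ha /ncvgP hb; apply/eqP; rewrite -subr_eq0; apply/eqP.
apply: cnorm_small => e e0; have e2 : 0 < e / 2 by rewrite divr_gt0.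
have [K HK] := ha _ e2; have [L HL] := hb _ e2.
apply: le_trans (cnorm_triangle (u (maxn K L)) _ _) _.
rewrite cnorm_distC [leRHS](splitr e) lerD // ltW //.
  by rewrite HK // leq_maxl.
by rewrite HL // leq_maxr.
Qed.

Lemma ncvgD (u v : nat -> A) a b :
  ncvg (@cnorm R A) u a -> ncvg (@cnorm R A) v b ->
  ncvg (@cnorm R A) (fun i => u i + v i) (a + b).
Proof.
move=> /ncvgP ha /ncvgP hb; apply/ncvgP => e e0.
have e2 : 0 < e / 2 by rewrite divr_gt0.
have [K HK] := ha _ e2; have [L HL] := hb _ e2.
exists (maxn K L) => i; rewrite geq_max => /andP[Ki Li].
rewrite opprD addrACA; apply: le_lt_trans (cnormD _ _) _.
by rewrite [ltRHS](splitr e) ltrD ?HK ?HL.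
Qed.

Lemma ncvg_lip (B : cstarAlg R) (f : A -> B) (C : R) (u : nat -> A) a :
  (forall b c, cnorm (f b - f c) <= C * cnorm (b - c)) ->
  ncvg (@cnorm R A) u a -> ncvg (@cnorm R B) (fun i => f (u i)) (f a).
Proof.
move=> hf /ncvgP ha.
have C1 : 0 < `|C| + 1 by rewrite ltr_wpDl.
rewrite /ncvg; apply/cvgrPdist_lt => e e0.
have [K HK] := ha _ (divr_gt0 e0 C1); exists K => // i Ki.
rewrite sub0r normrN ger0_norm ?cnorm_ge0 //.
apply: le_lt_trans (hf _ _) _; have := HK i Ki.
rewrite ltr_pdivlMr // mulrC; apply: le_lt_trans.
rewrite ler_wpM2r ?cnorm_ge0 // (le_trans (ler_norm C)) // lerDl //.
Qed.

Lemma ncvg_star (u : nat -> A) a :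
  ncvg (@cnorm R A) u a -> ncvg (@cnorm R A) (fun i => star (u i)) (star a).
Proof.
by apply: (@ncvg_lip A (@star R A) 1) => b c; rewrite mul1r -starB cnorm_star.
Qed.

Lemma ncvg_mull b (u : nat -> A) a :
  ncvg (@cnorm R A) u a -> ncvg (@cnorm R A) (fun i => b * u i) (b * a).
Proof.
by apply: (@ncvg_lip A ( *%R b) (cnorm b)) => c d; rewrite -mulrBr cnormM.
Qed.

Lemma ncvg_mulr b (u : nat -> A) a :
  ncvg (@cnorm R A) u a -> ncvg (@cnorm R A) (fun i => u i * b) (a * b).
Proof.
by apply: (@ncvg_lip A ( *%R^~ b) (cnorm b)) => c d; rewrite -mulrBl mulrC cnormM.
Qed.

Lemma ncvg_scale (z : R[i]) (u : nat -> A) a :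
  ncvg (@cnorm R A) u a -> ncvg (@cnorm R A) (fun i => z *: u i) (z *: a).
Proof.
by apply: (@ncvg_lip A ( *:%R z) (Normc.normc z)) => c d; rewrite -scalerBr cnormZ.
Qed.

Lemma ncvg_cst a : ncvg (@cnorm R A) (fun=> a) a.
Proof.
by apply/ncvgP => e e0; exists 0%N => i _; rewrite subrr cnorm0.
Qed.

Lemma ncvg_shift (u : nat -> A) a :
  ncvg (@cnorm R A) u a -> ncvg (@cnorm R A) (fun i => u i.+1) a.
Proof.
move=> /ncvgP h; apply/ncvgP => e e0; have [K HK] := h e e0.
by exists K => i Ki; rewrite HK // ltnW.
Qed.

Lemma ncvg_bound (u : nat -> A) a b C : ncvg (@cnorm R A) u a ->
  (forall i, cnorm (b - u i) <= C) -> cnorm (b - a) <= C.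
Proof.
move=> /ncvgP h hC; apply/ler_addgt0Pr => e e0; have [K HK] := h e e0.
apply: le_trans (cnorm_triangle (u K) _ _) _.
by rewrite lerD ?hC // ltW // HK.
Qed.

End CStarNorm.

(** * Square roots near the identity *)

Section SquareRoot.
Variables (R : realType) (A : cstarAlg R).
Implicit Types (a b c d p q x y : A) (r t : R).

Lemma ncvgM (u v : nat -> A) a b :
  ncvg (@cnorm R A) u a -> ncvg (@cnorm R A) v b ->
  ncvg (@cnorm R A) (fun i => u i * v i) (a * b).
Proof.
move=> hu hv.
have null : ncvg (@cnorm R A) (fun i => (u i - a) * (v i - b)) 0.
  apply/ncvgP => e e0; move/ncvgP: hu => hu; move/ncvgP: hv => hv.
  have [K HK] := hu _ e0; have [L HL] := hv _ ltr01.
  exists (maxn K L) => i; rewrite geq_max => /andP[/HK Ki /HL Li].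
  rewrite subr0; apply: le_lt_trans (cnormM _ _) _.
  apply: le_lt_trans Ki; rewrite -[leRHS]mulr1 ler_wpM2l ?cnorm_ge0 //.
  exact: ltW.
have := ncvgD null (ncvgD (ncvg_mull a hv) (ncvg_mulr b hu)).
have := ncvg_cst (- (a * b)) => cab /ncvgD/(_ cab).
have -> : 0 + (a * b + a * b) + - (a * b) = a * b by rewrite add0r addrK.
congr ncvg; apply/funext => i; ncring.
Qed.

(* Newton-type iteration for 1 - sqrt(1 - a), dominated by the scalar iteration
   [sqrt_dom], which is the case a = 1. *)
Fixpoint sqrt_iter (a : A) (m : nat) : A :=
  if m is k.+1 then (2^-1)%:C *: (a + sqrt_iter a k * sqrt_iter a k) else 0.

Fixpoint sqrt_dom (m : nat) : R :=
  if m is k.+1 then 2^-1 * (1 + sqrt_dom k * sqrt_dom k) else 0.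

Lemma sqrt_dom_bound m : 0 <= sqrt_dom m <= 1.
Proof. by elim: m => [|m /andP[h0 h1]] /=; rewrite ?lexx ?ler01 //; nra. Qed.

Lemma sqrt_dom_incr : {homo sqrt_dom : m k / (m <= k)%N >-> m <= k}.
Proof.
apply: homo_leq => // [x y z|m]; first exact: le_trans.
by have /andP[h0 h1] := sqrt_dom_bound m; rewrite /=; nra.
Qed.

Lemma sqrt_iter_comm a b m : GRing.comm b a -> GRing.comm b (sqrt_iter a m).
Proof.
move=> h; elim: m => [|m IH] /=; first exact: commr0.
rewrite /GRing.comm -scalerAr -scalerAl; congr (_ *: _).
by apply: commrD => //; apply: commrM.
Qed.

Lemma sqrt_iter_star a m : star a = a -> star (sqrt_iter a m) = sqrt_iter a m.
Proof.
by move=> h; elim: m => [|m IH] /=; rewrite ?star0 // starZr starD starM IH h.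
Qed.

Lemma half_gt0 : 0 < 2^-1 :> R. Proof. by rewrite invr_gt0. Qed.

Lemma sqrt_iter_norm a m : cnorm a <= 1 -> cnorm (sqrt_iter a m) <= sqrt_dom m.
Proof.
move=> h; elim: m => [|m IH] /=; first by rewrite cnorm0.
rewrite cnormZr gtr0_norm ?half_gt0 // ler_pM2l ?half_gt0 //.
apply: le_trans (cnormD _ _) _; rewrite lerD //.
by apply: le_trans (cnormM _ _) _; rewrite ler_pM ?cnorm_ge0.
Qed.

Lemma sqrt_iter_step a m : cnorm a <= 1 ->
  cnorm (sqrt_iter a m.+1 - sqrt_iter a m) <= sqrt_dom m.+1 - sqrt_dom m.
Proof.
move=> h; elim: m => [|m IH].
  by rewrite !subr0; apply: sqrt_iter_norm.
set y := sqrt_iter a m in IH *; set z := sqrt_iter a m.+1 in IH *.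
have zy : GRing.comm z y.
  rewrite /z /=; apply/commr_sym; apply: (sqrt_iter_comm m.+1).
  by apply/commr_sym; apply: sqrt_iter_comm.
have -> : sqrt_iter a m.+2 - z = (2^-1)%:C *: ((z - y) * (z + y)).
  rewrite [sqrt_iter a m.+2]/= -/z {2}/z [sqrt_iter a m.+1]/= -/y -scalerBr.
  congr (_ *: _); rewrite opprD addrACA subrr add0r.
  by rewrite mulrBl !mulrDr zy; ncring.
rewrite cnormZr gtr0_norm ?half_gt0 //.
have -> : sqrt_dom m.+2 - sqrt_dom m.+1 =
    2^-1 * ((sqrt_dom m.+1 - sqrt_dom m) * (sqrt_dom m.+1 + sqrt_dom m)).
  rewrite [sqrt_dom m.+2]/=; set u := sqrt_dom m.+1.
  have -> : u = 2^-1 * (1 + sqrt_dom m * sqrt_dom m) by [].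
  by set v := sqrt_dom m; field.
rewrite ler_pM2l ?half_gt0 //; apply: le_trans (cnormM _ _) _.
rewrite ler_pM ?cnorm_ge0 //; apply: le_trans (cnormD _ _) _.
by rewrite lerD // sqrt_iter_norm.
Qed.

Lemma sqrt_iter_dist a m k : cnorm a <= 1 -> (m <= k)%N ->
  cnorm (sqrt_iter a k - sqrt_iter a m) <= sqrt_dom k - sqrt_dom m.
Proof.
move=> h /subnK <-; elim: (k - m)%N => [|j IH].
  by rewrite add0n !subrr cnorm0.
apply: le_trans (cnorm_triangle (sqrt_iter a (j + m)) _ _) _.
rewrite -[leRHS](subrKA (sqrt_dom (j + m))) lerD //.
exact: sqrt_iter_step.
Qed.

Lemma sqrt_iter_cauchy a : cnorm a <= 1 -> ncauchy (@cnorm R A) (sqrt_iter a).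
Proof.
move=> h e e0.
have : cvgn sqrt_dom.
  apply: nondecreasing_is_cvgn; first exact: sqrt_dom_incr.
  by exists 1 => _ [m _ <-]; have /andP[] := sqrt_dom_bound m.
move=> /cvgrPdist_lt/(_ _ (divr_gt0 e0 (ltr0n _ 2))) [K _ HK].
have wl i j : (K <= i)%N -> (i <= j)%N ->
    cnorm (sqrt_iter a i - sqrt_iter a j) < e.
  move=> Ki ij; rewrite cnorm_distC.
  apply: le_lt_trans (sqrt_iter_dist h ij) _.
  have := HK _ Ki; have := HK _ (leq_trans Ki ij).
  by rewrite !ltr_distl => /andP[? ?] /andP[? ?]; lra.
exists K => i j Ki Kj; case: (leqP i j) => ij; first exact: wl.
by rewrite cnorm_distC wl // ltnW.
Qed.

(** The limit y of the iteration satisfies 2 y = a + y^2, which is (1 - y)^2 = 1 - a. The bound on 1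
    - c = y later makes the root positive, and the last clause makes roots of commuting elements
    commute. *)
Lemma sqrt_one_sub a : star a = a -> cnorm a <= 1 ->
  exists c, [/\ star c = c, c * c = 1 - a, cnorm (1 - c) <= 1
    & forall b, GRing.comm b a -> GRing.comm b c].
Proof.
move=> sa na; have [y hy] := cnorm_complete (sqrt_iter_cauchy na).
have sy : star y = y.
  apply: ncvg_uniq (ncvg_star hy) _.
  by under [X in ncvg _ X _]eq_fun => i do rewrite (sqrt_iter_star i sa).
have ny : cnorm y <= 1.
  rewrite -cnormN -sub0r; apply: (ncvg_bound hy) => i.
  rewrite sub0r cnormN; apply: le_trans (sqrt_iter_norm i na) _.
  by have /andP[] := sqrt_dom_bound i.
have ey : y + y = a + y * y.
  have e1 : y = (2^-1)%:C *: (a + y * y).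
    apply: ncvg_uniq (ncvg_shift hy) _.
    by apply: ncvg_scale; apply: ncvgD (ncvg_cst _) _; apply: ncvgM.
  rewrite {1 2}e1 -scalerDl -rmorphD /=.
  have -> : 2^-1 + 2^-1 = 1 :> R by field.
  by rewrite rmorph1 scale1r.
exists (1 - y); split.
- by rewrite starB star1 sy.
- have -> : (1 - y) * (1 - y) = 1 - (y + y) + y * y by ncring.
  by rewrite ey; ncring.
- by rewrite subKr.
- move=> b ba; apply: commrB; first exact: commr1.
  apply: ncvg_uniq (ncvg_mull b hy) _.
  have := ncvg_mulr b hy; congr ncvg; apply/funext => i.
  exact/esym/sqrt_iter_comm.
Qed.

End SquareRoot.

(** * The positive cone and Kaplansky's theorem *)

Section PositiveCone.
Variables (R : realType) (A : cstarAlg R).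
Implicit Types (a b c d p q x y : A) (r t : R).

(* A norm criterion equivalent to being of the form b^* b (cposP); it is visibly
   stable under sums, limits and restriction to subalgebras. *)
Definition pos a := star a = a /\ exists t : R, cnorm (t%:C%:A - a) <= t.

Lemma realZDl r t a : (r + t)%:C *: a = r%:C *: a + t%:C *: a.
Proof. by rewrite rmorphD /= scalerDl. Qed.

Lemma realZA r t a : (r * t)%:C *: a = r%:C *: (t%:C *: a).
Proof. by rewrite rmorphM /= scalerA. Qed.

Lemma realZ1 a : (1 : R)%:C *: a = a.
Proof. by rewrite rmorph1 scale1r. Qed.

Lemma comm_rs r b : GRing.comm b (r%:C%:A).
Proof. by rewrite /GRing.comm mulr_algl -scalerAr mulr1. Qed.

Lemma commZr r b a : GRing.comm b a -> GRing.comm b (r%:C *: a).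
Proof. by move=> h; rewrite /GRing.comm -scalerAr -scalerAl h. Qed.

(** The element c + i d is normal and its adjoint times itself is c^2 + d^2 = r, so its norm squared
    is |r|; d is its imaginary part and has no larger norm. This stands in for the spectral theorem
    in the norm estimates below. *)
Lemma unit_trick c d r : star c = c -> star d = d -> GRing.comm c d ->
  c * c + d * d = r%:C%:A -> cnorm d ^+ 2 <= `|r|.
Proof.
move=> sc sd cd h; pose e := 'i%C *: d.
have ne : cnorm e = cnorm d.
  by rewrite cnormZ /= expr0n /= add0r expr1n sqrtr1 mul1r.
have se : star e = - e.
  by rewrite starZ sd complexiE conjCi scaleNr -complexiE.
have ee : e * e = - (d * d).
  by rewrite -scalerAl -scalerAr scalerA -expr2 sqr_i scaleN1r.
have ce : c * e = e * c by rewrite -scalerAl -scalerAr cd.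
have hu : star (c + e) * (c + e) = r%:C%:A.
  rewrite starD sc se -h.
  have -> : (c - e) * (c + e) = c * c + (c * e - e * c) - e * e by ncring.
  by rewrite ce ee; ncring.
have nu : cnorm (c + e) ^+ 2 = `|r| by rewrite -cstar_identity hu cnorm_rs.
rewrite -nu ler_pXn2r ?nnegrE ?cnorm_ge0 //.
have -> : d = (2^-1)%:C *: (- 'i%C *: ((c + e) - star (c + e))).
  have -> : c + e - star (c + e) = e + e.
    by rewrite starD sc se; ncring.
  rewrite scalerDr scalerA mulNr -expr2 sqr_i opprK scale1r scalerDr -realZDl.
  have -> : 2^-1 + 2^-1 = 1 :> R by field.
  by rewrite realZ1.
rewrite cnormZr cnormZ normcN.
have -> : Normc.normc ('i%C : R[i]) = 1.
  by rewrite /= expr0n /= add0r expr1n sqrtr1.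
rewrite mul1r gtr0_norm ?invr_gt0 // ler_pdivrMl //.
by apply: le_trans (cnormB _ _) _; rewrite cnorm_star; lra.
Qed.

(** [unit_trick] for d and the root c of 1 - d^2, in this order, bounds |c|^2, which is |1 -
    d^2|. *)
Lemma sa_sqr_bound1 d : star d = d -> cnorm d <= 1 -> cnorm (1 - d * d) <= 1.
Proof.
move=> sd nd.
have ndd : cnorm (d * d) <= 1.
  by rewrite cnorm_sa_sqr // expr_le1 ?cnorm_ge0.
have sdd : star (d * d) = d * d by rewrite starM sd.
have [c [sc cc _ comm]] := sqrt_one_sub sdd ndd.
have dc : GRing.comm d c by apply: comm; apply: commrM.
rewrite -cc cnorm_sa_sqr // (le_trans (unit_trick sd sc dc (r := 1) _)) //.
  by rewrite cc realZ1; ncring.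
by rewrite normr1.
Qed.

Lemma sa_sqr_bound d t : star d = d -> cnorm d ^+ 2 <= t ->
  cnorm (t%:C%:A - d * d) <= t.
Proof.
move=> sd nd; have t0 : 0 <= t by apply: le_trans nd; rewrite sqr_ge0.
have [t_eq|tn0] := eqVneq t 0.
  by rewrite t_eq scale0r sub0r cnormN cnorm_sa_sqr // -t_eq.
have tp : 0 < t by rewrite lt_def tn0.
pose e := (Num.sqrt t)^-1%:C *: d.
have ee : d * d = t%:C *: (e * e).
  have ss : Num.sqrt t ^+ 2 = t by rewrite sqr_sqrtr.
  rewrite -scalerAl -scalerAr -!realZA -[LHS]realZ1; congr (_%:C *: _).
  by rewrite -{1}ss; field; rewrite sqrtr_eq0 -ltNge.
have se : star e = e by rewrite starZr sd.
have ne : cnorm e <= 1.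
  rewrite cnormZr ger0_norm ?invr_ge0 ?sqrtr_ge0 // mulrC.
  rewrite ler_pdivrMr ?sqrtr_gt0 // mul1r.
  by rewrite -(ger0_norm (cnorm_ge0 d)) -sqrtr_sqr ler_sqrt.
rewrite ee -scalerBr cnormZr ger0_norm // -[leRHS]mulr1 ler_wpM2l //.
exact: sa_sqr_bound1.
Qed.

Lemma pos_sa a : pos a -> star a = a. Proof. by case. Qed.

Lemma pos_sqr d : star d = d -> pos (d * d).
Proof.
move=> sd; split; first by rewrite starM sd.
by exists (cnorm d ^+ 2); apply: sa_sqr_bound.
Qed.

Lemma pos_rs r : 0 <= r -> pos (r%:C%:A).
Proof.
by move=> r0; split; [exact: star_rs | exists r; rewrite subrr cnorm0].
Qed.

Lemma pos0 : pos 0.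
Proof. by have := pos_rs (lexx 0); rewrite scale0r. Qed.

Lemma pos1 : pos 1.
Proof. by have := pos_rs ler01; rewrite realZ1. Qed.

Lemma posD a b : pos a -> pos b -> pos (a + b).
Proof.
move=> [sa [t ta]] [sb [r rb]]; split; first by rewrite starD sa sb.
exists (t + r); rewrite realZDl opprD addrACA.
by apply: le_trans (cnormD _ _) _; rewrite lerD.
Qed.

Lemma pos_sum I (r : seq I) (P : pred I) (F : I -> A) :
  (forall i, P i -> pos (F i)) -> pos (\sum_(i <- r | P i) F i).
Proof. by move=> h; elim/big_ind: _ => //; [exact: pos0 | exact: posD]. Qed.

Lemma posZ r a : 0 <= r -> pos a -> pos (r%:C *: a).
Proof.
move=> r0 [sa [t ta]]; split; first by rewrite starZr sa.
exists (r * t); rewrite realZA -scalerBr cnormZr ger0_norm //.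
by rewrite ler_wpM2l.
Qed.

(** A witness t > 0 of positivity says that b = 1 - a/t has norm at most 1, so sqrt t times the root
    of 1 - b is a root of a. The witness t = 0 forces a = 0. *)
Lemma pos_sqrt a : pos a -> exists d, [/\ pos d, d * d = a
  & forall b, GRing.comm b a -> GRing.comm b d].
Proof.
move=> [sa [t ta]]; have t0 : 0 <= t := le_trans (cnorm_ge0 _) ta.
have [t_eq|tn0] := eqVneq t 0.
  exists 0; split; [exact: pos0 | rewrite mulr0 | by move=> b _; exact: commr0].
  apply/esym/cnorm0_eq0/le_anti; rewrite cnorm_ge0 andbT.
  by move: ta; rewrite t_eq scale0r sub0r cnormN.
have tp : 0 < t by rewrite lt_def tn0.
pose b := 1 - t^-1%:C *: a.
have sb : star b = b by rewrite starB star1 starZr sa.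
have nb : cnorm b <= 1.
  have -> : b = t^-1%:C *: (t%:C%:A - a).
    by rewrite scalerBr -realZA mulVf // realZ1.
  by rewrite cnormZr gtr0_norm ?invr_gt0 // ler_pdivrMl // mulr1.
have [c [sc cc nc comm]] := sqrt_one_sub sb nb.
exists ((Num.sqrt t)%:C *: c); split.
- by apply: posZ; rewrite ?sqrtr_ge0 //; split => //; exists 1; rewrite realZ1.
- rewrite -scalerAl -scalerAr -realZA -expr2 sqr_sqrtr // cc /b subKr -realZA.
  by rewrite mulfV // realZ1.
- move=> x xa; apply: commZr; apply: comm; apply: commrB; first exact: commr1.
  exact: commZr.
Qed.

(** Writing a as a square shows that every t >= |a| is a witness for [pos]. This uniformity is what
    allows limits of positive elements. *)
Lemma pos_norm a t : pos a -> cnorm a <= t -> cnorm (t%:C%:A - a) <= t.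
Proof.
move=> /pos_sqrt [d [pd <- _]]; rewrite cnorm_sa_sqr ?pos_sa // => h.
by apply: sa_sqr_bound => //; rewrite pos_sa.
Qed.

Lemma pos_closed a :
  (forall e, 0 < e -> exists p, pos p /\ cnorm (a - p) <= e) -> pos a.
Proof.
move=> h; split.
  apply/eqP; rewrite -subr_eq0; apply/eqP; apply: cnorm_small => e e0.
  have [p [pp ap]] := h _ (divr_gt0 e0 (ltr0n _ 2)).
  apply: le_trans (cnorm_triangle p _ _) _.
  rewrite -{1}(pos_sa pp) -starB cnorm_star [X in _ + X]cnorm_distC.
  by rewrite [leRHS](splitr e) lerD.
(* Approximants within distance 1 of a have norm at most |a| + 1, so by [pos_norm] this one witness
   serves them all. *)
exists (cnorm a + 1); apply/ler_addgt0Pr => e e0.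
have m0 : 0 < Num.min e 1 by rewrite lt_min e0 ltr01.
have [p [pp]] := h _ m0; rewrite le_min => /andP[ape ap1].
apply: le_trans (cnorm_triangle p _ _) _.
rewrite (cnorm_distC p); apply: lerD => //; apply: pos_norm => //.
rewrite -[p](subKr a); apply: le_trans (cnormB _ _) _.
by rewrite lerD2l.
Qed.

(** Both |b| - b and b - a are positive, hence so is |b| - a. Its root c and the root d of a commute
    and satisfy c^2 + d^2 = |b|, so [unit_trick] bounds |d|^2 = |a|. *)
Lemma pos_le_norm a b : pos a -> pos (b - a) -> cnorm a <= cnorm b.
Proof.
move=> pa pba; have pb : pos b by rewrite -(subrK a b); apply: posD.
have ptb : pos ((cnorm b)%:C%:A - b).
  split; first by rewrite starB star_rs pos_sa.
  by exists (cnorm b); rewrite subKr.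
have /pos_sqrt [c [pc cc comc]] : pos ((cnorm b)%:C%:A - a).
  by rewrite -(subrKA b); apply: posD.
have [d [pd dd comd]] := pos_sqrt pa.
have cd : GRing.comm c d.
  apply/commr_sym/comc/commrB; first exact: comm_rs.
  exact/commr_sym/comd.
have := unit_trick (pos_sa pc) (pos_sa pd) cd (r := cnorm b).
rewrite cc dd subrK => /(_ erefl).
by rewrite ger0_norm ?cnorm_ge0 // -cnorm_sa_sqr ?dd // pos_sa.
Qed.

Lemma pos_mul_comm p q : pos p -> pos q -> GRing.comm p q -> pos (p * q).
Proof.
move=> /pos_sqrt [d [pd dd comd]] /pos_sqrt [e [pe ee come]] pq.
have de : GRing.comm d e by apply/come/commr_sym/comd/commr_sym.
have -> : p * q = (d * e) * (d * e).
  by rewrite -dd -ee !mulrA -[d * e * d]mulrA -de !mulrA.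
by apply: pos_sqr; rewrite starM !pos_sa.
Qed.

Lemma posX p m : pos p -> pos (p ^+ m).
Proof.
move=> pp; elim: m => [|m IH]; first exact: pos1.
by rewrite exprS; apply: pos_mul_comm => //; apply: commrX.
Qed.

(* With q = x x^* the intertwining x^* (1 - q)^m x = (1 + p)^m x^* x bounds
   (1 + p)^m p, which however dominates m p^2. *)
Lemma neg_star_mul x p : cnorm x <= 1 -> pos p -> star x * x = - p -> x = 0.
Proof.
move=> nx pp xx; pose q := x * star x.
(* g is skew-adjoint, so -g^2 is positive. Then 2 (x star x + star x x) = (x + star x)^2 - g^2,
   together with star x x = -p, gives positivity of q. *)
pose g := x - star x.
have pgg : pos (- (g * g)).
  pose k := 'i%C *: g.
  have -> : - (g * g) = k * k.
    by apply: esym; rewrite -scalerAl -scalerAr scalerA -expr2 sqr_i scaleN1r.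
  apply: pos_sqr; rewrite starZ starB starK complexiE conjCi scaleNr -scalerN.
  by rewrite opprB.
have sq : star q = q by rewrite starM starK.
have pq : pos q.
  have -> : q = (2^-1)%:C *: (q + q).
    rewrite scalerDr -realZDl; have -> : 2^-1 + 2^-1 = 1 :> R by field.
    by rewrite realZ1.
  have -> : q + q = (x + star x) * (x + star x) - g * g + (p + p).
    have -> : p = - (star x * x) by rewrite xx opprK.
    by rewrite /q /g; ncring.
  apply: posZ; first by rewrite invr_ge0.
  apply: posD; last exact: posD.
  by apply: posD => //; apply: pos_sqr; rewrite starD starK addrC.
have nq : cnorm (1 - q) <= 1.
  rewrite -[1 in X in X <= _]realZ1; apply: pos_norm => //.
  rewrite /q -{1}(starK x) cstar_identity cnorm_star.
  by rewrite expr_le1 ?cnorm_ge0.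
have twine m : star x * (1 - q) ^+ m = (1 + p) ^+ m * star x.
  elim: m => [|m IH]; first by rewrite !expr0 mul1r mulr1.
  rewrite exprSr mulrA IH exprSr -!mulrA; congr (_ * _).
  have -> : p = - (star x * x) by rewrite xx opprK.
  by rewrite /q; ncring.
have bound m : cnorm ((1 + p) ^+ m * p) <= 1.
  have -> : (1 + p) ^+ m * p = - (star x * (1 - q) ^+ m * x).
    by rewrite twine -mulrA xx mulrN opprK.
  rewrite cnormN; apply: le_trans (cnormM _ _) _.
  rewrite mulr_ile1 ?cnorm_ge0 //; apply: le_trans (cnormM _ _) _.
  rewrite mulr_ile1 ?cnorm_ge0 ?cnorm_star //; apply: le_trans (cnormX _ _) _.
  by rewrite exprn_ile1 ?cnorm_ge0.
(* Bernoulli's inequality in the cone: D (m+1) = D m + p D m + m p^3. It gives m p^2 <= (1 + p)^m p,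
   whose norm stays at most 1, so p^2 = 0. *)
pose D m := (1 + p) ^+ m * p - p - (m%:R : R)%:C *: (p * p).
have comD m : GRing.comm p (D m).
  apply: commrB; first apply: commrB => //; last first.
    by apply: commZr; apply: commrM.
  by apply: commrM => //; apply: commrX; apply: commrD => //; apply: commr1.
have pD m : pos (D m).
  elim: m => [|m IH].
    by rewrite /D expr0 mul1r subrr scale0r subrr; exact: pos0.
  have -> : D m.+1 = D m + p * D m + (m%:R : R)%:C *: (p * p * p).
    have e3 : (m%:R : R)%:C *: (p * p * p) = p * ((m%:R : R)%:C *: (p * p)).
      by rewrite -scalerAr mulrA.
    rewrite e3 /D exprS -natr1 realZDl realZ1.
    by set u := _%:C *: _; set w := (1 + p) ^+ m; ncring.
  apply: posD; first by apply: posD => //; apply: pos_mul_comm.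
  apply: posZ; first exact: ler0n.
  by rewrite -expr2 -exprSr; apply: posX.
have pp0 : p = 0.
  apply: sa_sqr_eq0; first exact: pos_sa.
  apply: cnorm_small => e e0.
  have [m] := ltr_add_invr e0; rewrite add0r => me.
  apply: ltW; apply: le_lt_trans me; rewrite -[leRHS]mulr1 ler_pdivlMl //.
  apply: le_trans (bound m.+1); rewrite -[X in X * _]ger0_norm //.
  rewrite -cnormZr; apply: pos_le_norm.
    by apply: posZ => //; apply: pos_sqr; exact: pos_sa.
  have := posD (pD m.+1) pp; rewrite /D; congr pos; ncring.
by apply: star_mul_eq0; rewrite xx pp0 oppr0.
Qed.

Lemma neg_star_mul_eq0 x p : pos p -> star x * x = - p -> x = 0.
Proof.
move=> pp xx; have [//|nz] := eqVneq x 0; apply/eqP.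
have nx : cnorm x != 0 by rewrite cnorm_eq0.
have xp : 0 < cnorm x by rewrite lt_def nx cnorm_ge0.
have ip : 0 <= (cnorm x)^-1 by rewrite invr_ge0 cnorm_ge0.
suff y0 : (cnorm x)^-1%:C *: x = 0.
  by rewrite -[x]realZ1 -(mulfV nx) realZA y0 scaler0.
apply: (@neg_star_mul _ ((cnorm x)^-1%:C *: ((cnorm x)^-1%:C *: p))).
- by rewrite cnormZr ger0_norm // mulVf.
- by do 2!apply: posZ => //.
- by rewrite starZr -scalerAl -scalerAr xx !scalerN.
Qed.

(** Let h = star b b, let k be the root of h^2 and v = k - h, twice the negative part of h. From v
    (k + h) = 0 one gets star (b v) (b v) = v h v = - v k v, so b v = 0 by [neg_star_mul_eq0]. Then
    v k v = 0 and v^2 = 2 k v make v nilpotent, hence zero, and h = k is positive. *)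
Lemma pos_star_mul b : pos (star b * b).
Proof.
pose h := star b * b.
have sh : star h = h by rewrite starM starK.
have [k [pk kk comk]] := pos_sqrt (pos_sqr sh).
have hk : GRing.comm h k by apply: comk; apply: commrM.
pose v := k - h.
have sv : star v = v by rewrite starB sh pos_sa.
have kv : GRing.comm k v by apply: commrB => //; apply/commr_sym.
have [l [pl ll coml]] := pos_sqrt pk.
have vl : GRing.comm v l by apply/coml/commr_sym.
have pv : pos (v * k * v).
  have -> : v * k * v = (v * l) * (v * l) 
    by rewrite -ll !mulrA -[LHS]mulrA -[l * v]vl !mulrA.
  by apply: pos_sqr; rewrite starM sv pos_sa.
have xx : star (b * v) * (b * v) = - (v * k * v).
  have -> : star (b * v) * (b * v) = v * h * v by rewrite starM sv !mulrA.
  apply/eqP; rewrite -subr_eq0 opprK -mulrDl -mulrDr /v; apply/eqP.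
  have -> : (k - h) * (h + k) = (k * h - h * k) + (k * k - h * h) by ncring.
  by rewrite kk hk !subrr addr0 mul0r.
have bv0 : b * v = 0 by apply: neg_star_mul_eq0 pv xx.
have vv : v * v = k * v + k * v.
  rewrite /v; have -> : (k - h) * (k - h) = k * k - k * h - h * k + h * h by ncring.
  by rewrite hk -kk; ncring.
have v0 : v = 0.
  have vkv : v * k * v = 0.
    by apply/eqP; rewrite -oppr_eq0 -xx bv0 mulr0.
  have vvv : v * v * v = 0 by rewrite -mulrA vv mulrDr mulrA vkv addr0.
  apply: sa_sqr_eq0 => //; apply: sa_sqr_eq0; first by rewrite starM sv.
  by rewrite mulrA vvv mul0r.
have -> : star b * b = k; last by [].
by apply/esym/eqP; rewrite -subr_eq0 -/h -/v v0.
Qed.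

Lemma cposP a : cpos a <-> pos a.
Proof.
split=> [[b ->]|/pos_sqrt [d [pd <- _]]]; first exact: pos_star_mul.
by exists d; rewrite (pos_sa pd).
Qed.

Lemma pos_conj x p : pos p -> pos (star x * p * x).
Proof.
move=> /pos_sqrt [d [pd <- _]].
have -> : star x * (d * d) * x = star (d * x) * (d * x).
  by rewrite starM (pos_sa pd) !mulrA.
exact: pos_star_mul.
Qed.

Lemma pos_norm_sub b : pos (((cnorm b) ^+ 2)%:C%:A - star b * b).
Proof.
split; first by rewrite starB star_rs starM starK.
by exists (cnorm b ^+ 2); rewrite subKr cstar_identity.
Qed.

Lemma pos_leZ a : pos a -> pos ((cnorm a)%:C%:A - a).
Proof.
move=> [sa _]; split; first by rewrite starB star_rs sa.
by exists (cnorm a); rewrite subKr.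
Qed.

End PositiveCone.

(** * Unital *-homomorphisms *)

Section StarHom.
Variables (R : realType) (A B : cstarAlg R) (f : A -> B).
Hypothesis hf : is_star_hom f.

Lemma shomZD (z : R[i]) a b : f (z *: a + b) = z *: f a + f b.
Proof. by case: hf => h _ _; rewrite h. Qed.

Lemma shomD a b : f (a + b) = f a + f b.
Proof. by rewrite -[a in LHS]scale1r shomZD scale1r. Qed.

Lemma shom0 : f 0 = 0.
Proof. by apply: (addrI (f 0)); rewrite -shomD !addr0. Qed.

Lemma shomZ z a : f (z *: a) = z *: f a.
Proof. by rewrite -[z *: a]addr0 shomZD shom0 addr0. Qed.

Lemma shomN a : f (- a) = - f a.
Proof. by rewrite -scaleN1r shomZ scaleN1r. Qed.

Lemma shomB a b : f (a - b) = f a - f b.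
Proof. by rewrite shomD shomN. Qed.

Lemma shom1 : f 1 = 1. Proof. by case: hf => _ [h _] _. Qed.

Lemma shomM a b : f (a * b) = f a * f b.
Proof. by case: hf => _ [_ h] _; rewrite h. Qed.

Lemma shom_star a : f (star a) = star (f a).
Proof. by case: hf => _ _ h; rewrite h. Qed.

Lemma shom_sum I (r : seq I) (P : pred I) (F : I -> A) :
  f (\sum_(i <- r | P i) F i) = \sum_(i <- r | P i) f (F i).
Proof. exact: (big_morph _ shomD shom0). Qed.

(** For h self-adjoint with |h| <= 1 and c the root of 1 - h^2, applying f gives f(c)^2 + f(h)^2 =
    1, and [unit_trick] yields |f(h)| <= 1. Scaling and the C*-identity do the rest. *)
Lemma shom_contract a : cnorm (f a) <= cnorm a.
Proof.
have sa1 h : star h = h -> cnorm h <= 1 -> cnorm (f h) <= 1.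
  move=> sh nh.
  have shh : star (h * h) = h * h by rewrite starM sh.
  have nhh : cnorm (h * h) <= 1 by rewrite cnorm_sa_sqr // expr_le1 ?cnorm_ge0.
  have [c [sc cc _ comc]] := sqrt_one_sub shh nhh.
  have hc : GRing.comm h c by apply: comc; apply: commrM.
  rewrite -(@expr_le1 _ 2) ?cnorm_ge0 //.
  apply: le_trans (unit_trick (c := f c) (r := 1) _ _ _ _) _.
  - by rewrite -shom_star sc.
  - by rewrite -shom_star sh.
  - by rewrite /GRing.comm -!shomM hc.
  - by rewrite -!shomM -shomD cc subrK shom1 realZ1.
  - by rewrite normr1.
have sa h : star h = h -> cnorm (f h) <= cnorm h.
  move=> sh; have [->|hn] := eqVneq h 0; first by rewrite shom0 !cnorm0.
  have hp : 0 < cnorm h by rewrite lt_def cnorm_eq0 hn cnorm_ge0.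
  rewrite -[leRHS]mulr1 -ler_pdivrMl //.
  rewrite -[_^-1]gtr0_norm ?invr_gt0 // -cnormZr -shomZ; apply: sa1.
    by rewrite starZr sh.
  by rewrite cnormZr gtr0_norm ?invr_gt0 // mulVf // gt_eqF.
rewrite -(@ler_pXn2r _ 2) ?nnegrE ?cnorm_ge0 // -!cstar_identity.
by rewrite -shom_star -shomM sa // starM starK.
Qed.

Lemma shom_pos a : pos a -> pos (f a).
Proof.
move=> /pos_sqrt [d [pd <- _]]; rewrite shomM; apply: pos_sqr.
by rewrite -shom_star pos_sa.
Qed.

Lemma ncvg_shom (u : nat -> A) a :
  ncvg (@cnorm R A) u a -> ncvg (@cnorm R B) (fun i => f (u i)) (f a).
Proof.
by apply: (@ncvg_lip _ _ _ _ 1) => b c; rewrite mul1r -shomB shom_contract.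
Qed.

(* Positivity is a condition on norms, so it does not depend on the ambient
   algebra. *)
Lemma isometry_pos a : (forall b, cnorm (f b) = cnorm b) -> pos (f a) -> pos a.
Proof.
move=> iso [sfa [t ht]]; split.
  apply/eqP; rewrite -subr_eq0 -cnorm_eq0 -iso shomB shom_star sfa subrr.
  by rewrite cnorm0.
by exists t; rewrite -iso shomB shomZ shom1.
Qed.

End StarHom.

(** * The circle and its roots of unity *)

Section Circle.
Variable R : realType.
Implicit Types (t : R) (k : int).

Definition circ t : R[i] := cos (2 * pi * t) +i* sin (2 * pi * t).

Lemma circ0 : circ 0 = 1.
Proof. by rewrite /circ mulr0 cos0 sin0. Qed.

Lemma circD t u : circ (t + u) = circ t * circ u.
Proof.
rewrite /circ mulrDr cosD sinD; apply/eqP; rewrite eq_complex /=.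
by rewrite eqxx addrC eqxx.
Qed.

Lemma circ1 : circ 1 = 1.
Proof. by rewrite /circ mulr1 mulr_natl cos2pi sin2pi. Qed.

Lemma circ_half : circ 2^-1 = -1.
Proof.
rewrite /circ mulrAC mulfV ?mul1r ?cospi ?sinpi //.
by apply/eqP; rewrite eq_complex /= oppr0 !eqxx.
Qed.

Lemma circ_norm t : `|circ t| = 1.
Proof. by rewrite normc_def /= cos2Dsin2 sqrtr1. Qed.

Lemma unit_neq0 (z : R[i]) : `|z| = 1 -> z != 0.
Proof. by move=> h; rewrite -normr_gt0 h. Qed.

Lemma circ_unit t : circ t != 0.
Proof. exact/unit_neq0/circ_norm. Qed.

Lemma circ_nat t m : circ (t * m%:R) = circ t ^+ m.
Proof.
by elim: m => [|m IH]; rewrite ?mulr0 ?circ0 // -natr1 mulrDr mulr1 circD IH exprSr.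
Qed.

Lemma circN t : circ (- t) = (circ t)^-1.
Proof.
apply: (mulfI (circ_unit t)); rewrite -circD subrr circ0 mulfV //.
exact: circ_unit.
Qed.

Lemma circ_int t k : circ (t * k%:~R) = circ t ^ k.
Proof.
case: k => m; first exact: circ_nat.
by rewrite NegzE mulrNz mulrN circN circ_nat.
Qed.

(** The real part is cos (2 u) = 1 - 2 sin(u)^2 for u = pi t, and sin u > 0. *)
Lemma circ_neq1 t : 0 < t < 1 -> circ t != 1.
Proof.
move=> /andP[t0 t1]; apply/negP; rewrite eq_complex /= => /andP[/eqP h _].
have : 0 < sin (pi * t) by rewrite sin_gt0_pi ?mulr_gt0 ?pi_gt0 // gtr_pMr ?pi_gt0.
have := h; have -> : 2 * pi * t = pi * t + pi * t by ring.
rewrite cosD -!expr2; have := cos2Dsin2 (pi * t); nra.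
Qed.

Lemma circ_pow_neq1 (J : nat) k : k != 0 -> (`|k| < J)%N ->
  circ (k%:~R / J%:R) != 1.
Proof.
have main m : (0 < m)%N -> (m < J)%N -> circ (m%:R / J%:R) != 1.
  move=> m0 mJ; have J0 : 0 < J%:R :> R by rewrite ltr0n (leq_ltn_trans _ mJ).
  apply: circ_neq1; apply/andP; split; first by rewrite divr_gt0 // ltr0n.
  by rewrite ltr_pdivrMr // mul1r ltr_nat.
case: k => p k0 kJ; first by apply: main => //; case: p k0 kJ.
by rewrite NegzE mulrNz mulNr circN invr_eq1 main.
Qed.

(** A geometric sum of ratio w = circ (k / J), where w^J = 1 and the bound on k keeps w away from
    1. *)
Lemma circ_sum (J : nat) k : k != 0 -> (`|k| < J)%N ->
  \sum_(i < J) circ (i%:R / J%:R) ^ k = 0.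
Proof.
move=> k0 kJ; set w := circ (k%:~R / J%:R).
have J0 : J%:R != 0 :> R by rewrite pnatr_eq0 -lt0n (leq_ltn_trans _ kJ).
have e i : circ (i%:R / J%:R) ^ k = w ^+ i.
  by rewrite /w -circ_int -circ_nat; congr circ; field.
under eq_bigr do rewrite e.
have w1 : w - 1 != 0 by rewrite subr_eq0 circ_pow_neq1.
apply: (mulfI w1); rewrite mulr0 -subrX1 /w -circ_nat divfK // .
by rewrite -[_%:~R]mul1r circ_int circ1 exp1rz subrr.
Qed.

Lemma conj_unit (z : R[i]) : `|z| = 1 -> z^*%R = z^-1.
Proof. by move=> h; rewrite invC_norm h expr1n invr1 mul1r. Qed.

Lemma circ_continuous0 (e : R) : 0 < e ->
  exists d : R, 0 < d /\ forall t, `|t| < d -> Normc.normc (circ t - 1) < e.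
Proof.
move=> e0; have e2 : 0 < e / 2 by rewrite divr_gt0.
have := @continuous_cos R 0; have := @continuous_sin R 0.
move=> /cvgrPdist_lt/(_ _ e2) [d1 d10 h1] /cvgrPdist_lt/(_ _ e2) [d2 d20 h2].
have p2 : 0 < 2 * pi :> R by rewrite mulr_gt0 ?pi_gt0.
suff h t : `|t| < Num.min d1 d2 / (2 * pi) -> Normc.normc (circ t - 1) < e.
  exists (Num.min d1 d2 / (2 * pi)); split => //.
  by rewrite divr_gt0 // lt_min d10 d20.
rewrite ltr_pdivlMr // -(gtr0_norm p2) -normrM mulrC lt_min.
set u := 2 * pi * t => /andP[u1 u2].
set goal := (X in is_true X).
have := h1 u; have := h2 u.
rewrite /ball_ /= !sub0r !normrN => /(_ u2) c /(_ u1).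
move: c; rewrite cos0 sin0 sub0r normrN => c s; rewrite /goal.
have -> : circ t - 1 = (cos u - 1)%:C + 'i%C * (sin u)%:C.
  rewrite /circ -/u; apply/eqP; rewrite eq_complex /=.
  by rewrite !mul0r !subr0 ?addr0 !mul1r ?mul0r ?add0r ?subr0 !eqxx.
apply: le_lt_trans (le_normcD _ _) _.
rewrite Normc.normcM !normc_real -[X in _ + X * _]/(Num.sqrt (0 ^+ 2 + 1 ^+ 2)).
rewrite expr0n /= add0r expr1n sqrtr1 mul1r distrC; lra.
Qed.

End Circle.

(** * Sums over symmetric intervals of integers *)

Definition sym (N : nat) : seq int := [seq i%:Z - N%:Z | i <- iota 0 N.*2.+1].

Lemma sym_uniq (N : nat) : uniq (sym N).
Proof. by rewrite map_inj_uniq ?iota_uniq // => i j /addIr [-> ]. Qed.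

Lemma mem_sym (N : nat) (k : int) : (k \in sym N) = (`|k| <= N)%N.
Proof.
apply/mapP/idP => [[j]|kN].
  by rewrite mem_iota add0n ltnS => /andP[_ hi] ->; lia.
exists `|(k + N%:Z)%R|%N; last by lia.
by rewrite mem_iota add0n ltnS; apply/andP; split => //; lia.
Qed.

Section SymmetricSums.
Variable V : nmodType.
Implicit Types (f : int -> V) (K N : nat).

Lemma sum_sym f N :
  \sum_(k <- sym N) f k = \sum_(i < N.*2.+1) f (i%:Z - N%:Z).
Proof. by rewrite big_map -val_enum_ord big_map big_enum. Qed.

Lemma fsum_sym f K N : (K <= N)%N -> (forall k, (K < `|k|)%N -> f k = 0) ->
  \sum_(k \in [set: int]) f k = \sum_(k <- sym N) f k.
Proof.
move=> KN hf; rewrite (fsbigE (sym N)) ?sym_uniq //.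
  by apply: eq_bigl => k; rewrite in_setT.
move=> k _; rewrite mem_sym -ltnNge => kN; apply: hf.
exact: leq_ltn_trans KN kN.
Qed.

Lemma sum_sym_widen f K N : (K <= N)%N -> (forall k, (K < `|k|)%N -> f k = 0) ->
  \sum_(k <- sym N) f k = \sum_(k <- sym K) f k.
Proof. by move=> KN hf; rewrite -(fsum_sym KN hf) -(fsum_sym (leqnn K) hf). Qed.

End SymmetricSums.

Section ScalarsClosed.
Variables (R : realType) (O : cstarAlg R).

Lemma real_cauchy_cvg (u : nat -> R) :
  (forall e, 0 < e -> exists K, forall i, (K <= i)%N -> `|u K - u i| < e) ->
  exists l : R, u @ \oo --> l.
Proof.
move=> h; suff : cvgn u by move=> c; exists (limn u).
apply: cauchy_cvg; apply: cauchy_exP => e e0; have [K HK] := h e e0.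
by exists (u K), K => // i Ki; exact: HK.
Qed.

Lemma normc_ge_Re (c : R[i]) : `|complex.Re c| <= Normc.normc c.
Proof. by case: c => a b /=; rewrite -sqrtr_sqr ler_wsqrtr // lerDl sqr_ge0. Qed.

Lemma normc_ge_Im (c : R[i]) : `|complex.Im c| <= Normc.normc c.
Proof. by case: c => a b /=; rewrite -sqrtr_sqr ler_wsqrtr // lerDr sqr_ge0. Qed.

(** As |1| = 1, scalars approximating x within 1/(m+1) form a Cauchy sequence; their real and
    imaginary parts converge. *)
Lemma scalars_closed (x : O) :
  (forall e : R, 0 < e -> exists c : R[i], cnorm (x - c%:A) < e) ->
  exists c : R[i], x = c%:A.
Proof.
move=> h.
have hn m : exists c : R[i], cnorm (x - c%:A) < m.+1%:R^-1.
  by apply: h; rewrite invr_gt0 ltr0n.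
have [c hc] := choice hn.
have dist i j : Normc.normc (c i - c j) <= i.+1%:R^-1 + j.+1%:R^-1.
  rewrite -[leLHS]mulr1 -[X in _ * X <= _](cnorm1 O) -cnormZ scalerBl.
  apply: le_trans (cnorm_triangle x _ _) _.
  by rewrite cnorm_distC; apply: lerD; apply/ltW/hc.
have small e : 0 < e -> exists K, forall i j, (K <= i)%N -> (K <= j)%N ->
    Normc.normc (c i - c j) < e.
  move=> e0; have [K hK] := ltr_add_invr (divr_gt0 e0 (ltr0n R 2)).
  rewrite add0r in hK; exists K => i j Ki Kj; apply: le_lt_trans (dist i j) _.
  rewrite [ltRHS](splitr e); apply: ltrD; apply: le_lt_trans hK;
  by rewrite lef_pV2 ?posrE ?ltr0n // ler_nat.
have [r hr] : exists r : R, (fun i => complex.Re (c i)) @ \oo --> r.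
  apply: real_cauchy_cvg => e /small [K hK]; exists K => i Ki.
  apply: le_lt_trans (hK K i (leqnn _) Ki); rewrite -raddfB; exact: normc_ge_Re.
have [t ht] : exists t : R, (fun i => complex.Im (c i)) @ \oo --> t.
  apply: real_cauchy_cvg => e /small [K hK]; exists K => i Ki.
  apply: le_lt_trans (hK K i (leqnn _) Ki); rewrite -raddfB; exact: normc_ge_Im.
exists (r +i* t); apply/eqP; rewrite -subr_eq0; apply/eqP.
apply: cnorm_small => e e0; have e4 : 0 < e / 4 by rewrite divr_gt0.
have [K hK] := ltr_add_invr e4; rewrite add0r in hK.
move/cvgrPdist_lt: hr => /(_ _ e4) [K1 _ H1].
move/cvgrPdist_lt: ht => /(_ _ e4) [K2 _ H2].
pose m := maxn K (maxn K1 K2).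
have m1 := H1 m (leq_trans (leq_maxl _ _) (leq_maxr _ _)).
have m2 := H2 m (leq_trans (leq_maxr _ _) (leq_maxr _ _)).
have mK : m.+1%:R^-1 < e / 4.
  by apply: le_lt_trans hK; rewrite lef_pV2 ?posrE ?ltr0n // ler_nat ltnS leq_maxl.
apply: le_trans (cnorm_triangle ((c m)%:A) _ _) _.
rewrite -scalerBl cnormZ cnorm1 mulr1.
have -> : c m - (r +i* t) =
    (complex.Re (c m) - r)%:C + 'i%C * (complex.Im (c m) - t)%:C.
  case: (c m) => u v; apply/eqP; rewrite eq_complex /=.
  by rewrite !mul0r !mul1r ?mulr0 ?subr0 ?addr0 ?add0r !eqxx.
apply: le_trans (lerD (ltW (hc m)) (le_normcD _ _)) _.
rewrite Normc.normcM !normc_real.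
have -> : Normc.normc ('i%C : R[i]) = 1.
  by rewrite /= expr0n /= add0r expr1n sqrtr1.
rewrite mul1r; move: m1 m2 => /= /ltW m1 /ltW m2.
rewrite [`|complex.Re _ - r|]distrC [`|complex.Im _ - t|]distrC.
apply: le_trans (lerD (ltW mK) (lerD m1 m2)) _.
move: (e : R) e0 => e' e0; lra.
Qed.

End ScalarsClosed.

(** * The Cuntz algebra and its gauge action *)

Section CuntzGauge.

Variables (R : realType) (n : nat) (O : cstarAlg R) (s : 'I_n -> O).
Hypothesis hO : is_cuntz_algebra s.
Hypothesis hn : (2 <= n)%N.
Variables (gam : R[i] -> O -> O) (hgam : is_gauge_action s gam).
Variables (A : cstarAlg R) (iota : A -> O) (hiota : is_inclusion iota).
Hypothesis hA : range iota = fixed_points gam.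
Variable E : O -> A.
Hypothesis hE : forall x, is_circle_average (fun z => gam z x) (iota (E x)).

Lemma star_gen_mul i j : star (s i) * s j = (i == j)%:R.
Proof. by case: hO => -[h _] _ _; exact: h. Qed.

Lemma sum_gen_star : \sum_(i < n) s i * star (s i) = 1.
Proof. by case: hO => -[_ h] _ _. Qed.

(** The closure [T] of S is a closed *-subalgebra, so generation applies to it. In a product the
    approximant of b is chosen after that of a, since its tolerance depends on the norm of the
    latter. *)
Lemma generated_dense (S : set O) : star_subalgebra S -> (forall i, S (s i)) ->
  ndense (@cnorm R O) S.
Proof.
move=> [S1 SZD SM SS] Ss.
pose T := [set x : O | forall e : R, 0 < e -> exists y, S y /\ cnorm (x - y) < e].
have ST x : S x -> T x by move=> Sx e e0; exists x; rewrite subrr cnorm0.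
have two (e : R) : 0 < e -> 0 < e / 2 by move=> e0; rewrite divr_gt0.
suff -> : ndense (@cnorm R O) S = forall x, T x.
  move=> x; suff -> : T = setT by [].
  case: hO => _ gen _; apply: gen => [u l hu /ncvgP hl e e0| |i]; last exact: ST.
    have [K HK] := hl _ (two _ e0); have [y [Sy hy]] := hu K _ (two _ e0).
    exists y; split=> //; apply: le_lt_trans (cnorm_triangle (u K) _ _) _.
    by rewrite (splitr e) ltrD // cnorm_distC HK.
  split; first exact: ST.
  - move=> c a b Ta Tb e e0.
    have c1 : 0 < Normc.normc c + 1.
      by rewrite ltr_wpDl // -(mulr1 (Normc.normc c)) -(cnorm1 O) -cnormZ cnorm_ge0.
    have [y [Sy hy]] := Ta _ (divr_gt0 (two _ e0) c1).
    have [z [Sz hz]] := Tb _ (two _ e0); exists (c *: y + z).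
    split; first exact: SZD.
    rewrite opprD addrACA -scalerBr; apply: le_lt_trans (cnormD _ _) _.
    rewrite [ltRHS](splitr e) ltrD // cnormZ.
    apply: le_lt_trans (_ : (Normc.normc c + 1) * cnorm (a - y) < _).
      by rewrite ler_wpM2r ?cnorm_ge0 // lerDl.
    by move: hy; rewrite ltr_pdivlMr // mulrC.
  - move=> a b Ta Tb e e0.
    have b1 : 0 < cnorm b + 1 by rewrite ltr_wpDl ?cnorm_ge0.
    have [y [Sy hy]] := Ta _ (divr_gt0 (two _ e0) b1).
    have y1 : 0 < cnorm y + 1 by rewrite ltr_wpDl ?cnorm_ge0.
    have [z [Sz hz]] := Tb _ (divr_gt0 (two _ e0) y1).
    exists (y * z); split; first exact: SM.
    have -> : a * b - y * z = (a - y) * b + y * (b - z) by ncring.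
    apply: le_lt_trans (cnormD _ _) _; rewrite [ltRHS](splitr e).
    move: hy; rewrite ltr_pdivlMr // => hy; move: hz; rewrite ltr_pdivlMr // => hz.
    apply: ltrD.
      apply: le_lt_trans hy; apply: le_trans (cnormM _ _) _.
      by rewrite ler_wpM2l ?cnorm_ge0 // lerDl.
    apply: le_lt_trans hz; apply: le_trans (cnormM _ _) _.
    by rewrite mulrC ler_wpM2l ?cnorm_ge0 // lerDl.
  - move=> a Ta e e0; have [y [Sy hy]] := Ta _ e0.
    by exists (star y); split; [exact: SS | rewrite -starB cnorm_star].
apply/propext; split=> // h x e e0; exact: h.
Qed.

(** * Words, monomials and their span *)

Definition word (al : seq 'I_n) : O := \prod_(i <- al) s i.

Lemma word_cons i al : word (i :: al) = s i * word al.
Proof. by rewrite /word big_cons. Qed.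

Lemma word_nil : word [::] = 1.
Proof. by rewrite /word big_nil. Qed.

Lemma word_cat al be : word (al ++ be) = word al * word be.
Proof. by rewrite /word big_cat. Qed.

Definition mono al be : O := word al * star (word be).

Inductive mspan : O -> Prop :=
| mspan0 : mspan 0
| mspanD c al be x : mspan x -> mspan (c *: mono al be + x).

Lemma mspan_add x y : mspan x -> mspan y -> mspan (x + y).
Proof.
by elim=> [|c al be z _ IH] hy; rewrite ?add0r // -addrA; apply/mspanD/IH.
Qed.

Lemma mspan_scale c x : mspan x -> mspan (c *: x).
Proof.
elim=> [|d al be z _ IH]; first by rewrite scaler0; exact: mspan0.
by rewrite scalerDr scalerA; apply: mspanD.
Qed.

Lemma mspan_mono al be : mspan (mono al be).
Proof. by rewrite -[mono al be]scale1r -[_ *: _]addr0; apply/mspanD/mspan0. Qed.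

Lemma mspan_star x : mspan x -> mspan (star x).
Proof.
elim=> [|c al be z _ IH]; first by rewrite star0; exact: mspan0.
rewrite starD starZ starM starK; exact: mspanD.
Qed.

(** Equal leading letters cancel until two letters differ, which gives 0, or one word is exhausted
    and the rest of the other remains. Hence the monomials span an algebra. *)
Lemma word_starM be al : [\/ star (word be) * word al = 0,
  exists ga, star (word be) * word al = word ga |
  exists ga, star (word be) * word al = star (word ga)].
Proof.
elim: be al => [|i be IH] [|j al].
- by constructor 2; exists [::]; rewrite word_nil star1 mul1r.
- by constructor 2; exists (j :: al); rewrite word_nil star1 mul1r.
- by constructor 3; exists (i :: be); rewrite word_nil mulr1.
rewrite !word_cons starM -mulrA [star (s i) * _]mulrA star_gen_mul.
case: eqP => _; first by rewrite mul1r.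
by constructor 1; rewrite mul0r mulr0.
Qed.

Lemma mspan_monoM al be al' be' : mspan (mono al be * mono al' be').
Proof.
have -> : mono al be * mono al' be' =
    word al * (star (word be) * word al') * star (word be').
  by rewrite /mono !mulrA.
case: (word_starM be al') => [->|[ga -> ]|[ga -> ]].
- by rewrite mulr0 mul0r; exact: mspan0.
- by rewrite -word_cat; exact: mspan_mono.
- by rewrite -mulrA -starM -word_cat; exact: mspan_mono.
Qed.

Lemma mspan_mul x y : mspan x -> mspan y -> mspan (x * y).
Proof.
elim=> [|c al be z _ IH] hy; first by rewrite mul0r; exact: mspan0.
rewrite mulrDl; apply: mspan_add; last exact: IH.
elim: hy => [|d al' be' t _ IH']; first by rewrite mulr0; exact: mspan0.
rewrite mulrDr; apply: mspan_add => //.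
rewrite -scalerAl -scalerAr; do 2!apply: mspan_scale; exact: mspan_monoM.
Qed.

Lemma mspan_dense x (e : R) : 0 < e -> exists y, mspan y /\ cnorm (x - y) < e.
Proof.
apply: (generated_dense (S := mspan)).
  split.
  - by have := mspan_mono [::] [::]; rewrite /mono word_nil mul1r star1.
  - by move=> c a b ha hb; apply: mspan_add => //; apply: mspan_scale.
  - exact: mspan_mul.
  - exact: mspan_star.
by move=> i; have := mspan_mono [:: i] [::];
   rewrite /mono word_nil word_cons word_nil mulr1 star1 mulr1.
Qed.

Implicit Types (z : R[i]) (k l : int) (x y : O).

Lemma gam_hom z : `|z| = 1 -> is_star_hom (gam z).
Proof. by move=> /hgam[]. Qed.

Lemma gam_s z j : `|z| = 1 -> gam z (s j) = z *: s j.
Proof. by move=> /hgam[]. Qed.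

(** * Spectral subspaces of the gauge action *)

Definition sp k x := forall z, `|z| = 1 -> gam z x = z ^ k *: x.

Lemma spZD k (c : R[i]) x y : sp k x -> sp k y -> sp k (c *: x + y).
Proof.
move=> hx hy z hz; rewrite (shomZD (gam_hom hz)) hx // hy // scalerDr.
by rewrite !scalerA mulrC.
Qed.

Lemma sp0 k : sp k 0.
Proof. by move=> z hz; rewrite (shom0 (gam_hom hz)) scaler0. Qed.

Lemma spD k x y : sp k x -> sp k y -> sp k (x + y).
Proof. by move=> hx hy; rewrite -[x]scale1r; apply: spZD. Qed.

Lemma spZ k c x : sp k x -> sp k (c *: x).
Proof. by move=> hx; rewrite -[_ *: _]addr0; apply: spZD => //; exact: sp0. Qed.

Lemma sp_sum k I (r : seq I) (P : pred I) (F : I -> O) :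
  (forall i, P i -> sp k (F i)) -> sp k (\sum_(i <- r | P i) F i).
Proof. by move=> h; elim/big_ind: _ => //; [exact: sp0 | exact: spD]. Qed.

Lemma spM k l x y : sp k x -> sp l y -> sp (k + l) (x * y).
Proof.
move=> hx hy z hz; rewrite (shomM (gam_hom hz)) hx // hy //.
by rewrite -scalerAl -scalerAr scalerA expfzDr // unit_neq0.
Qed.

Lemma sp_star k x : sp k x -> sp (- k) (star x).
Proof.
move=> hx z hz; rewrite (shom_star (gam_hom hz)) hx // starZ; congr (_ *: _).
by rewrite fmorphXz /= conj_unit // exprz_inv.
Qed.

Lemma sp1 : sp 0 1.
Proof. by move=> z hz; rewrite (shom1 (gam_hom hz)) expr0z scale1r. Qed.

Lemma sp_s j : sp 1 (s j).
Proof. by move=> z hz; rewrite gam_s. Qed.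

Lemma sp_word al : sp (size al)%:Z (word al).
Proof.
elim: al => [|i al IH]; first by rewrite word_nil; exact: sp1.
by rewrite word_cons -[size _]/(1 + size al)%N PoszD; apply: spM => //; exact: sp_s.
Qed.

Lemma sp_mono al be : sp ((size al)%:Z - (size be)%:Z) (mono al be).
Proof. by apply: spM; [exact: sp_word | apply: sp_star; exact: sp_word]. Qed.

Lemma ncvg_gam z (u : nat -> O) x : `|z| = 1 ->
  ncvg (@cnorm R O) u x -> ncvg (@cnorm R O) (fun i => gam z (u i)) (gam z x).
Proof. by move=> hz; exact: (ncvg_shom (gam_hom hz)). Qed.

Lemma sp_closed k (u : nat -> O) x :
  (forall i, sp k (u i)) -> ncvg (@cnorm R O) u x -> sp k x.
Proof.
move=> hu ux z hz; apply: ncvg_uniq (ncvg_gam hz ux) _.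
have := ncvg_scale (z ^ k) ux; congr ncvg; apply/funext => i.
by rewrite hu.
Qed.

Lemma sp_neq k l x : k != l -> sp k x -> sp l x -> x = 0.
Proof.
move=> kl hk hl; have m0 : k - l != 0 by rewrite subr_eq0.
(* Chosen so that z^(k - l) = -1, which leaves -2 x = 0. *)
pose z := circ ((k - l)%:~R^-1 / 2 : R).
have hz : `|z| = 1 := circ_norm _.
have zm : z ^ (k - l) = -1.
  by rewrite -circ_int mulrAC mulVf ?mul1r ?circ_half // intr_eq0.
have e : z ^ k *: x = z ^ l *: x by rewrite -hk // -hl.
have : (z ^ (k - l) - 1) *: x = 0.
  rewrite scalerBl scale1r expfzDr ?unit_neq0 // mulrC -scalerA e scalerA.
  by rewrite -expfzDr ?unit_neq0 // addNr expr0z scale1r subrr.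
rewrite zm -opprD scaleNr => /eqP; rewrite oppr_eq0 => /eqP h.
have := congr1 (fun y : O => 2^-1 *: y) h.
by rewrite scaler0 scalerA mulVf ?scale1r.
Qed.

Lemma mspan_fourier x : mspan x -> exists (K : nat) (f : int -> O),
  [/\ forall k, sp k (f k), forall k, (K < `|k|)%N -> f k = 0
    & x = \sum_(k <- sym K) f k].
Proof.
elim=> [|c al be y _ [K [f [hf f0 ->]]]].
  exists 0%N, (fun=> 0); split=> // [k|]; first exact: sp0.
  by rewrite big1.
pose d := (size al)%:Z - (size be)%:Z.
pose g k := if k == d then c *: mono al be else 0.
have g0 k : (`|d| < `|k|)%N -> g k = 0.
  by rewrite /g; case: eqP => // ->; rewrite ltnn.
exists (maxn K `|d|), (fun k => g k + f k); split => [k|k|].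
- rewrite /g; apply: spD => //; case: eqP => [-> | _]; last exact: sp0.
  by apply: spZ; exact: sp_mono.
- by rewrite gtn_max => /andP[Kk dk]; rewrite g0 // f0 // addr0.
rewrite big_split /=; congr (_ + _); last by rewrite (sum_sym_widen (leq_maxl _ _) f0).
rewrite (sum_sym_widen (leq_maxr _ _) g0) (bigD1_seq d) ?sym_uniq ?mem_sym //=.
rewrite {1}/g eqxx big1 ?addr0 // => k kd; rewrite /g (negPf kd) //.
Qed.

Lemma fourier_dense x (e : R) : 0 < e -> exists (K : nat) (f : int -> O),
  [/\ forall k, sp k (f k), forall k, (K < `|k|)%N -> f k = 0
    & cnorm (x - \sum_(k <- sym K) f k) < e].
Proof.
move=> e0; have [y [/mspan_fourier [K [f [hf f0 ->]]] xy]] := mspan_dense x e0.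
by exists K, f.
Qed.

(** True on sums of homogeneous elements by the definition of the degree, hence on their limits
    because [gam 1] is contractive. *)
Lemma gam1 x : gam 1 x = x.
Proof.
have h1 : `|1 : R[i]| = 1 by rewrite normr1.
apply/eqP; rewrite -subr_eq0; apply/eqP; apply: cnorm_small => e e0.
have [K [f [hf _]]] := fourier_dense x (divr_gt0 e0 (ltr0n _ 2)).
set y := \sum_(_ <- _) _ => xy.
have gy : gam 1 y = y.
  rewrite (shom_sum (gam_hom h1)); apply: eq_bigr => k _.
  by rewrite hf // exp1rz scale1r.
apply: le_trans (cnorm_triangle y _ _) _.
rewrite -{1}gy -(shomB (gam_hom h1)) [cnorm (y - x)]cnorm_distC.
rewrite [leRHS](splitr e) lerD ?(ltW xy) //.
by apply: le_trans (shom_contract (gam_hom h1) _) _; exact: ltW.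
Qed.

(** On an element of degree k the increment is (circ (t k) - 1) times that element. Sums of such
    elements approximate x, and contractivity makes the approximation uniform in t. *)
Lemma gam_continuous x (e : R) : 0 < e ->
  exists d : R, 0 < d /\ forall t, `|t| < d -> cnorm (gam (circ t) x - x) < e.
Proof.
pose cont x := forall e : R, 0 < e ->
  exists d : R, 0 < d /\ forall t, `|t| < d -> cnorm (gam (circ t) x - x) < e.
have two (r : R) : 0 < r -> 0 < r / 2 by move=> e0; rewrite divr_gt0.
have contD y w : cont y -> cont w -> cont (y + w).
  move=> hy hz r r0; have [d [d0 hd]] := hy _ (two _ r0).
  have [d' [d0' hd']] := hz _ (two _ r0); exists (Num.min d d').
  split=> [|t]; rewrite ?lt_min ?d0 // => /andP[td td'].
  rewrite (shomD (gam_hom (circ_norm t))) opprD addrACA.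
  apply: le_lt_trans (cnormD _ _) _.
  by rewrite [ltRHS](splitr r) ltrD ?hd ?hd'.
have cont_sp k y : sp k y -> cont y.
  move=> hy r r0; have y1 : 0 < cnorm y + 1 by rewrite ltr_wpDl ?cnorm_ge0.
  have [d [d0 hd]] := circ_continuous0 (divr_gt0 r0 y1).
  have k1 : 0 < `|k%:~R : R| + 1 by rewrite ltr_wpDl.
  exists (d / (`|k%:~R| + 1)); split; first by rewrite divr_gt0.
  move=> t; rewrite ltr_pdivlMr // => td.
  rewrite hy ?circ_norm // -circ_int -[X in _ - X]scale1r -scalerBl cnormZ.
  have := hd (t * k%:~R); rewrite normrM ltr_pdivlMr // => h.
  apply: le_lt_trans (h _); last first.
    by apply: le_lt_trans td; rewrite ler_wpM2l // lerDl.
  by rewrite ler_wpM2l ?lerDl // -(mulr1 (Normc.normc _)) -(cnorm1 O) -cnormZ cnorm_ge0.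
have cont_mspan y : mspan y -> cont y.
  elim=> [|c al be z _ IH]; first exact: cont_sp (sp0 0).
  by apply: contD => //; apply: cont_sp (spZ c (sp_mono al be)).
move=> e0; have e3 : 0 < e / 3 by rewrite divr_gt0.
have [y [/cont_mspan cy xy]] := mspan_dense x e3.
have [d [d0 hd]] := cy _ e3; exists d; split=> // t /hd h.
have hc := gam_hom (circ_norm t).
apply: le_lt_trans (cnorm_triangle (gam (circ t) y) _ _) _.
rewrite -(shomB hc).
have h1 := le_lt_trans (shom_contract hc (x - y)) xy.
have h2 := cnorm_triangle y (gam (circ t) y) x.
rewrite [cnorm (y - x)]cnorm_distC in h2.
lra.
Qed.

(** The hypothesis 2 <= n enters through these two distinct letters: powers of the first supply
    bases in negative degrees, and the second ends the probe words. *)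
Definition i0 : 'I_n := Ordinal (ltnW hn).
Definition i1 : 'I_n := Ordinal hn.

Lemma i01 : i0 != i1. Proof. by []. Qed.

(* As x = sum_u u (u^* x), such a family is a right Pimsner-Popa basis of the
   spectral subspace of degree k. *)
Lemma pp_basis k : exists u : seq O,
  (forall x, x \in u -> sp k x) /\ \sum_(x <- u) x * star x = 1.
Proof.
case: k => m.
  elim: m => [|m [u [hu u1]]].
    exists [:: 1]; split; last by rewrite big_seq1 star1 mulr1.
    by move=> x; rewrite inE => /eqP ->; exact: sp1.
  exists [seq x * s i | x <- u, i <- enum 'I_n]; split.
    move=> _ /allpairsP [[x j] /= [xu _ ->]]; rewrite -addn1 PoszD.
    by apply: spM; [exact: hu | exact: sp_s].
  rewrite big_allpairs_dep -[RHS]u1; apply: eq_bigr => x _.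
  rewrite big_enum /= -[X in X * star x]mulr1 -sum_gen_star mulr_sumr mulr_suml.
  by apply: eq_bigr => j _; rewrite starM !mulrA.
exists [:: star (word (nseq m.+1 i0))]; split.
  move=> x; rewrite inE => /eqP ->; rewrite NegzE; apply: sp_star.
  by have := sp_word (nseq m.+1 i0); rewrite size_nseq.
rewrite big_seq1 starK; elim: m.+1 => [|p IH]; first by rewrite word_nil star1 mulr1.
rewrite word_cons starM -mulrA [star (s i0) * _]mulrA star_gen_mul eqxx mul1r.
exact: IH.
Qed.

Implicit Types (a b : A).

Lemma iota_hom : is_star_hom iota. Proof. by case: hiota. Qed.

Lemma iota_norm a : cnorm (iota a) = cnorm a. Proof. by case: hiota. Qed.

Lemma iota_inj : injective iota.
Proof.
move=> a b ab; apply/eqP; rewrite -subr_eq0 -cnorm_eq0 -iota_norm.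
by rewrite (shomB iota_hom) ab subrr cnorm0.
Qed.

Lemma sp_iota a : sp 0 (iota a).
Proof.
move=> z hz; rewrite expr0z scale1r.
have : fixed_points gam (iota a) by rewrite -hA; exists a.
exact.
Qed.

Lemma sp0_iota x : sp 0 x -> exists a, x = iota a.
Proof.
move=> hx; have : range iota x.
  by rewrite hA => z hz; rewrite hx // expr0z scale1r.
by case=> a _ <-; exists a.
Qed.

(** * The conditional expectation *)

Definition mean (J : nat) x : O :=
  (J%:R^-1)%:C *: \sum_(i < J) gam (circ (i%:R / J%:R)) x.

(** [mean J] is the Riemann sum of the uniform partition tagged at left endpoints. The properties of
    E below hold for every mean, or for all large J, and pass to this limit. *)
Lemma ncvg_mean x : ncvg (@cnorm R O) (fun J => mean J.+1 x) (iota (E x)).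
Proof.
apply/ncvgP => e e0; have [d d0 hd] := hE x e0.
have [K dK] := ltr_add_invr d0; rewrite add0r in dK.
exists K => J KJ.
have J0 : J.+1%:R != 0 :> R by rewrite pnatr_eq0.
have step i : i.+1%:R / J.+1%:R - i%:R / J.+1%:R = J.+1%:R^-1 :> R.
  by rewrite -mulrBl -natr1 addrAC subrr add0r mul1r.
pose t (i : nat) : R := i%:R / J.+1%:R.
have := hd J.+1 t t; rewrite /t mul0r mulfV // => /(_ erefl erefl).
under eq_bigr do rewrite step; rewrite -scaler_sumr; apply => i _; split.
  by rewrite lexx /= ler_pM2r ?invr_gt0 ?ltr0n // ler_nat.
rewrite step; apply: le_lt_trans dK.
by rewrite lef_pV2 ?posrE ?ltr0n // ler_nat.
Qed.

Lemma meanZD J (c : R[i]) x y : mean J (c *: x + y) = c *: mean J x + mean J y.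
Proof.
rewrite /mean scalerA mulrC -scalerA -scalerDr; congr (_ *: _).
rewrite scaler_sumr -big_split; apply: eq_bigr => i _.
by rewrite (shomZD (gam_hom (circ_norm _))).
Qed.

Lemma mean_iotaM J a x : mean J (iota a * x) = iota a * mean J x.
Proof.
rewrite /mean -scalerAr mulr_sumr; congr (_ *: _); apply: eq_bigr => i _.
have hc := circ_norm (i%:R / J%:R : R).
by rewrite (shomM (gam_hom hc)) sp_iota // expr0z scale1r.
Qed.

Lemma meanM_iota J a x : mean J (x * iota a) = mean J x * iota a.
Proof.
rewrite /mean -scalerAl mulr_suml; congr (_ *: _); apply: eq_bigr => i _.
have hc := circ_norm (i%:R / J%:R : R).
by rewrite (shomM (gam_hom hc)) sp_iota // expr0z scale1r.
Qed.

Lemma mean_sp0 J x : (0 < J)%N -> sp 0 x -> mean J x = x.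
Proof.
move=> J0 hx; rewrite /mean (eq_bigr (fun=> x)) => [|i _]; last first.
  by rewrite hx ?circ_norm // expr0z scale1r.
rewrite sumr_const card_ord -[x *+ _]scaler_nat scalerA.
rewrite -(rmorph_nat (real_complex R)) -rmorphM mulVf ?realZ1 //.
by rewrite pnatr_eq0 -lt0n.
Qed.

Lemma mean_sp J k x : k != 0 -> (`|k| < J)%N -> sp k x -> mean J x = 0.
Proof.
move=> k0 kJ hx; rewrite /mean.
rewrite (eq_bigr (fun i : 'I_J => circ (i%:R / J%:R) ^ k *: x)) => [|i _].
  by rewrite -scaler_suml circ_sum // scale0r scaler0.
by rewrite hx ?circ_norm.
Qed.

Lemma mean_pos J x : pos x -> pos (mean J x).
Proof.
move=> px; apply: posZ; first by rewrite invr_ge0 ler0n.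
by apply: pos_sum => i _; apply: (shom_pos (gam_hom (circ_norm _))).
Qed.

Lemma E_lin : linear E.
Proof.
move=> c x y; apply: iota_inj; rewrite (shomZD iota_hom).
apply: ncvg_uniq (ncvg_mean _) _.
have := ncvgD (ncvg_scale c (ncvg_mean x)) (ncvg_mean y); congr ncvg.
by apply/funext => J; rewrite meanZD.
Qed.

Lemma E_sp0 x : sp 0 x -> iota (E x) = x.
Proof.
move=> hx; apply: ncvg_uniq (ncvg_mean _) _.
by have := ncvg_cst x; congr ncvg; apply/funext => J; rewrite mean_sp0.
Qed.

Lemma E_iota a : E (iota a) = a.
Proof. by apply: iota_inj; rewrite E_sp0 //; exact: sp_iota. Qed.

Lemma E_iotaM a x : E (iota a * x) = a * E x.
Proof.
apply: iota_inj; rewrite (shomM iota_hom); apply: ncvg_uniq (ncvg_mean _) _.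
have := ncvg_mull (iota a) (ncvg_mean x); congr ncvg.
by apply/funext => J; rewrite mean_iotaM.
Qed.

Lemma EM_iota x a : E (x * iota a) = E x * a.
Proof.
apply: iota_inj; rewrite (shomM iota_hom); apply: ncvg_uniq (ncvg_mean _) _.
have := ncvg_mulr (iota a) (ncvg_mean x); congr ncvg.
by apply/funext => J; rewrite meanM_iota.
Qed.

Lemma E_sp k x : k != 0 -> sp k x -> E x = 0.
Proof.
move=> k0 hx; apply: iota_inj; rewrite (shom0 iota_hom).
apply: cnorm_small => e e0; have /ncvgP/(_ _ e0) [K HK] := ncvg_mean x.
have := HK (maxn K `|k|) (leq_maxl _ _); rewrite (mean_sp k0) //.
  by rewrite sub0r cnormN => /ltW.
by rewrite ltnS leq_maxr.
Qed.

(** Means of a positive element are positive and the cone of [O] is closed; [isometry_pos] brings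
    the conclusion back to [A]. *)
Lemma E_pos x : pos x -> pos (E x).
Proof.
move=> px; apply: (isometry_pos iota_hom iota_norm); apply: pos_closed => e e0.
have /ncvgP/(_ _ e0) [K HK] := ncvg_mean x; exists (mean K.+1 x).
by split; [exact: mean_pos | rewrite cnorm_distC ltW // HK].
Qed.

Lemma ED x y : E (x + y) = E x + E y.
Proof. by rewrite -[x in LHS]scale1r E_lin scale1r. Qed.

Lemma E0 : E 0 = 0.
Proof. by rewrite -(shom0 iota_hom) E_iota. Qed.

Lemma EZ (c : R[i]) x : E (c *: x) = c *: E x.
Proof. by rewrite -[_ *: x]addr0 E_lin E0 addr0. Qed.

Lemma EB x y : E (x - y) = E x - E y.
Proof. by rewrite ED -scaleN1r EZ scaleN1r. Qed.

Lemma E_sum I (r : seq I) (P : pred I) (F : I -> O) :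
  E (\sum_(i <- r | P i) F i) = \sum_(i <- r | P i) E (F i).
Proof. exact: (big_morph _ ED E0). Qed.

Lemma cond_exp_E : is_cond_exp iota E.
Proof.
split; [exact: E_lin | exact: E_iota | exact: E_iotaM | | ].
  by move=> b a; rewrite EM_iota.
by move=> b /cposP pb; apply/cposP/E_pos.
Qed.

(* A positive element dominates a fixed fraction of its mean over a short arc,
   on which the gauge action moves it by less than half its norm. *)
Lemma faithful_pos y : pos y -> E y = 0 -> y = 0.
Proof.
move=> py Ey; have [//|yn] := eqVneq y 0.
have y0 : 0 < cnorm y by rewrite lt_def cnorm_eq0 yn cnorm_ge0.
have [d [d0 hd]] := gam_continuous y (divr_gt0 y0 (ltr0n _ 2)).
have [p pd] := ltr_add_invr d0; rewrite add0r in pd.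
have e0 : 0 < cnorm y / 2 / p.+1%:R by rewrite !divr_gt0 ?ltr0n.
have /ncvgP/(_ _ e0) [K HK] := ncvg_mean y.
(* The first q of the J roots of unity fill the fraction 1/(p + 1) < d of the circle, where [gam]
   moves y by less than |y|/2. Their share of the mean thus has norm at least |y|/2/(p + 1), a bound
   independent of J. *)
pose q := K.+1; pose J := (p.+1 * q)%N.
have J0 : (0 < J)%N by rewrite muln_gt0.
have JR : 0 < J%:R :> R by rewrite ltr0n.
have KJ : (K <= J.-1)%N by rewrite /J /q; nia.
have := HK _ KJ; rewrite Ey (shom0 iota_hom) subr0 prednK // ltNge => /negP[].
pose part := (J%:R^-1)%:C *: \sum_(i < q) gam (circ (i%:R / J%:R)) y.
have hg i := gam_hom (circ_norm (i%:R / J%:R : R)).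
have qJ : (q <= J)%N by rewrite /J leq_pmull.
apply: le_trans (pos_le_norm (a := part) _ _); last 2 first.
- apply: posZ; first by rewrite invr_ge0 ltW.
  by apply: pos_sum => i _; apply: (shom_pos (hg _)).
- rewrite /mean -scalerBr; apply: posZ; first by rewrite invr_ge0 ltW.
  rewrite -(big_mkord xpredT (fun i => gam (circ (i%:R / J%:R)) y)).
  rewrite (big_cat_nat (n := q)) //= big_mkord [X in pos (X - _)]addrC addrK.
  by apply: pos_sum => i _; apply: (shom_pos (hg _)).
have -> : part = (J%:R^-1)%:C *: (q%:R%:C *: y -
    \sum_(i < q) (y - gam (circ (i%:R / J%:R)) y)).
  congr (_ *: _); rewrite sumrB sumr_const card_ord rmorph_nat scaler_nat.
  by rewrite subKr.
rewrite cnormZr gtr0_norm ?invr_gt0 //.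
have -> : cnorm y / 2 / p.+1%:R = J%:R^-1 * (q%:R * cnorm y - q%:R * (cnorm y / 2)).
  by rewrite /J natrM; field; rewrite nat1r !pnatr_eq0.
rewrite ler_pM2l ?invr_gt0 //.
apply: le_trans (_ : _ <= cnorm (q%:R%:C *: y) -
    cnorm (\sum_(i < q) (y - gam (circ (i%:R / J%:R)) y))) _; last first.
  rewrite lerBlDr; apply: le_trans _ (cnormD _ _); by rewrite subrK.
rewrite cnormZr ger0_norm ?ler0n // lerD2l lerN2.
apply: le_trans (cnorm_sum _ _ _) _.
apply: le_trans (ler_sum _ (G := fun=> cnorm y / 2) _) _; last first.
  by rewrite sumr_const card_ord mulr_natl.
move=> i _; rewrite cnorm_distC ltW // hd //.
rewrite ger0_norm ?divr_ge0 ?ler0n //; apply: le_lt_trans pd.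
rewrite ler_pdivrMr // /J natrM mulrA mulVf ?pnatr_eq0 // mul1r ler_nat.
exact: ltnW.
Qed.

Lemma faithful_E : is_faithful E.
Proof. by move=> b /cposP; exact: faithful_pos. Qed.

(** * The relative commutant *)

Definition comm_iota x := forall a, iota a * x = x * iota a.

Lemma comm_sp0 x y : comm_iota x -> sp 0 y -> y * x = x * y.
Proof. by move=> hx /(sp0_iota) [a ->]. Qed.

(** The canonical endomorphism of the Cuntz algebra; it is used for its contractivity. *)
Definition shift x : O := \sum_(i < n) s i * x * star (s i).

Lemma shift_hom : is_star_hom shift.
Proof.
split.
- move=> c x y; rewrite /shift scaler_sumr -big_split; apply: eq_bigr => i _.
  by rewrite mulrDr mulrDl -scalerAr -scalerAl.
- split=> [|x y].
    by rewrite -[RHS]sum_gen_star; apply: eq_bigr => i _; rewrite mulr1.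
  rewrite /shift mulr_suml; apply: eq_bigr => i _.
  rewrite mulr_sumr (bigD1 i) //= big1 ?addr0 => [|j ji].
    by rewrite !mulrA -[s i * x * star _ * s i]mulrA star_gen_mul eqxx mulr1.
  rewrite !mulrA -[s i * x * star _ * s j]mulrA star_gen_mul eq_sym (negPf ji).
  by rewrite mulr0 !mul0r.
- move=> x; rewrite /shift star_sum; apply: eq_bigr => i _.
  by rewrite !starM starK !mulrA.
Qed.

Lemma comm_compress x i : comm_iota x -> comm_iota (star (s i) * x * s i).
Proof.
move=> hx a; have ha : sp 0 (s i * iota a * star (s i)).
  have -> : (0 : int) = 1 + 0 - 1 by [].
  apply: spM; last by apply: sp_star; exact: sp_s i.
  by apply: spM; [exact: sp_s i | exact: sp_iota a].
have ss : star (s i) * s i = 1 by rewrite star_gen_mul eqxx.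
transitivity (star (s i) * (s i * iota a * star (s i) * x) * s i).
  by rewrite !mulrA ss mul1r.
by rewrite (comm_sp0 hx ha) -!mulrA ss mulr1.
Qed.

(** x commutes with each [s j * star (s i)], of degree 0. Multiplying x by 1 = sum of
    [s j * star (s j)] therefore recovers it from a single compression, which by contractivity of
    [shift] has norm at least |x|. *)
Lemma comm_shift x i : comm_iota x -> x = shift (star (s i) * x * s i).
Proof.
move=> hx; rewrite -[LHS]mulr1 -sum_gen_star mulr_sumr; apply: eq_bigr => j _.
have hij : sp 0 (s j * star (s i)).
  rewrite -[0](addrN 1); apply: spM; first exact: sp_s j.
  by apply: sp_star; exact: sp_s i.
have ss : star (s i) * s i = 1 by rewrite star_gen_mul eqxx.
transitivity (s j * star (s i) * x * (s i * star (s j))); last by rewrite !mulrA.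
by rewrite (comm_sp0 hx hij) -!mulrA [star (s i) * (s i * _)]mulrA ss mul1r.
Qed.

Lemma comm_norm x al : comm_iota x ->
  cnorm x <= cnorm (star (word al) * x * word al).
Proof.
elim: al x => [|i al IH] x hx; first by rewrite word_nil star1 mul1r mulr1.
rewrite {1}(comm_shift i hx); apply: le_trans (shom_contract shift_hom _) _.
apply: le_trans (IH _ (comm_compress i hx)) _.
by rewrite word_cons starM !mulrA.
Qed.

Lemma word_isom al : star (word al) * word al = 1.
Proof.
elim: al => [|i al IH]; first by rewrite word_nil star1 mulr1.
by rewrite word_cons starM -mulrA [star (s i) * _]mulrA star_gen_mul eqxx mul1r.
Qed.

Lemma cnorm_word al : cnorm (word al) = 1.
Proof.
apply/eqP; rewrite -(@pexpr_eq1 _ _ 2) ?cnorm_ge0 //.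
by rewrite -cstar_identity word_isom cnorm1.
Qed.

(* The word 1^m 2 overlaps none of its proper shifts, so compression by it
   sends every monomial of small length to a scalar. *)
Definition probe m := word (nseq m i0 ++ [:: i1]).

Lemma probeS m : probe m.+1 = s i0 * probe m.
Proof. by rewrite /probe /= word_cons. Qed.

Lemma probe_lt p q : (p < q)%N -> star (probe p) * probe q = 0.
Proof.
elim: p q => [|p IH] [|q] // pq; rewrite probeS.
  rewrite /probe /= word_cons word_nil mulr1 mulrA star_gen_mul.
  by rewrite eq_sym (negPf i01) mul0r.
rewrite probeS starM -mulrA [star (s i0) * _]mulrA star_gen_mul eqxx mul1r.
exact: IH.
Qed.

Lemma probeM p q : star (probe p) * probe q = (p == q)%:R.
Proof.
case: (ltngtP p q) => [pq|qp|->].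
- exact: probe_lt.
- by rewrite -[LHS]starK starM starK probe_lt // star0.
- exact: word_isom.
Qed.

(** A word this short meets only the letters [i0] of the probe: it cancels entirely or produces
    0. *)
Lemma probe_word m al : (size al <= m)%N ->
  star (probe m) * word al = 0 \/
  star (probe m) * word al = star (probe (m - size al)).
Proof.
elim: al m => [|j al IH] m hm; first by right; rewrite word_nil mulr1 subn0.
case: m hm => // m hm; rewrite probeS word_cons starM.
rewrite -mulrA [star (s i0) * _]mulrA star_gen_mul; case: eqP => _.
  by rewrite mul1r subSS; apply: IH.
by left; rewrite mul0r mulr0.
Qed.

Lemma probe_scalar x : mspan x -> exists N, forall m, (N <= m)%N ->
  exists c : R[i], star (probe m) * x * probe m = c%:A.
Proof.
elim=> [|d al be y _ [N hN]].
  by exists 0%N => m _; exists 0; rewrite mulr0 mul0r scale0r.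
exists (maxn N (maxn (size al) (size be))) => m; rewrite !geq_max.
move=> /and3P[/hN [c hc] ma mb].
suff [c' hc'] : exists c' : R[i], star (probe m) * mono al be * probe m = c'%:A.
  exists (d * c' + c); rewrite mulrDr mulrDl hc -scalerAr -scalerAl hc'.
  by rewrite scalerDl scalerA.
have -> : star (probe m) * mono al be * probe m =
    (star (probe m) * word al) * star (star (probe m) * word be).
  by rewrite /mono starM starK !mulrA.
case: (probe_word ma) => ->; first by exists 0; rewrite mul0r scale0r.
case: (probe_word mb) => ->; first by exists 0; rewrite star0 mulr0 scale0r.
exists (m - size al == m - size be)%N%:R.
by rewrite starK probeM scaler_nat.
Qed.

Lemma irreducible_iota : irreducible_inclusion iota.
Proof.
move=> x hx; apply: scalars_closed => e e0.
have [y [/probe_scalar [N hN] xy]] := mspan_dense x e0.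
have [c hc] := hN N (leqnn _); exists c.
have hxc : comm_iota (x - c%:A).
  by move=> a; rewrite mulrBr mulrBl hx mulr_algl -scalerAr mulr1.
apply: le_lt_trans (comm_norm (nseq N i0 ++ [:: i1]) hxc) _.
(* Compression by the probe sends both c and y to c, so what remains is the compression of x - y. *)
have -> : star (word (nseq N i0 ++ [:: i1])) * (x - c%:A) *
    word (nseq N i0 ++ [:: i1]) = star (probe N) * (x - y) * probe N.
  rewrite !mulrBr !mulrBl hc; congr (_ - _).
  by rewrite -scalerAr mulr1 -scalerAl word_isom.
apply: le_lt_trans xy; apply: le_trans (cnormM _ _) _.
rewrite cnorm_word mulr1; apply: le_trans (cnormM _ _) _.
by rewrite cnorm_star cnorm_word mul1r.
Qed.

Implicit Types (H K : ghilb).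
(** * The bimodules and the action *)

Definition hsp H : {pred {ffun H -> O}} :=
  fun x : {ffun H -> O} => `[< forall i : H, sp (gdeg i) (x i) >].

Lemma hspP H (x : {ffun H -> O}) :
  reflect (forall i, sp (gdeg i) (x i)) (x \in @hsp H).
Proof. exact: asboolP. Qed.

Lemma hsp_submod_closed H : submod_closed (@hsp H).
Proof.
split=> [|c x y /hspP hx /hspP hy]; apply/hspP => i; rewrite !ffunE.
  exact: sp0.
exact: spZD.
Qed.

HB.instance Definition _ H :=
  GRing.isSubmodClosed.Build R[i] {ffun H -> O} (@hsp H) (hsp_submod_closed H).

(* F(H) is the direct sum over the basis of H of the spectral subspaces of the
   corresponding degrees. *)
Record hmod H := Hmod { hval :> {ffun H -> O}; _ : hval \in @hsp H }.

HB.instance Definition _ H := [isSub for @hval H].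
HB.instance Definition _ H := [Choice of hmod H by <:].
HB.instance Definition _ H := [SubChoice_isSubLmodule of hmod H by <:].

Lemma hval_sp H (x : hmod H) i : sp (gdeg i) (x i).
Proof. by case: x => x /= /hspP. Qed.

Lemma hmod_eq H (x y : hmod H) : (forall i, x i = y i) -> x = y.
Proof. by move=> h; apply/val_inj/ffunP. Qed.

Lemma hvalZD H (c : R[i]) (x y : hmod H) j : (c *: x + y) j = c *: x j + y j.
Proof. by rewrite -[LHS]/(val (c *: x + y) j) linearP !ffunE. Qed.

Lemma hval0 H j : (0 : hmod H) j = 0.
Proof. by rewrite -[LHS]/(val (0 : hmod H) j) raddf0 ffunE. Qed.

Lemma hvalB H (x y : hmod H) j : (x - y) j = x j - y j.
Proof. by rewrite -[LHS]/(val (x - y) j) raddfB !ffunE. Qed.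

Lemma hval_sum H I (r : seq I) (P : pred I) (F : I -> hmod H) j :
  (\sum_(k <- r | P k) F k) j = \sum_(k <- r | P k) F k j.
Proof.
rewrite -[LHS]/(val (\sum_(k <- r | P k) F k) j) raddf_sum /=.
by elim/big_rec2: _ => [|k x y _ <-]; rewrite ffunE.
Qed.

Section Make.
Variables (H : ghilb) (f : H -> O).
Hypothesis hf : forall j, sp (gdeg j) (f j).

Lemma hmk_proof : [ffun j => f j] \in @hsp H.
Proof. by apply/hspP => j; rewrite ffunE. Qed.

Definition hmk : hmod H := Hmod hmk_proof.

Lemma hmkE j : hmk j = f j.
Proof. exact: ffunE. Qed.

End Make.

Lemma sp_lact k a x : sp k x -> sp k (iota a * x).
Proof. by move=> hx; rewrite -[k]add0r; apply: spM => //; exact: sp_iota. Qed.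

Lemma sp_ract k a x : sp k x -> sp k (x * iota a).
Proof. by move=> hx; rewrite -[k]addr0; apply: spM => //; exact: sp_iota. Qed.

Definition hlact H a (x : hmod H) : hmod H :=
  hmk (fun j => sp_lact a (hval_sp x j)).

Definition hract H (x : hmod H) a : hmod H :=
  hmk (fun j => sp_ract a (hval_sp x j)).

Lemma hlactE H a (x : hmod H) j : hlact a x j = iota a * x j.
Proof. exact: hmkE. Qed.

Lemma hractE H a (x : hmod H) j : hract x a j = x j * iota a.
Proof. exact: hmkE. Qed.

Definition hbim (H : ghilb) : bimod A.
Proof.
refine (@Bimod R A (hmod H) (@hlact H) (@hract H) _ _ _ _ _ _ _ _ _).
- move=> a c x y; apply: hmod_eq => j.
  by rewrite hvalZD !hlactE hvalZD mulrDr scalerAr.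
- move=> x c a b; apply: hmod_eq => j.
  by rewrite hvalZD !hlactE (shomZD iota_hom) mulrDl scalerAl.
- by move=> x; apply: hmod_eq => j; rewrite hlactE (shom1 iota_hom) mul1r.
- by move=> a b x; apply: hmod_eq => j; rewrite !hlactE (shomM iota_hom) mulrA.
- move=> x c a b; apply: hmod_eq => j.
  by rewrite hvalZD !hractE (shomZD iota_hom) mulrDr scalerAr.
- move=> a c x y; apply: hmod_eq => j.
  by rewrite hvalZD !hractE hvalZD mulrDl scalerAl.
- by move=> x; apply: hmod_eq => j; rewrite hractE (shom1 iota_hom) mulr1.
- by move=> a b x; apply: hmod_eq => j; rewrite !hractE (shomM iota_hom) mulrA.
- by move=> a x b; apply: hmod_eq => j; rewrite !(hractE, hlactE) mulrA.
Defined.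

(** The sum has degree 0, so E acts here as the inverse of [iota]. *)
Definition hrip H (x y : hmod H) : A := E (\sum_j star (x j) * y j).
Definition hlip H (x y : hmod H) : A := E (\sum_j x j * star (y j)).

Lemma sp_starM k x y : sp k x -> sp k y -> sp 0 (star x * y).
Proof. by move=> hx hy; rewrite -[0](addNr k); apply: spM => //; exact: sp_star. Qed.

Lemma sp_Mstar k x y : sp k x -> sp k y -> sp 0 (x * star y).
Proof. by move=> hx hy; rewrite -[0](addrN k); apply: spM => //; exact: sp_star. Qed.

Lemma iota_rip H (x y : hmod H) : iota (hrip x y) = \sum_j star (x j) * y j.
Proof.
apply: E_sp0; apply: sp_sum => j _.
by apply: sp_starM; exact: hval_sp.
Qed.

Lemma iota_lip H (x y : hmod H) : iota (hlip x y) = \sum_j x j * star (y j).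
Proof.
apply: E_sp0; apply: sp_sum => j _.
by apply: sp_Mstar; exact: hval_sp.
Qed.

Lemma sumsq_ge (I : finType) (f : I -> O) j :
  cnorm (f j) ^+ 2 <= cnorm (\sum_i star (f i) * f i).
Proof.
rewrite -cstar_identity; apply: pos_le_norm; first exact: pos_star_mul.
rewrite (bigD1 j) //= addrC addrK.
by apply: pos_sum => i _; exact: pos_star_mul.
Qed.

Lemma sumsq_le (I : finType) (f : I -> O) :
  cnorm (\sum_i star (f i) * f i) <= (\sum_i cnorm (f i)) ^+ 2.
Proof.
apply: le_trans (cnorm_sum _ _ _) _.
rewrite (eq_bigr (fun i => cnorm (f i) * cnorm (f i))) => [|i _]; last first.
  by rewrite cstar_identity expr2.
rewrite expr2 mulr_suml; apply: ler_sum => i _.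
rewrite ler_wpM2l ?cnorm_ge0 // (bigD1 i) //= lerDl.
by apply: sumr_ge0 => i' _; exact: cnorm_ge0.
Qed.

(** Both inner products give norms squeezed between the maximum and the sum of the coordinate norms;
    this alone yields completeness and equivalence. *)
Definition coord_norm H (N : hmod H -> R) :=
  [/\ forall x : hmod H, 0 <= N x, forall (x : hmod H) j, cnorm (x j) <= N x
    & forall x : hmod H, N x <= \sum_j cnorm (x j)].

Lemma sum_cnorm_ge0 H (x : hmod H) : 0 <= \sum_j cnorm (x j).
Proof. by apply: sumr_ge0 => j _; exact: cnorm_ge0. Qed.

Lemma coord_norm_rip H : @coord_norm H (hnorm (@hrip H)).
Proof.
split=> [x|x j|x]; first exact: sqrtr_ge0.
all: rewrite /hnorm -iota_norm iota_rip.
  rewrite -[leLHS]ger0_norm ?cnorm_ge0 // -sqrtr_sqr ler_wsqrtr //.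
  exact: sumsq_ge.
rewrite -[leRHS]ger0_norm ?sum_cnorm_ge0 // -sqrtr_sqr ler_wsqrtr //.
exact: sumsq_le.
Qed.

Lemma coord_norm_lip H : @coord_norm H (hnorm (@hlip H)).
Proof.
have e (x : hmod H) : \sum_j x j * star (x j) = \sum_j star (star (x j)) * star (x j).
  by apply: eq_bigr => j _; rewrite starK.
split=> [x|x j|x]; first exact: sqrtr_ge0.
all: rewrite /hnorm -iota_norm iota_lip e.
  rewrite -[leLHS]ger0_norm ?cnorm_ge0 // -sqrtr_sqr ler_wsqrtr // -cnorm_star.
  exact: (sumsq_ge (fun j => star (x j))).
rewrite -[leRHS]ger0_norm ?sum_cnorm_ge0 // -sqrtr_sqr ler_wsqrtr //.
apply: le_trans (sumsq_le (fun j => star (x j))) _.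
by under eq_bigr do rewrite cnorm_star.
Qed.

Lemma coord_norm_complete H (N : hmod H -> R) : coord_norm N -> ncomplete N.
Proof.
move=> [N0 N1 N2] u hu.
have /choice [l hl] : forall j : H, exists l : O, ncvg (@cnorm R O) (fun m => u m j) l.
  move=> j; apply: cnorm_complete => e e0; have [K hK] := hu e e0.
  exists K => p q Kp Kq; apply: le_lt_trans (hK p q Kp Kq).
  by rewrite -hvalB.
have hlsp j : sp (gdeg j) (l j).
  by apply: sp_closed (hl j) => m; exact: hval_sp.
exists (hmk hlsp); apply/cvgrPdist_lt => e e0.
(* The successor keeps the divisor positive for an empty basis and the final inequality strict. *)
have c0 : 0 < #|H|.+1%:R :> R by rewrite ltr0n.
have /choice [K hK] : forall j : H, exists K : nat, forall m, (K <= m)%N ->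
    cnorm (u m j - l j) < e / #|H|.+1%:R.
  by move=> j; have /ncvgP := hl j; apply; rewrite divr_gt0.
exists (\max_j K j) => // m /= Km; rewrite sub0r normrN.
have b : \sum_j cnorm ((u m - hmk hlsp) j) < e.
  apply: le_lt_trans (_ : \sum_(j : H) e / #|H|.+1%:R < e).
    apply: ler_sum => j _; rewrite hvalB hmkE ltW // hK //.
    by apply: leq_trans Km; apply: leq_bigmax.
  rewrite sumr_const -[_ *+ _]mulr_natr mulrAC ltr_pdivrMr //.
  by rewrite ltr_pM2l // ltr_nat.
by rewrite ger0_norm // (le_lt_trans (N2 _) b).
Qed.

Lemma hrip_inner H : @right_inner R A (hbim H) (@hrip H).
Proof.
split; first split.
- move=> x c y w; rewrite /hrip -E_lin scaler_sumr -big_split; congr (E _).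
  by apply: eq_bigr => j _; rewrite hvalZD mulrDr scalerAr.
- move=> x y a; rewrite /hrip -EM_iota mulr_suml; congr (E _).
  by apply: eq_bigr => j _; rewrite hractE mulrA.
- move=> x y; apply: iota_inj; rewrite (shom_star iota_hom) !iota_rip star_sum.
  by apply: eq_bigr => j _; rewrite starM starK.
- split=> [x|x /= x0|].
  + by apply/cposP/E_pos/pos_sum => j _; exact: pos_star_mul.
  + apply: hmod_eq => j; rewrite hval0; apply: cnorm0_eq0; apply/le_anti.
    rewrite cnorm_ge0 andbT; have [_ h _] := coord_norm_rip H.
    by apply: le_trans (h x j) _; rewrite /hnorm x0 cnorm0 sqrtr0.
  + exact: coord_norm_complete (coord_norm_rip H).
- move=> a x y; rewrite /hrip; congr (E _); apply: eq_bigr => j _.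
  by rewrite !hlactE starM (shom_star iota_hom) mulrA.
Qed.

Lemma hlip_inner H : @left_inner R A (hbim H) (@hlip H).
Proof.
split; first split.
- move=> y c x w; rewrite /hlip -E_lin scaler_sumr -big_split; congr (E _).
  by apply: eq_bigr => j _; rewrite hvalZD mulrDl scalerAl.
- move=> a x y; rewrite /hlip -E_iotaM mulr_sumr; congr (E _).
  by apply: eq_bigr => j _; rewrite hlactE mulrA.
- move=> x y; apply: iota_inj; rewrite (shom_star iota_hom) !iota_lip star_sum.
  by apply: eq_bigr => j _; rewrite starM starK.
- split=> [x|x /= x0|].
  + apply/cposP/E_pos/pos_sum => j _; rewrite -{1}(starK (x j)).
    exact: pos_star_mul.
  + apply: hmod_eq => j; rewrite hval0; apply: cnorm0_eq0; apply/le_anti.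
    rewrite cnorm_ge0 andbT; have [_ h _] := coord_norm_lip H.
    by apply: le_trans (h x j) _; rewrite /hnorm x0 cnorm0 sqrtr0.
  + exact: coord_norm_complete (coord_norm_lip H).
- move=> a x y; rewrite /hlip; congr (E _); apply: eq_bigr => j _.
  by rewrite !hractE starM (shom_star iota_hom) starK mulrA.
Qed.

Definition hcorr H : corr A := Corr (hrip_inner H).

(** [insubd] makes this total: if the family lies outside the bimodule the value is 0, so lists of
    basis vectors need not carry proofs about degrees. *)
Definition hdelta H (i : H) (x : O) : hmod H :=
  insubd (0 : hmod H) [ffun j => if j == i then x else 0].

Lemma hdeltaE H (i j : H) (x : O) : sp (gdeg i) x ->
  hdelta i x j = if j == i then x else 0.
Proof.
move=> hx; have hd : [ffun j => if j == i then x else 0] \in @hsp H.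
  by apply/hspP => p; rewrite ffunE; case: eqP => [-> | _] //; exact: sp0.
by have /ffunP/(_ j) := insubdK (0 : hmod H) hd; rewrite ffunE.
Qed.

Definition pp k : seq O := projT1 (cid (pp_basis k)).

Lemma pp_sp k x : x \in pp k -> sp k x.
Proof. by rewrite /pp; case: cid => u /= [h _]; exact: h. Qed.

Lemma pp_sum k : \sum_(x <- pp k) x * star x = 1.
Proof. by rewrite /pp; case: cid => u /= []. Qed.

Lemma hrip_delta H (i : H) (x : O) (y : hmod H) : sp (gdeg i) x ->
  iota (hrip (hdelta i x) y) = star x * y i.
Proof.
move=> hx; rewrite iota_rip (bigD1 i) //= big1 => [|j /negPf ji].
  by rewrite hdeltaE // eqxx addr0.
by rewrite hdeltaE // ji star0 mul0r.
Qed.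

Lemma hlip_delta H (i : H) (x : O) (y : hmod H) : sp (gdeg i) x ->
  iota (hlip y (hdelta i x)) = y i * star x.
Proof.
move=> hx; rewrite iota_lip (bigD1 i) //= big1 => [|j /negPf ji].
  by rewrite hdeltaE // eqxx addr0.
by rewrite hdeltaE // ji star0 mulr0.
Qed.

Lemma sum_delta H (F : H -> O) j : \sum_(i : H) (if j == i then F i else 0) = F j.
Proof. by rewrite -big_mkcond (big_pred1 j) // => i; rewrite eq_sym. Qed.

Lemma rbasis H : exists r : seq (hmod H), forall x : hmod H,
  x = \sum_(u <- r) hract u (hrip u x).
Proof.
exists [seq hdelta i u | i <- enum H, u <- pp (gdeg i)] => x.
apply: hmod_eq => j; rewrite hval_sum big_allpairs_dep big_enum /=.
rewrite -[LHS](sum_delta (fun i => x i)); apply: eq_bigr => i _.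
rewrite (eq_big_seq (fun u => if j == i then u * star u * x i else 0)) => [|u].
  by case: eqP => _; [rewrite -mulr_suml pp_sum mul1r | rewrite big1].
move=> /pp_sp hu; rewrite hractE hdeltaE // hrip_delta //.
by case: eqP => _; rewrite ?mul0r // mulrA.
Qed.

(** The adjoints of a right basis in degree -k form a left basis in degree k. *)
Lemma lbasis H : exists r : seq (hmod H), forall x : hmod H,
  x = \sum_(u <- r) hlact (hlip x u) u.
Proof.
exists [seq hdelta i (star u) | i <- enum H, u <- pp (- gdeg i)] => x.
apply: hmod_eq => j; rewrite hval_sum big_allpairs_dep big_enum /=.
rewrite -[LHS](sum_delta (fun i => x i)); apply: eq_bigr => i _.
rewrite (eq_big_seq (fun u => if j == i then x i * (u * star u) else 0)) => [|u].
  by case: eqP => _; [rewrite -mulr_sumr pp_sum mulr1 | rewrite big1].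
move=> /pp_sp /sp_star; rewrite opprK => hu.
rewrite hlactE hdeltaE // hlip_delta // starK.
by case: eqP => _; rewrite ?mulr0 // mulrA.
Qed.

Lemma coord_norm_equiv H (N N' : hmod H -> R) : coord_norm N -> coord_norm N' ->
  forall x : hmod H, N x <= #|H|.+1%:R * N' x.
Proof.
move=> [_ _ h] [p q _] x; apply: le_trans (h x) _.
apply: le_trans (ler_sum _ (fun j _ => q x j)) _.
rewrite sumr_const -[_ *+ _]mulr_natl ler_wpM2r // ler_nat.
exact: leqnSn.
Qed.

Lemma hcorr_fgp H : fgp (hcorr H).
Proof.
exists (@hlip H); have c0 : 0 < #|H|.+1%:R :> R by rewrite ltr0n.
have hr := coord_norm_rip H; have hl := coord_norm_lip H.
split; first exact: hlip_inner.
- exists (#|H|.+1%:R)^-1, #|H|.+1%:R; split; rewrite ?invr_gt0 // => x.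
  apply/andP; split; last exact: coord_norm_equiv.
  by rewrite ler_pdivrMl //; exact: coord_norm_equiv.
- have [r hrb] := rbasis H; exists (size r), (tnth (in_tuple r)) => x.
  by rewrite {1}(hrb x) [LHS]big_tnth.
- have [r hrb] := lbasis H; exists (size r), (tnth (in_tuple r)) => x.
  by rewrite {1}(hrb x) [LHS]big_tnth.
Qed.

(** Distinct basis vectors have distinct degrees, so mixed products have nonzero degree and E kills
    them: summing the coordinates embeds the bimodule in [O] isometrically. *)
Lemma hrip_sum H (x y : hmod H) : injective (@gdeg H) ->
  E (star (\sum_j x j) * \sum_j y j) = hrip x y.
Proof.
move=> inj; rewrite /hrip star_sum mulr_suml !E_sum; apply: eq_bigr => j _.
rewrite mulr_sumr E_sum (bigD1 j) //= big1 ?addr0 // => p pj.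
apply: (@E_sp (- gdeg j + gdeg p)).
  by rewrite addrC subr_eq0; apply: contraNneq pj => /inj ->.
by apply: spM; [apply: sp_star|]; exact: hval_sp.
Qed.

Lemma fgp_subbimodule_sum H : injective (@gdeg H) ->
  is_fgp_subbimodule iota E (range (fun x : hmod H => \sum_j x j)).
Proof.
move=> inj; exists (hcorr H), (fun x : hmod H => \sum_j x j); split.
- exact: hcorr_fgp.
- have lin : linear (fun x : hmod H => \sum_j x j).
    move=> c x y; rewrite scaler_sumr -big_split; apply: eq_bigr => j _.
    exact: hvalZD.
  split=> // x y xy; apply/eqP; rewrite -subr_eq0; apply/eqP.
  have [_ [_ h _] _] := hrip_inner H; apply: h; rewrite -hrip_sum //.
  have -> : \sum_j (x - y) j = 0.
    under eq_bigr do rewrite hvalB.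
    by rewrite sumrB; move: xy => /= ->; rewrite subrr.
  by rewrite mulr0 E0.
- by move=> a x; rewrite mulr_sumr; apply: eq_bigr => j _; exact: hlactE.
- by move=> x a; rewrite mulr_suml; apply: eq_bigr => j _; exact: hractE.
- by move=> x y; rewrite hrip_sum.
Qed.

Lemma discrete_iota : cstar_discrete iota E.
Proof.
move=> x e e0; have [K [f [hf _ xf]]] := fourier_dense x e0.
exists (\sum_(k <- sym K) f k); split=> //.
(* One basis vector in each degree from -K to K, so that a whole Fourier sum lies in a single
   sub-bimodule. *)
pose H := @GHilb 'I_(K.*2.+1) (fun p => p%:Z - K%:Z).
exists (range (fun x : hmod H => \sum_j x j)); split.
  by apply: fgp_subbimodule_sum => p q /= /addIr [] /val_inj.
exists (hmk (fun p : H => hf (gdeg p))) => //; rewrite sum_sym.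
by apply: eq_bigr => p _; rewrite hmkE.
Qed.

(** * The tensor functor *)

Definition hmap H K (f : ghom R H K) (x : hmod H) : hmod K.
Proof.
refine (@hmk K (fun j => \sum_i f j i *: x i) _).
move=> j; apply: sp_sum => i _.
have [ji|ji] := eqVneq (gdeg j) (gdeg i).
  by rewrite ji; apply: spZ; exact: hval_sp.
by rewrite ghom_deg // scale0r; exact: sp0.
Defined.

Lemma hmapE H K (f : ghom R H K) (x : hmod H) j :
  hmap f x j = \sum_i f j i *: x i.
Proof. exact: hmkE. Qed.

Lemma hmap_bimod H K (f : ghom R H K) : @is_bimod_map R A (hbim H) (hbim K) (hmap f).
Proof.
split=> [c x y|a x|x a]; apply: hmod_eq => j.
- rewrite hvalZD !hmapE scaler_sumr -big_split; apply: eq_bigr => i _.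
  by rewrite hvalZD scalerDr !scalerA mulrC.
- rewrite hlactE !hmapE mulr_sumr; apply: eq_bigr => i _.
  by rewrite hlactE scalerAr.
- rewrite hractE !hmapE mulr_suml; apply: eq_bigr => i _.
  by rewrite hractE scalerAl.
Qed.

Lemma hmap_adj H K (f : ghom R H K) (x : hmod H) (y : hmod K) :
  hrip (hmap f x) y = hrip x (hmap (gadj f) y).
Proof.
rewrite /hrip; congr (E _).
transitivity (\sum_j \sum_i (f j i)^*%R *: (star (x i) * y j)).
  apply: eq_bigr => j _; rewrite hmapE star_sum mulr_suml.
  by apply: eq_bigr => i _; rewrite starZ scalerAl.
rewrite exchange_big; apply: eq_bigr => i _; rewrite hmapE mulr_sumr.
by apply: eq_bigr => j _; rewrite scalerAr.
Qed.

Lemma sum_delta_scale (I : finType) (F : I -> O) j :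
  \sum_i ((j == i)%:R : R[i]) *: F i = F j.
Proof.
rewrite (bigD1 j) //= eqxx scale1r big1 ?addr0 // => i ij.
by rewrite eq_sym (negPf ij) scale0r.
Qed.

Lemma hmap_id H (x : hmod H) : hmap (gid R H) x = x.
Proof. by apply: hmod_eq => j; rewrite hmapE sum_delta_scale. Qed.

Lemma hmap_comp H K L (g : ghom R K L) (f : ghom R H K) (x : hmod H) :
  hmap (gcomp g f) x = hmap g (hmap f x).
Proof.
apply: hmod_eq => j; rewrite !hmapE.
under eq_bigr => i _ do rewrite /= scaler_suml.
rewrite exchange_big; apply: eq_bigr => p _; rewrite hmapE scaler_sumr.
by apply: eq_bigr => i _; rewrite scalerA.
Qed.

Lemma hmap_lin H K c (f g : ghom R H K) (x : hmod H) :
  hmap (glin c f g) x = c *: hmap f x + hmap g x.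
Proof.
apply: hmod_eq => j; rewrite hvalZD !hmapE scaler_sumr -big_split.
by apply: eq_bigr => i _; rewrite scalerDl scalerA.
Qed.

Definition hunit (a : trivial_corr A) : hmod (gline 0) :=
  hmk (fun _ : gline 0 => sp_iota a).

Lemma hunitE a j : hunit a j = iota a. Proof. exact: hmkE. Qed.

Lemma sum_unit (F : gline 0 -> O) : \sum_j F j = F tt.
Proof. by rewrite (big_pred1 tt) // => -[]. Qed.

Lemma hunit_unitary : @Defs.is_unitary R A (trivial_corr A) (hcorr (gline 0)) hunit.
Proof.
split.
- split=> [c a b|a b|b a]; apply: hmod_eq => j.
  + by rewrite hvalZD !hunitE (shomZD iota_hom).
  + by rewrite hlactE !hunitE (shomM iota_hom).
  + by rewrite hractE !hunitE (shomM iota_hom).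
- move=> a b; apply: iota_inj; rewrite iota_rip sum_unit !hunitE.
  by rewrite (shomM iota_hom) (shom_star iota_hom).
- move=> y; have [a ha] := sp0_iota (hval_sp y tt).
  by exists a; apply: hmod_eq => -[]; rewrite hunitE.
Qed.

Definition htens H K (x : hmod H) (y : hmod K) : hmod (gtensor H K) :=
  hmk (fun p : gtensor H K => spM (hval_sp x p.1) (hval_sp y p.2)).

Lemma htensE H K (x : hmod H) (y : hmod K) p : htens x y p = x p.1 * y p.2.
Proof. exact: hmkE. Qed.

Lemma sum_gtensor H K (G : gtensor H K -> O) (F : H -> K -> O) :
  (forall i j, G (i, j) = F i j) -> \sum_p G p = \sum_i \sum_j F i j.
Proof.
move=> h; rewrite pair_bigA; apply: eq_bigr => -[i j] _; exact: h.
Qed.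

(** With u running over a basis of the first degree, each coordinate is the finite sum of the
    products u (star u w_p). This is O_k O_l = O_(k+l) without closure. *)
Lemma htens_span H K (w : hmod (gtensor H K)) : exists (m : nat)
  (x : 'I_m -> hmod H) (y : 'I_m -> hmod K), w = \sum_(i < m) htens (x i) (y i).
Proof.
pose h (t : hmod H * hmod K) := htens t.1 t.2.
suff [r ->] : exists r : seq (hmod H * hmod K), w = \sum_(t <- r) h t.
  exists (size r), (fun i => (tnth (in_tuple r) i).1).
  by exists (fun i => (tnth (in_tuple r) i).2); rewrite big_tnth.
pose t (p : gtensor H K) (u : O) : hmod H * hmod K :=
  (hdelta p.1 u, hdelta p.2 (star u * w p)).
exists [seq t p u | p <- enum (gtensor H K), u <- pp (gdeg (p.1 : H))].
apply: hmod_eq => q; rewrite hval_sum big_allpairs_dep big_enum /=.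
rewrite -[LHS](sum_delta (fun p => w p)); apply: eq_bigr => p _.
rewrite (eq_big_seq (fun u => if q == p then u * star u * w p else 0)) => [|u].
  by case: eqP => _; [rewrite -mulr_suml pp_sum mul1r | rewrite big1].
move=> /pp_sp hu; rewrite htensE !hdeltaE //; last first.
  have := spM (sp_star hu) (hval_sp w p).
  by rewrite /= addrA addNr add0r.
case: q p hu => q1 q2 [p1 p2] /= hu; rewrite -pair_eqE /pair_eq /=.
by case: eqP => _; rewrite ?mul0r //; case: eqP => _; rewrite ?mulr0 // mulrA.
Qed.

(** The tensor product is carried by the bimodule of [gtensor H K] itself, so that F^2 can be the
    identity and coherence reduces to associativity and unitality in [O]. *)
Definition hbox H K : itensor (hcorr H) (hcorr K).
Proof.
refine (@ITensor R A (hcorr H) (hcorr K) (hcorr (gtensor H K)) (@htens H K)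
  _ _ _ _ _ _ _).
- move=> x c y y'; apply: hmod_eq => p.
  by rewrite hvalZD !htensE hvalZD mulrDr scalerAr.
- move=> y c x x'; apply: hmod_eq => p.
  by rewrite hvalZD !htensE hvalZD mulrDl scalerAl.
- by move=> x a y; apply: hmod_eq => p; rewrite !htensE hractE hlactE mulrA.
- by move=> a x y; apply: hmod_eq => p; rewrite !hlactE !htensE hlactE mulrA.
- by move=> x y a; apply: hmod_eq => p; rewrite !hractE !htensE hractE mulrA.
- move=> x y x' y'; apply: iota_inj; rewrite !iota_rip.
  rewrite (sum_gtensor (F := fun i j => star (y j) * (star (x i) * x' i * y' j))).
    rewrite exchange_big; apply: eq_bigr => j _ /=.
    by rewrite hlactE iota_rip mulr_suml mulr_sumr; apply: eq_bigr => i _.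
  by move=> i j; rewrite !htensE /= starM !mulrA.
- move=> w e e0; exists w; split; last first.
    rewrite subrr; apply: le_lt_trans e0.
    have [_ _ h] := coord_norm_rip (gtensor H K); apply: le_trans (h 0) _.
    by rewrite big1 // => j _; rewrite hval0 cnorm0.
  exact: htens_span.
Defined.

Lemma unitary_id (X : corr A) : @Defs.is_unitary R A X X id.
Proof. by split=> // y; exists y. Qed.

Lemma hmu_nat H K H' K' (f : ghom R H H') (g : ghom R K K')
    (x : hmod H) (y : hmod K) :
  htens (hmap f x) (hmap g y) = hmap (gtensor_hom f g) (htens x y).
Proof.
apply: hmod_eq => q; rewrite htensE !hmapE mulr_suml.
apply/esym; rewrite (sum_gtensor (F := fun i j =>
  (f q.1 i *: x i) * (g q.2 j *: y j))) => [|i j].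
  by apply: eq_bigr => i _; rewrite mulr_sumr.
by rewrite htensE /= -scalerAl -scalerAr scalerA.
Qed.

Lemma gassocE H K L j p :
  gassoc R H K L j p = (j == (p.1.1, (p.1.2, p.2)))%:R.
Proof. by []. Qed.

Lemma glunitE H j p : glunit R H j p = (j == p.2)%:R.
Proof. by []. Qed.

Lemma grunitE H j p : grunit R H j p = (j == p.1)%:R.
Proof. by []. Qed.

Lemma hmu_assoc H K L (x : hmod H) (y : hmod K) (w : hmod L) :
  hmap (gassoc R H K L) (htens (htens x y) w) = htens x (htens y w).
Proof.
apply: hmod_eq => -[q1 [q2 q3]]; rewrite hmapE (bigD1 ((q1, q2), q3)) //.
rewrite gassocE eqxx scale1r big1 => [|[[p1 p2] p3] pq].
  by rewrite [LHS]addr0 !htensE mulrA.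
rewrite gassocE; case: eqP => [[e1 e2 e3]|]; last by rewrite scale0r.
by case/andP: pq => _ /eqP[]; rewrite e1 e2 e3.
Qed.

Lemma hmu_lunit H a (x : hmod H) :
  hmap (glunit R H) (htens (hunit a) x) = hlact a x.
Proof.
apply: hmod_eq => j; rewrite hmapE hlactE (bigD1 (tt, j)) // glunitE eqxx scale1r.
rewrite big1 => [|[[] p] pj]; first by rewrite [LHS]addr0 htensE hunitE.
rewrite glunitE; case: eqP => [e|]; last by rewrite scale0r.
by case/andP: pj => _ /eqP[]; rewrite e.
Qed.

Lemma hmu_runit H (x : hmod H) a :
  hmap (grunit R H) (htens x (hunit a)) = hract x a.
Proof.
apply: hmod_eq => j; rewrite hmapE hractE (bigD1 (j, tt)) // grunitE eqxx scale1r.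
rewrite big1 => [|[p []] pj]; first by rewrite [LHS]addr0 htensE hunitE.
rewrite grunitE; case: eqP => [e|]; last by rewrite scale0r.
by case/andP: pj => _ /eqP[]; rewrite e.
Qed.

Definition zact : zaction A :=
  @ZAction R A hcorr hcorr_fgp hmap hmap_bimod hmap_id hmap_comp hmap_lin
    hmap_adj hunit hunit_unitary hbox (fun H K => id)
    (fun H K => unitary_id (hcorr (gtensor H K)))
    hmu_nat hmu_assoc hmu_lunit hmu_runit.

(** * Outerness *)

Lemma scale_sp_eq0 k (c : R[i]) : (forall x, sp k x -> c *: x = 0) -> c = 0.
Proof.
(* 1 is a sum of products [x * star x] with x of degree k. *)
move=> h; have : c *: (1 : O) = 0.
  rewrite -(pp_sum k) scaler_sumr big1_seq // => x /= /pp_sp hx.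
  by rewrite scalerAl h // mul0r.
move=> /(congr1 (@cnorm R O)); rewrite cnormZ cnorm1 mulr1 cnorm0.
exact: Normc.eq0_normc.
Qed.

Lemma ghom_eq H K (f g : ghom R H K) : (forall j i, f j i = g j i) -> f = g.
Proof.
case: f g => f hf [g hg] /= fg; have e : f = g.
  by apply/funext => j; apply/funext => i.
by case: _ / e hg => hg; congr GHom; exact: Prop_irrelevance.
Qed.

Lemma hdelta_decomp H (x : hmod H) : x = \sum_i hdelta i (x i).
Proof.
apply: hmod_eq => j; rewrite hval_sum -[LHS](sum_delta (fun i => x i)).
by apply: eq_bigr => i _; rewrite hdeltaE //; exact: hval_sp.
Qed.

Lemma hmap_delta H K (f : ghom R H K) i j x : sp (gdeg i) x ->
  hmap f (hdelta i x) j = f j i *: x.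
Proof.
move=> hx; rewrite hmapE (bigD1 i) // big1 => [|p /andP[_ /negPf pi]].
  by rewrite [LHS]addr0 hdeltaE // eqxx.
by rewrite hdeltaE // pi scaler0.
Qed.

Section BimoduleMap.
Variables (H K : ghilb) (T : hmod H -> hmod K).
Hypothesis hT : @is_bimod_map R A (hbim H) (hbim K) T.

Lemma bmapZD (c : R[i]) (x y : hmod H) : T (c *: x + y) = c *: T x + T y.
Proof. by case: hT => h _ _; exact: h. Qed.

Lemma bmapD (x y : hmod H) : T (x + y) = T x + T y.
Proof. by rewrite -[x in LHS]scale1r bmapZD scale1r. Qed.

Lemma bmap0 : T 0 = 0.
Proof. by apply: (addrI (T 0)); rewrite -bmapD !addr0. Qed.

Lemma bmap_sum I (r : seq I) (F : I -> hmod H) :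
  T (\sum_(p <- r) F p) = \sum_(p <- r) T (F p).
Proof. exact: (big_morph _ bmapD bmap0). Qed.

Lemma bmap_l a (x : hmod H) : T (hlact a x) = hlact a (T x).
Proof. by case: hT => _ h _; exact: h. Qed.

Lemma bmap_r (x : hmod H) a : T (hract x a) = hract (T x) a.
Proof. by case: hT => _ _ h; exact: h. Qed.

(* A bimodule map between spectral subspaces is left multiplication by this
   element, which then commutes with the fixed-point algebra. *)
Definition bmap_coef j i : O := \sum_(u <- pp (gdeg i)) T (hdelta i u) j * star u.

(** Expand x in the right basis; its coefficients [star u * x] have degree 0 and leave T by right
    linearity. *)
Lemma bmap_delta i j x : sp (gdeg i) x -> T (hdelta i x) j = bmap_coef j i * x.
Proof.
move=> hx; pose a u := E (star u * x).
have -> : hdelta i x = \sum_(u <- pp (gdeg i)) hract (hdelta i u) (a u).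
  apply: hmod_eq => p; rewrite hval_sum hdeltaE //.
  rewrite (eq_big_seq (fun u => if p == i then u * star u * x else 0)) => [|u].
    by case: eqP => _; [rewrite -mulr_suml pp_sum mul1r | rewrite big1].
  move=> /pp_sp hu; rewrite hractE hdeltaE // E_sp0; last exact: sp_starM hu hx.
  by case: eqP => _; rewrite ?mul0r // mulrA.
rewrite bmap_sum hval_sum mulr_suml; apply: eq_big_seq => u /pp_sp hu.
rewrite bmap_r hractE E_sp0 ?mulrA //; exact: sp_starM hu hx.
Qed.

(** Left linearity gives the commutation after multiplication by any x of the degree of i; the
    relation sum of [u * star u] = 1 removes x. *)
Lemma bmap_coef_comm j i : comm_iota (bmap_coef j i).
Proof.
have e a x : sp (gdeg i) x ->
    iota a * bmap_coef j i * x = bmap_coef j i * iota a * x.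
  move=> hx; rewrite -!mulrA -!bmap_delta //; last exact: sp_lact.
  rewrite -hlactE -bmap_l; congr (T _ j); apply: hmod_eq => p.
  rewrite hlactE !hdeltaE //; last exact: sp_lact.
  by case: eqP => _ //; rewrite mulr0.
move: (bmap_coef j i) e => y e a.
rewrite -[LHS]mulr1 -[RHS]mulr1 -(pp_sum (gdeg i)) !mulr_sumr.
by apply: eq_big_seq => u /pp_sp hu; rewrite !mulrA e.
Qed.

Lemma bmap_ghom : exists f : ghom R H K, forall x : hmod H, hmap f x = T x.
Proof.
have /choice [c hc] : forall p : K * H, exists c : R[i], bmap_coef p.1 p.2 = c%:A.
  by move=> p; apply: irreducible_iota; exact: bmap_coef_comm.
(* c x has the degree of i as a multiple of x and the degree of j as a coordinate of a value of
   T. *)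
have deg j i : gdeg j != gdeg i -> c (j, i) = 0.
  move=> ji; apply: (@scale_sp_eq0 (gdeg i)) => x hx.
  have e : T (hdelta i x) j = c (j, i) *: x.
    by rewrite bmap_delta // (hc (j, i)) mulr_algl.
  rewrite -e; apply: sp_neq ji (hval_sp _ _) _; rewrite e; exact: spZ.
exists (@GHom R H K (fun j i => c (j, i)) deg) => x; apply: hmod_eq => j.
rewrite {2}(hdelta_decomp x) bmap_sum hval_sum hmapE; apply: eq_bigr => i _.
by rewrite bmap_delta ?(hc (j, i)) ?mulr_algl //; exact: hval_sp.
Qed.

End BimoduleMap.

Lemma zact_outer : outer_action zact.
Proof.
move=> H K T hT _; have [f hf] := bmap_ghom hT.
exists f; split=> // g hg; apply: ghom_eq => j i.
apply/eqP; rewrite -subr_eq0; apply/eqP; apply: (@scale_sp_eq0 (gdeg i)) => x hx.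
rewrite scalerBl -!hmap_delta // hf.
have -> : hmap g (hdelta i x) = T (hdelta i x) := hg _.
by rewrite subrr.
Qed.

(** * The crossed product *)

Implicit Types (f g : int -> O) (D : nat).

Definition spectral f := forall k, sp k (f k).
Definition bounded D f := forall k, (D < `|k|)%N -> f k = 0.
(** Only the first factor is cut off: g may have infinite support, as do vectors of the Hilbert
    module. *)
Definition conv D f g m := \sum_(k <- sym D) f k * g (m - k).
Definition sqsum (N : nat) f := \sum_(k <- sym N) star (f k) * f k.

Lemma spectral_conv D f g : spectral f -> spectral g -> spectral (conv D f g).
Proof.
move=> hf hg m; apply: sp_sum => k _.
have := spM (hf k) (hg (m - k)); by rewrite addrC subrK.
Qed.

Lemma bounded_conv D D1 f g : bounded D1 g -> bounded (D + D1) (conv D f g).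
Proof.
move=> hg m hm; rewrite /conv big1_seq // => k /=; rewrite mem_sym => kK.
by rewrite hg ?mulr0 //; lia.
Qed.

Lemma sum_sym_shift D D1 g k : bounded D1 g -> (`|k| <= D)%N ->
  \sum_(m <- sym (D + D1)) g (m - k) = \sum_(m <- sym D1) g m.
Proof.
move=> hg kK; rewrite -(fsum_sym (leqnn D1) hg).
rewrite -(big_map (fun m : int => m - k) xpredT g) (fsbigE [seq m - k | m <- sym (D + D1)]).
- by apply: eq_bigl => m; rewrite in_setT.
- by rewrite map_inj_uniq ?sym_uniq // => p q /addIr.
- by [].
move=> m _ hm; apply: hg; rewrite ltnNge; apply: contra hm => hm.
by apply/mapP; exists (m + k); rewrite ?addrK // mem_sym; lia.
Qed.

Lemma conv_sum D D1 f g : bounded D1 g ->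
  \sum_(m <- sym (D + D1)) conv D f g m =
  (\sum_(k <- sym D) f k) * \sum_(k <- sym D1) g k.
Proof.
move=> hg; rewrite exchange_big mulr_suml; apply: eq_big_seq => k.
by rewrite mem_sym => kK; rewrite -mulr_sumr sum_sym_shift.
Qed.

(** Parseval's identity: mixed terms have nonzero degree. *)
Lemma sqsum_E N f : spectral f ->
  iota (E (star (\sum_(k <- sym N) f k) * \sum_(k <- sym N) f k)) = sqsum N f.
Proof.
move=> hf; rewrite star_sum mulr_suml E_sum (shom_sum iota_hom).
apply: eq_big_seq => k kN; rewrite mulr_sumr E_sum (bigD1_seq k) ?sym_uniq //=.
rewrite big1 ?addr0 => [|l lk]; first by rewrite E_sp0 //; exact: sp_starM.
apply: (@E_sp (- k + l)); first by rewrite addrC subr_eq0.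
by apply: spM => //; exact: sp_star.
Qed.

Lemma sum_sym_split (F : int -> O) N M : (N <= M)%N ->
  \sum_(k <- sym M) F k =
  \sum_(k <- sym N) F k + \sum_(k <- sym M | (N < `|k|)%N) F k.
Proof.
move=> NM; rewrite (bigID (fun k : int => (`|k| <= N)%N)) /=; congr (_ + _).
  rewrite big_mkcond (sum_sym_widen (K := N)) // => [|k kN].
    by apply: eq_big_seq => k; rewrite mem_sym => ->.
  by rewrite leqNgt kN.
by apply: eq_bigl => k; rewrite ltnNge.
Qed.

(* Truncating g to W does not change the convolution on Q, so the estimate is
   Bessel's inequality for X Y followed by X^* X <= |X|^2. *)
Lemma window_bound D D1 f g (W Q : pred int) : spectral f -> spectral g ->
  (forall m k, Q m -> (`|k| <= D)%N -> W (m - k) && (`|m - k| <= D1)%N) ->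
  cnorm (\sum_(m <- sym (D + D1) | Q m) star (conv D f g m) * conv D f g m) <=
  cnorm (\sum_(k <- sym D) f k) ^+ 2 *
    cnorm (\sum_(k <- sym D1 | W k) star (g k) * g k).
Proof.
move=> hf hg hWQ; set X := \sum_(_ <- _) f _.
pose g' k := if W k && (`|k| <= D1)%N then g k else 0.
have hg' : spectral g' by move=> k; rewrite /g'; case: ifP => // _; exact: sp0.
have bg' : bounded D1 g' by move=> k kL; rewrite /g' [(_ <= D1)%N]leqNgt kL andbF.
pose Y := \sum_(k <- sym D1) g' k.
have -> : \sum_(k <- sym D1 | W k) star (g k) * g k = iota (E (star Y * Y)).
  rewrite sqsum_E // /sqsum big_mkcond; apply: eq_big_seq => k.
  rewrite mem_sym /g' => ->; rewrite andbT.
  by case: ifP => // _; rewrite mulr0.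
have -> : \sum_(m <- sym (D + D1) | Q m) star (conv D f g m) * conv D f g m =
    \sum_(m <- sym (D + D1) | Q m) star (conv D f g' m) * conv D f g' m.
  apply: eq_bigr => m Qm; suff -> : conv D f g m = conv D f g' m by [].
  apply: eq_big_seq => k; rewrite mem_sym /g' => kK.
  by rewrite hWQ.
have sumXY := conv_sum D f bg'; rewrite -/X -/Y in sumXY.
have sqXY := sqsum_E (D + D1) (spectral_conv D hf hg').
rewrite sumXY in sqXY.
apply: le_trans (_ : _ <= cnorm (iota (E (star (X * Y) * (X * Y))))) _.
  rewrite sqXY /sqsum; apply: pos_le_norm.
    by apply: pos_sum => m _; exact: pos_star_mul.
  rewrite [X in pos (X - _)](bigID Q) /= [X in pos (X - _)]addrC addrK.
  by apply: pos_sum => m _; exact: pos_star_mul.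
rewrite -(ger0_norm (sqr_ge0 (cnorm X))) -cnormZr.
apply: pos_le_norm; first exact/(shom_pos iota_hom)/E_pos/pos_star_mul.
rewrite -(shomZ iota_hom) -EZ -(shomB iota_hom) -EB.
apply/(shom_pos iota_hom)/E_pos.
have -> : (cnorm X ^+ 2)%:C *: (star Y * Y) - star (X * Y) * (X * Y) =
    star Y * ((cnorm X ^+ 2)%:C%:A - star X * X) * Y.
  by rewrite mulrBr mulrBl -scalerAr mulr1 -scalerAl starM !mulrA.
exact/pos_conj/pos_norm_sub.
Qed.

(** Up to degree N the product sees g only up to degree N + D. *)
Lemma conv_sqsum_bound D f g N : spectral f -> spectral g ->
  cnorm (sqsum N (conv D f g)) <=
  cnorm (\sum_(k <- sym D) f k) ^+ 2 * cnorm (sqsum (N + D) g).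
Proof.
move=> hf hg.
have := @window_bound D (N + D) f g xpredT (fun m => (`|m| <= N)%N) hf hg.
have NK : (N <= D + (N + D))%N by lia.
have -> : \sum_(m <- sym (D + (N + D)) | (`|m| <= N)%N)
    star (conv D f g m) * conv D f g m = sqsum N (conv D f g).
  rewrite big_mkcond (sum_sym_widen NK) => [|k kN].
    by apply: eq_big_seq => k; rewrite mem_sym => ->.
  by rewrite leqNgt kN.
by apply=> m k mN kK /=; lia.
Qed.

(** Beyond degree N + D the product sees g only beyond degree N. This makes the partial sums of the
    product Cauchy. *)
Lemma conv_sqsum_tail D f g N M : spectral f -> spectral g -> (N + D <= M)%N ->
  cnorm (sqsum M (conv D f g) - sqsum (N + D) (conv D f g)) <=
  cnorm (\sum_(k <- sym D) f k) ^+ 2 * cnorm (sqsum (M + D) g - sqsum N g).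
Proof.
move=> hf hg NM.
have := @window_bound D (M + D) f g (fun k => (N < `|k|)%N)
  (fun m => (N + D < `|m|)%N && (`|m| <= M)%N) hf hg.
have e1 : sqsum (M + D) g - sqsum N g =
    \sum_(k <- sym (M + D) | (N < `|k|)%N) star (g k) * g k.
  have NMD : (N <= M + D)%N by lia.
  by rewrite /sqsum (sum_sym_split _ NMD) [LHS]addrC addKr.
have e2 : sqsum M (conv D f g) - sqsum (N + D) (conv D f g) =
    \sum_(m <- sym (D + (M + D)) | (N + D < `|m|)%N && (`|m| <= M)%N)
      star (conv D f g m) * conv D f g m.
  rewrite /sqsum (sum_sym_split _ NM) [LHS]addrC addKr.
  have MK : (M <= D + (M + D))%N by lia.
  rewrite [RHS]big_mkcond (sum_sym_widen MK) => [|k kM]; last first.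
    by rewrite [(_ <= M)%N]leqNgt kM andbF.
  by rewrite [LHS]big_mkcond; apply: eq_big_seq => k; rewrite mem_sym => ->; rewrite andbT.
by rewrite e1 e2; apply=> m k /andP[mN mM] kK; lia.
Qed.

Lemma mean_bounded J D f : spectral f -> (D < J)%N ->
  mean J (\sum_(k <- sym D) f k) = iota (E (\sum_(k <- sym D) f k)).
Proof.
move=> hf KJ; rewrite E_sum (shom_sum iota_hom).
have meanD x y : mean J (x + y) = mean J x + mean J y.
  by rewrite -[x in LHS]scale1r meanZD scale1r.
have mean0 : mean J 0 = 0.
  by apply: (addrI (mean J 0)); rewrite -meanD !addr0.
rewrite (big_morph _ meanD mean0); apply: eq_big_seq => k.
rewrite mem_sym => kK; have [k0|k0] := eqVneq k 0.
  have h : sp 0 (f k) by have := hf k; rewrite {1}k0.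
  by rewrite mean_sp0 ?E_sp0 // (leq_ltn_trans _ KJ).
rewrite (@mean_sp _ k) ?(@E_sp k) ?(shom0 iota_hom) //.
exact: leq_ltn_trans KJ.
Qed.

(** The root of unity 1 contributes x / J by [gam1]; the other terms are positive. *)
Lemma mean_lower J x : (0 < J)%N -> pos x -> pos (mean J x - (J%:R^-1)%:C *: x).
Proof.
case: J => // J _ px; rewrite /mean big_ord_recl mul0r circ0 gam1.
rewrite scalerDr addrC addKr; apply: posZ; first by rewrite invr_ge0 ler0n.
by apply: pos_sum => p _; apply: (shom_pos (gam_hom (circ_norm _))).
Qed.

(** * Elements of finite degree and growth of their powers *)

Definition fin_deg D x := exists f, [/\ spectral f, bounded D f
  & x = \sum_(k <- sym D) f k].

Lemma fin_deg_mul D D1 x y : fin_deg D x -> fin_deg D1 y -> fin_deg (D + D1) (x * y).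
Proof.
move=> [f [hf bf ->]] [g [hg bg ->]]; exists (conv D f g); split.
- exact: spectral_conv.
- exact: bounded_conv.
- by rewrite conv_sum.
Qed.

Lemma fin_deg_star D x : fin_deg D x -> fin_deg D (star x).
Proof.
move=> [f [hf bf ->]]; exists (fun k => star (f (- k))); split.
- by move=> k; have := sp_star (hf (- k)); rewrite opprK.
- by move=> k kK; rewrite bf ?star0 // abszN.
rewrite star_sum -(big_map (fun k : int => - k) xpredT (fun k => star (f k))).
apply: perm_big; apply: uniq_perm; rewrite ?sym_uniq //.
  by rewrite map_inj_uniq ?sym_uniq //; exact: oppr_inj.
move=> k; rewrite mem_sym; apply/idP/mapP => [kK|[l]].
  by exists (- k); rewrite ?opprK // mem_sym abszN.
by rewrite mem_sym => lK ->; rewrite abszN.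
Qed.

Lemma fin_deg1 : fin_deg 0 1.
Proof.
exists (fun k => if k == 0 then 1 else 0); split.
- by move=> k; case: eqP => [-> | _]; [exact: sp1 | exact: sp0].
- by move=> k; case: eqP => // ->.
by rewrite sum_sym big_ord1.
Qed.

Lemma fin_degX D x m : fin_deg D x -> fin_deg (m * D) (x ^+ m).
Proof.
move=> hx; elim: m => [|m IH]; first exact: fin_deg1.
by rewrite exprS mulSn; exact: fin_deg_mul.
Qed.

Lemma fin_E_lower D x : fin_deg D x -> pos x ->
  cnorm x <= D.+1%:R * cnorm (E x).
Proof.
move=> [f [hf bf xf]] px.
(* D + 1 roots of unity make the average exact in degree at most D, which is where the factor comes
   from. *)
have h := mean_bounded hf (ltnSn D); rewrite -xf in h.
have J0 : 0 < D.+1%:R :> R by rewrite ltr0n.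
rewrite -ler_pdivrMl // -[_^-1]gtr0_norm ?invr_gt0 // -cnormZr.
rewrite -iota_norm -h; apply: pos_le_norm; last exact: mean_lower.
by apply: posZ => //; rewrite invr_ge0 ltW.
Qed.

Lemma bernoulli (d : R) m : 0 <= d -> 1 + m%:R * d <= (1 + d) ^+ m.
Proof.
move=> d0; elim: m => [|m IH]; first by rewrite mul0r addr0.
rewrite exprS -natr1; have := ler0n R m.
have := mulr_ge0 (ler0n R m) (sqr_ge0 d); nra.
Qed.

(** Repeated squaring by the C*-identity; hence the powers of two in the growth argument. *)
Lemma pos_norm_pow2 x p : pos x -> cnorm (x ^+ (2 ^ p)) = cnorm x ^+ (2 ^ p).
Proof.
move=> px; elim: p => [|p IH]; first by rewrite !expr1.
rewrite expnSr !exprM -IH expr2 cnorm_sa_sqr //.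
by rewrite starX pos_sa.
Qed.

(* On a of finite degree E loses at most a polynomial factor in the norm of
   a^m, so the growth rate of the norms of E(a^m) is the norm of a. *)
Lemma fin_norm_le D X (c : R) : fin_deg D X -> 0 <= c ->
  (forall D1 y, fin_deg D1 y ->
    cnorm (E (star (X * y) * (X * y))) <= c * cnorm (E (star y * y))) ->
  cnorm X ^+ 2 <= c.
Proof.
move=> hX c0 hc; rewrite leNgt; apply/negP => cX.
pose a := star X * X.
have [N eN] : exists N, N = cnorm X ^+ 2 by exists (cnorm X ^+ 2).
rewrite -eN in cX.
have N0 : 0 < N := le_lt_trans c0 cX.
have Na : cnorm a = N by rewrite cstar_identity eN.
have pa : pos a := pos_star_mul X.
have sa m : star (a ^+ m) = a ^+ m by rewrite starX pos_sa.
have ha : fin_deg (D + D) a := fin_deg_mul (fin_deg_star hX) hX.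
(* The test vector is y = a^m. Passing from an even to an odd exponent costs c, the remaining steps
   cost N because a <= N, so two steps cost c N. *)
have odd m : cnorm (E (a ^+ (m + m).+1)) <= c * cnorm (E (a ^+ (m + m))).
  have := hc _ _ (fin_degX m ha); rewrite starM sa -exprD.
  by rewrite mulrA -[a ^+ m * star X * X]mulrA -exprSr -exprD addSn.
have even m : cnorm (E (a ^+ m.+1)) <= N * cnorm (E (a ^+ m)).
  rewrite -[X in X * _]gtr0_norm // -cnormZr -EZ; apply: pos_le_norm.
    exact/E_pos/posX.
  rewrite -EB; apply: E_pos.
  have -> : N%:C *: a ^+ m - a ^+ m.+1 = (N%:C%:A - a) * a ^+ m.
    by rewrite mulrBl -scalerAl mul1r exprS.
  apply: pos_mul_comm; first by rewrite -Na; exact: pos_leZ.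
    exact: posX.
  by apply/commrX/commr_sym/commrB; [exact: comm_rs | exact: commr_refl].
have up m : cnorm (E (a ^+ (m + m))) <= (c * N) ^+ m.
  elim: m => [|m IH].
    by rewrite !expr0 -(shom1 iota_hom) E_iota cnorm1.
  rewrite addSn addnS; apply: le_trans (even _) _.
  apply: le_trans (ler_wpM2l (ltW N0) (odd m)) _.
  by rewrite [leRHS]exprS mulrA [N * c]mulrC ler_wpM2l // mulr_ge0 // ltW.
(* Both bounds on E of the power 2^(p+1) of a are combined, and the common factor N^(2^p)
   cancels. *)
have low p : N ^+ (2 ^ p) <= ((2 ^ p.+1) * (D + D)).+1%:R * c ^+ (2 ^ p).
  have := fin_E_lower (fin_degX (2 ^ p.+1) ha) (posX _ pa).
  rewrite pos_norm_pow2 // Na => h.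
  have e : (2 ^ p.+1 = 2 ^ p + 2 ^ p)%N by rewrite expnS mul2n addnn.
  have u := up (2 ^ p)%N; rewrite -e in u.
  have := le_trans h (ler_wpM2l (ler0n _ _) u).
  have -> : N ^+ (2 ^ p.+1) = N ^+ (2 ^ p) * N ^+ (2 ^ p) by rewrite e exprD.
  by rewrite exprMn mulrA ler_pM2r // exprn_gt0.
have cp : 0 < c.
  rewrite lt_def c0 andbT; apply/eqP => c_eq; have := low 0%N.
  by rewrite c_eq !expr1 mulr0 leNgt N0.
pose d := N / c - 1.
have d0 : 0 < d by rewrite subr_gt0 ltr_pdivlMr // mul1r.
have dN : N = c * (1 + d) by rewrite /d; field; rewrite gt_eqF.
(* With q = 2^p, squaring Bernoulli's bound gives (q d)^2 <= (1 + d)^(2q), which [low] at p + 1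
   bounds linearly in q. Dividing by q leaves a bound that fails for large p. *)
have key p : (2 ^ p)%:R * d ^+ 2 <= (4 * (D + D)).+1%:R.
  have := low p.+1; rewrite dN exprMn mulrC ler_pM2r ?exprn_gt0 //.
  have := bernoulli (2 ^ p) (ltW d0); set q := (2 ^ p)%N.
  have e1 : (2 ^ p.+1 = q + q)%N by rewrite expnS mul2n addnn.
  have e2 : (2 ^ p.+2 * (D + D) = q * (4 * (D + D)))%N.
    by rewrite !expnS -/q; lia.
  have q1 : (1 <= q)%N by rewrite expn_gt0.
  rewrite e1 e2 exprD => b u.
  have qd : q%:R * d <= (1 + d) ^+ q by apply: le_trans b; rewrite lerDr.
  have qd0 : 0 <= q%:R * d by rewrite mulr_ge0 // ltW.
  have := le_trans (ler_pM qd0 qd0 qd qd) u.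
  have -> : q%:R * d * (q%:R * d) = q%:R * (q%:R * d ^+ 2) by ring.
  move=> v; rewrite -(@ler_pM2l _ q%:R) ?ltr0n //; apply: le_trans v _.
  by rewrite -natrM ler_nat mulnS; lia.
have [p hp] := ltr_add_invr (divr_gt0 (exprn_gt0 2 d0) (ltr0Sn R (4 * (D + D)))).
have := key p.+1; rewrite leNgt => /negP[].
move: hp; rewrite add0r ltr_pdivlMr ?ltr0n // ltr_pdivrMl ?ltr0n // => hp.
apply: lt_le_trans hp _; rewrite ler_pM2r ?exprn_gt0 // ler_nat.
exact: ltn_trans (ltnSn p) (ltn_expl _ _).
Qed.

(** * The canonical map from the algebraic direct sum to the Cuntz algebra *)

Definition co (x : zfam zact) (k : int) : O := (x k : hmod (gline k)) tt.

Lemma co_spectral (x : zfam zact) : spectral (co x).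
Proof. by move=> k; exact: (hval_sp (x k : hmod (gline k)) tt). Qed.

Lemma gline_eq k (x y : hmod (gline k)) : x tt = y tt -> x = y.
Proof. by move=> h; apply: hmod_eq => -[]. Qed.

Lemma co_eq0 (x : zfam zact) k : (co x k = 0) <-> (x k = 0).
Proof.
split=> [h|h]; last by rewrite /co h; exact: hval0.
by apply: gline_eq; rewrite hval0.
Qed.

Lemma finsupp_bounded (x : zfam zact) : finsupp x -> exists D, bounded D (co x).
Proof.
move=> /finite_seqP [r hr]; exists (\max_(k <- r) `|k|)%N => k hk.
apply/co_eq0/eqP; apply: contraLR hk => xk; rewrite -leqNgt.
have kr : k \in r.
  by have : [set` r] k by rewrite -hr; exact: xk.
exact: leq_bigmax_seq.
Qed.

Definition zf f (hf : spectral f) : zfam zact :=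
  fun k => hmk (fun _ : gline k => hf k).

Lemma co_zf f (hf : spectral f) k : co (zf hf) k = f k.
Proof. exact: hmkE. Qed.

Lemma bounded_finsupp D (x : zfam zact) : bounded D (co x) -> finsupp x.
Proof.
move=> bx; apply: (@sub_finite_set _ _ [set` sym D]) => // k /= xk.
rewrite mem_sym leqNgt; apply: contra xk => /bx /co_eq0 ->.
by rewrite eqxx.
Qed.

Definition cpP (x : zfam zact) : O := \sum_(k \in [set: int]) co x k.

Lemma cpP_sym D (x : zfam zact) : bounded D (co x) ->
  cpP x = \sum_(k <- sym D) co x k.
Proof. exact: fsum_sym. Qed.

Lemma cp_prodE k l m (e : k + l = m) (x : hmod (gline k)) (y : hmod (gline l)) :
  (@cp_prod R A zact k l m e x y : hmod (gline m)) tt = x tt * y tt.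
Proof.
rewrite [LHS]hmapE (sum_gtensor (F := fun i j => x i * y j)) => [|p q].
  by rewrite !sum_unit.
by rewrite [LHS]scale1r htensE.
Qed.

Lemma co_mul D (x y : zfam zact) m : bounded D (co x) ->
  co (cp_mul x y) m = conv D (co x) (co y) m.
Proof.
move=> bx; rewrite /co /cp_mul (fsum_sym (leqnn D)) => [|k kD]; last first.
  by apply: gline_eq; rewrite cp_prodE [x k tt]bx // mul0r hval0.
rewrite [LHS]hval_sum; apply: eq_bigr => k _; exact: cp_prodE.
Qed.

Lemma cpP_lin (c : R[i]) (x y : zfam zact) : finsupp x -> finsupp y ->
  cpP (fun k => c *: x k + y k) = c *: cpP x + cpP y.
Proof.
move=> /finsupp_bounded [D bx] /finsupp_bounded [D' bY].
have coD k : co (fun k => c *: x k + y k) k = c *: co x k + co y k.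
  exact: hvalZD.
have wx : bounded (maxn D D') (co x) by move=> k; rewrite gtn_max => /andP[/bx].
have wy : bounded (maxn D D') (co y) by move=> k; rewrite gtn_max => /andP[_ /bY].
rewrite (cpP_sym wx) (cpP_sym wy) (@cpP_sym (maxn D D')).
  by rewrite scaler_sumr -big_split; apply: eq_bigr => k _; exact: coD.
by move=> k kD; rewrite coD wx // wy // scaler0 addr0.
Qed.

Lemma cpP_mul (x y : zfam zact) : finsupp x -> finsupp y ->
  cpP (cp_mul x y) = cpP x * cpP y.
Proof.
move=> /finsupp_bounded [D bx] /finsupp_bounded [D' bY].
have bxy : bounded (D + D') (co (cp_mul x y)).
  by move=> k kD; rewrite (co_mul _ _ bx) (bounded_conv _ bY).
rewrite (cpP_sym bxy) (cpP_sym bx) (cpP_sym bY) -conv_sum //.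
by apply: eq_bigr => m _; exact: co_mul.
Qed.

Lemma cpP_one : cpP (cp_one zact) = 1.
Proof.
have co1 k : co (cp_one zact) k = if k == 0 then 1 else 0.
  rewrite /co /cp_one /cp_in; case: eqP => [e|ne]; last first.
    by case: eqP => [e|_]; [case: ne | exact: hval0].
  case: _ / e; rewrite eqxx [LHS]hmapE sum_unit [LHS]scale1r [LHS]hunitE.
  exact: (shom1 iota_hom).
rewrite (@cpP_sym 0) => [|k k0]; first by rewrite sum_sym big_ord1 co1.
by rewrite co1; case: eqP k0 => // ->.
Qed.

(** [cp_dagger] selects an element by its defining property, so uniqueness is needed too: two
    solutions agree after multiplication by a right basis in degree -m, hence agree. *)
Lemma co_star (x : zfam zact) m : co (cp_star x) m = star (co x (- m)).
Proof.
have hs : sp m (star (co x (- m))).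
  by have := sp_star (co_spectral x (- m)); rewrite opprK.
pose z : hmod (gline m) := hmk (fun _ : gline m => hs).
rewrite /co /cp_star /cp_dagger (@xget_unique _ _ _ z); first exact: hmkE.
  move=> y; apply: gline_eq; rewrite cp_prodE hmkE [RHS]hunitE iota_rip.
  by rewrite sum_unit.
move=> w hw; apply: gline_eq; rewrite hmkE.
have e v : sp (- m) v -> w tt * v = star (co x (- m)) * v.
  move=> hv; have := hw (hmk (fun _ : gline (- m) => hv)).
  move=> /(congr1 (fun u : hmod (gline 0) => u tt)).
  by rewrite cp_prodE [X in _ = X]hunitE iota_rip sum_unit hmkE.
rewrite -[LHS]mulr1 -[RHS]mulr1 -(pp_sum (- m)) !mulr_sumr.
by apply: eq_big_seq => u /pp_sp hu; rewrite !mulrA e.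
Qed.

Lemma cpP_star (x : zfam zact) : finsupp x -> cpP (cp_star x) = star (cpP x).
Proof.
move=> /finsupp_bounded [D bx].
have bs : bounded D (co (cp_star x)).
  by move=> k kD; rewrite co_star bx ?star0 // abszN.
rewrite (cpP_sym bs) (cpP_sym bx) star_sum.
under eq_bigr do rewrite co_star.
rewrite -(big_map (fun k : int => - k) xpredT (fun k => star (co x k))).
apply: perm_big; apply: uniq_perm; rewrite ?sym_uniq //.
  by rewrite map_inj_uniq ?sym_uniq //; exact: oppr_inj.
move=> k; rewrite mem_sym; apply/mapP/idP => [[l]|kK].
  by rewrite mem_sym => lK ->; rewrite abszN.
by exists (- k); rewrite ?opprK // mem_sym abszN.
Qed.

Definition psum (eta : zfam zact) (N : nat) : A :=
  \sum_(p < N.*2.+1) rip (eta (p%:Z - N%:Z)) (eta (p%:Z - N%:Z)).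

Lemma iota_psum eta N : iota (psum eta N) = sqsum N (co eta).
Proof.
rewrite (shom_sum iota_hom) /sqsum sum_sym; apply: eq_bigr => p _.
by rewrite [LHS]iota_rip sum_unit.
Qed.

Lemma hsum_fin D (eta : zfam zact) : bounded D (co eta) ->
  hsum_sq eta (E (star (cpP eta) * cpP eta)).
Proof.
move=> be; apply/ncvgP => e e0; exists D => N DN.
rewrite -/(psum eta N) -iota_norm (shomB iota_hom) iota_psum (cpP_sym be).
rewrite sqsum_E; last exact: co_spectral.
rewrite /sqsum (sum_sym_widen DN) ?subrr ?cnorm0 // => k kD.
by rewrite be // mulr0.
Qed.

Lemma sqrt_bound (x : O) (a b : A) : cnorm b <= cnorm x ^+ 2 * cnorm a ->
  Num.sqrt (cnorm b) <= cnorm x * Num.sqrt (cnorm a).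
Proof.
move=> h; rewrite -(ger0_norm (cnorm_ge0 x)) -sqrtr_sqr -sqrtrM ?sqr_ge0 //.
exact: ler_wsqrtr.
Qed.

(** For an infinitely supported eta the square sum of the product must be shown to converge: the
    tail estimate gives this, and the bound on partial sums passes to the limit. *)
Lemma cpP_bound (x : zfam zact) : finsupp x -> lmul_bound x (cnorm (cpP x)).
Proof.
move=> /finsupp_bounded [D bx] eta a ha; have hf := co_spectral x.
have hg := co_spectral eta; rewrite (cpP_sym bx); set X := \sum_(_ <- _) _.
set C := cnorm X ^+ 2; have C0 : 0 <= C by exact: sqr_ge0.
have C1 : 0 < C + 1 by rewrite ltr_wpDl.
have psumE N : iota (psum (cp_mul x eta) N) = sqsum N (conv D (co x) (co eta)).
  by rewrite iota_psum; apply: eq_bigr => k _; rewrite (co_mul _ _ bx).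
have psum_bound N : cnorm (psum (cp_mul x eta) N) <= C * cnorm (psum eta (N + D)).
  by rewrite -!iota_norm psumE iota_psum conv_sqsum_bound.
have tail N M : (N + D <= M)%N ->
    cnorm (psum (cp_mul x eta) M - psum (cp_mul x eta) (N + D)) <=
    C * cnorm (psum eta (M + D) - psum eta N).
  move=> NM; rewrite -!iota_norm !(shomB iota_hom) !psumE !iota_psum.
  exact: conv_sqsum_tail.
have /ncvgP ha' := ha.
have [b hb] : exists b, ncvg (@cnorm R A) (psum (cp_mul x eta)) b.
  apply: cnorm_complete => e e0.
  (* The tail is at most C times twice this error, hence below e / 2; the divisor is C + 1 because C
     may vanish. *)
  have e4 : 0 < e / 4 / (C + 1) by rewrite !divr_gt0.
  have [N hN] := ha' _ e4; exists (N + D)%N.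
  have near M : (N + D <= M)%N ->
      cnorm (psum (cp_mul x eta) M - psum (cp_mul x eta) (N + D)) < e / 2.
    move=> NM; apply: le_lt_trans (tail _ _ NM) _.
    have h1 := hN (M + D)%N (leq_trans (leq_addr _ _) (leq_trans NM (leq_addr _ _))).
    have h2 := hN N (leqnn _).
    have h3 : cnorm (psum eta (M + D) - psum eta N) < e / 4 / (C + 1) + e / 4 / (C + 1).
      apply: le_lt_trans (cnorm_triangle a _ _) _.
      by apply: ltrD => //; rewrite cnorm_distC.
    apply: le_lt_trans (ler_wpM2l C0 (ltW h3)) _.
    have -> : C * (e / 4 / (C + 1) + e / 4 / (C + 1)) = (e / 2) * (C / (C + 1)).
      by field; rewrite gt_eqF.
    by rewrite gtr_pMr ?divr_gt0 // ltr_pdivrMr // mul1r ltrDl.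
  move=> p q Np Nq.
  apply: le_lt_trans (cnorm_triangle (psum (cp_mul x eta) (N + D)) _ _) _.
  rewrite (splitr e); apply: ltrD; first exact: near.
  by rewrite cnorm_distC; exact: near.
exists b; split; first exact: hb.
apply: sqrt_bound; apply/ler_addgt0Pr => e e0.
have e1 : 0 < e / (C + 1) by rewrite divr_gt0.
move/ncvgP: hb => hb; have [N1 h1] := hb _ e1; have [N2 h2] := ha' _ e1.
pose N := maxn N1 N2.
have b1 : cnorm (b - psum (cp_mul x eta) N) < e / (C + 1).
  by rewrite cnorm_distC h1 // leq_maxl.
have a1 : cnorm (psum eta (N + D) - a) < e / (C + 1).
  by apply: h2; rewrite (leq_trans (leq_maxr N1 _)) // leq_addr.
have nb : cnorm b <= e / (C + 1) + cnorm (psum (cp_mul x eta) N).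
  rewrite -[X in cnorm X](subrK (psum (cp_mul x eta) N)).
  by apply: le_trans (cnormD _ _) _; rewrite lerD2r ltW.
have na : cnorm (psum eta (N + D)) <= e / (C + 1) + cnorm a.
  rewrite -[X in cnorm X](subrK a).
  by apply: le_trans (cnormD _ _) _; rewrite lerD2r ltW.
apply: le_trans nb _; apply: le_trans (lerD (lexx _) (psum_bound N)) _.
apply: le_trans (lerD (lexx _) (ler_wpM2l C0 na)) _.
have -> : e / (C + 1) + C * (e / (C + 1) + cnorm a) = C * cnorm a + e.
  by field; rewrite gt_eqF.
exact: lexx.
Qed.

(** Finitely supported vectors suffice as tests: their square sums, and those of their products with
    x, are values of E, so the bound becomes the hypothesis of [fin_norm_le] with c = M^2. *)
Lemma cpP_minimal (x : zfam zact) (M : R) : finsupp x -> 0 <= M ->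
  lmul_bound x M -> cnorm (cpP x) <= M.
Proof.
move=> /finsupp_bounded [D bx] M0 hM; have hf := co_spectral x.
rewrite -(@ler_pXn2r _ 2) ?nnegrE ?cnorm_ge0 //.
rewrite (cpP_sym bx); apply: (@fin_norm_le D); first by exists (co x).
  exact: sqr_ge0.
move=> D' y [g [hg bg ->]]; pose eta := zf hg.
have be : bounded D' (co eta) by move=> k kD; rewrite co_zf bg.
have fx : finsupp x := bounded_finsupp bx.
have bxe : bounded (D + D') (co (cp_mul x eta)).
  by move=> k kD; rewrite (co_mul _ _ bx) (bounded_conv _ be).
have [b [hb]] := hM _ _ (hsum_fin be).
have := ncvg_uniq hb (hsum_fin bxe) => ->.
rewrite cpP_mul //; last exact: bounded_finsupp be.
have eP : cpP eta = \sum_(k <- sym D') g k.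
  by rewrite (cpP_sym be); apply: eq_bigr => k _; exact: co_zf.
rewrite (cpP_sym bx) eP => h.
have h0 (u : A) : 0 <= Num.sqrt (cnorm u) by exact: sqrtr_ge0.
have := h; rewrite -(@ler_pXn2r _ 2) ?nnegrE ?mulr_ge0 //.
by rewrite exprMn !sqr_sqrtr ?cnorm_ge0.
Qed.

Lemma reduced_cpP : @is_reduced_crossed_product R A zact O cpP.
Proof.
split; first split.
- exact: cpP_lin.
- exact: cpP_mul.
- exact: cpP_one.
- exact: cpP_star.
- move=> x fx; split; [exact: cnorm_ge0 | exact: cpP_bound |].
  by move=> M M0 hM; exact: cpP_minimal.
move=> y e e0; have [D [f [hf bf yf]]] := fourier_dense y e0.
have bz : bounded D (co (zf hf)) by move=> k kD; rewrite co_zf bf.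
exists (cpP (zf hf)); split.
  by exists (zf hf) => //; exact: bounded_finsupp bz.
by rewrite (cpP_sym bz); under eq_bigr do rewrite co_zf.
Qed.

End CuntzGauge.

Theorem theoremB (R : realType) (n : nat) (hn : (2 <= n)%N)
    (O : cstarAlg R) (s : 'I_n -> O) (hO : is_cuntz_algebra s)
    (gam : R[i] -> O -> O) (hgam : is_gauge_action s gam)
    (A : cstarAlg R) (iota : A -> O) (hiota : is_inclusion iota)
    (hA : range iota = fixed_points gam)
    (E : O -> A)
    (hE : forall x, is_circle_average (fun z => gam z x) (iota (E x))) :
  [/\ is_cond_exp iota E /\ is_faithful E,
      irreducible_inclusion iota,
      cstar_discrete iota E
    & exists F : zaction A, outer_action F /\
        exists (D : cstarAlg R) (P : zfam F -> D),
          is_reduced_crossed_product P /\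
          exists Phi : O -> D, is_star_iso Phi].
Proof.
split.
- split; first exact: (cond_exp_E hgam hiota hA hE).
  exact: (faithful_E hO hn hgam hiota hE).
- exact: (irreducible_iota hO hn hgam hA).
- exact: (discrete_iota hO hn hgam hiota hA hE).
exists (zact hO hn hgam hiota hA hE); split; first exact: zact_outer.
exists O, (@cpP R n O s hO hn gam hgam A iota hiota hA E hE).
split; first exact: reduced_cpP.
by exists id; split; [split | exists id].
Qed.
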